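(* For metric $k$CP with odd $k\geq 3$, there is a polynomial-time $(3/4-0.25/k)$-approximation algorithm.
   Context: A metric graph is an undirected complete graph $G=(V,E)$ on $n$ vertices with a non-negative edge weight function $w$ satisfying the triangle inequality; the weight of a set of edges is the sum of their weights. A $k$-cycle is a simple cycle on exactly $k$ distinct vertices. When $k$ divides $n$, a $k$-cycle packing is a set of $n/k$ vertex-disjoint $k$-cycles covering all vertices. Metric $k$CP: given a metric graph with $n$ divisible by $k$, find a $k$-cycle packing of maximum total weight. A $\rho$-approximation algorithm outputs on every instance a feasible solution of weight at least $\rho$ times the optimum. *)

(* Defs.v *)
From mathcomp Require Import all_boot all_order all_algebra.

Set Implicit Arguments.
Unset Strict Implicit.
Unset Printing Implicit Defensive.

Import Order.TTheory GRing.Theory Num.Theory.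

Local Open Scope ring_scope.

(* An edge weight function is a symmetric function on ordered pairs; the
   diagonal, which carries no edge, is set to 0, so that the triangle
   inequality for arbitrary x y z amounts to the one on distinct vertices.
   Weights are rational in order to be finite inputs. *)
Record is_metric (n : nat) (w : 'I_n -> 'I_n -> rat) : Prop := IsMetric {
  metric_diag : forall x, w x x = 0;
  metric_sym : forall x y, w x y = w y x;
  metric_ge0 : forall x y, 0 <= w x y;
  metric_triangle : forall x y z, w x z <= w x y + w y z
}.

(* A k-cycle is given by the cyclic sequence of its vertices, the last one
   being joined to the first; for k >= 3 and distinct vertices the edges
   {x, next c x} are k distinct edges. *)
Definition cycle_family (n k : nat) : Type := (n %/ k).-tuple (k.-tuple 'I_n).

Definition vertices n k (P : cycle_family n k) : seq 'I_n :=
  flatten [seq val c | c <- val P].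

(* [uniq] makes every cycle simple and the cycles pairwise disjoint. *)
Definition is_packing n k (P : cycle_family n k) : bool :=
  uniq (vertices P) && [forall x, x \in vertices P].

Definition cycle_weight n (w : 'I_n -> 'I_n -> rat) (c : seq 'I_n) : rat :=
  \sum_(x <- c) w x (next c x).

Definition weight n k (w : 'I_n -> 'I_n -> rat) (P : cycle_family n k) : rat :=
  \sum_(c <- val P) cycle_weight w (val c).

(* The default value 0 is harmless: weights are nonnegative, and packings
   exist whenever k divides n. *)
Definition opt n (k : nat) (w : 'I_n -> 'I_n -> rat) : rat :=
  \big[Order.max/0]_(P : cycle_family n k | is_packing P) weight w P.

(* Random access machine: registers, named in the program, and an unbounded
   memory, both holding natural numbers of arbitrary size. Every elementary
   operation costs one time unit. As there is no multiplication, the bit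
   length of the numbers grows by O(1) per time unit, so that polynomial time
   on this machine is polynomial time on Turing machines. *)
Inductive expr : Type :=
| Const of nat
| Reg of nat
| Mem of expr
| Add of expr & expr
| Sub of expr & expr
| Half of expr.

Inductive cmd : Type :=
| Skip
| SetReg of nat & expr
| SetMem of expr & expr
| Seq of cmd & cmd
| If of expr & cmd & cmd
| While of expr & cmd.

Record state : Type := State { reg : nat -> nat; mem : nat -> nat }.

Fixpoint eval (s : state) (e : expr) : nat :=
  match e with
  | Const a => a
  | Reg r => reg s r
  | Mem e1 => mem s (eval s e1)
  | Add e1 e2 => (eval s e1 + eval s e2)%N
  | Sub e1 e2 => (eval s e1 - eval s e2)%N
  | Half e1 => (eval s e1)./2
  end.

Fixpoint ecost (e : expr) : nat :=
  match e with
  | Const _ | Reg _ => 1%N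
  | Mem e1 | Half e1 => (ecost e1).+1
  | Add e1 e2 | Sub e1 e2 => (ecost e1 + ecost e2).+1
  end.

Definition update (f : nat -> nat) (a v : nat) : nat -> nat :=
  fun b => if b == a then v else f b.

(* [exec c s t s']: started in s, the program c halts in s' after time t.
   Guards are true when nonzero. *)
Inductive exec : cmd -> state -> nat -> state -> Prop :=
| exec_skip s :
    exec Skip s 1 s
| exec_setreg r e s :
    exec (SetReg r e) s (ecost e).+1
         (State (update (reg s) r (eval s e)) (mem s))
| exec_setmem ea ev s :
    exec (SetMem ea ev) s (ecost ea + ecost ev).+1
         (State (reg s) (update (mem s) (eval s ea) (eval s ev)))
| exec_seq c1 c2 s t1 s1 t2 s2 :
    exec c1 s t1 s1 -> exec c2 s1 t2 s2 ->
    exec (Seq c1 c2) s (t1 + t2)%N s2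
| exec_if_true e c1 c2 s t s1 :
    eval s e != 0%N -> exec c1 s t s1 ->
    exec (If e c1 c2) s (ecost e + t).+1 s1
| exec_if_false e c1 c2 s t s1 :
    eval s e = 0%N -> exec c2 s t s1 ->
    exec (If e c1 c2) s (ecost e + t).+1 s1
| exec_while_true e c s t1 s1 t2 s2 :
    eval s e != 0%N -> exec c s t1 s1 -> exec (While e c) s1 t2 s2 ->
    exec (While e c) s (ecost e + t1 + t2).+1 s2
| exec_while_false e c s :
    eval s e = 0%N ->
    exec (While e c) s (ecost e).+1 s.

(* Input and output words are stored in memory from address 0 on, their
   length in register 0; everything else is initially 0. *)
Definition load (xs : seq nat) : state :=
  State (update (fun=> 0%N) 0 (size xs)) (nth 0%N xs).

Definition unload (s : state) : seq nat := mkseq (mem s) (reg s 0).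

Definition runs (A : cmd) (xs : seq nat) (t : nat) (ys : seq nat) : Prop :=
  exists2 s, exec A (load xs) t s & unload s = ys.

(* The number of binary digits of m, with one digit for 0. *)
Definition bitlen (m : nat) : nat := (trunc_log 2 m).+1.

Definition bitsize (xs : seq nat) : nat := \sum_(m <- xs) bitlen m.

(* n followed by the n * n weight matrix, row by row, each entry being given
   as the numerator and the denominator of the reduced fraction. *)
Definition encode_instance n (w : 'I_n -> 'I_n -> rat) : seq nat :=
  n :: flatten [seq [:: `|numq (w x y)|%N; `|denq (w x y)|%N]
               | x <- enum 'I_n, y <- enum 'I_n].

(* The vertices of the cycles, one cycle after the other. *)
Definition encode_packing n k (P : cycle_family n k) : seq nat :=
  [seq val x | x <- vertices P].

Definition polytime_approximation (k : nat) (rho : rat) (A : cmd) : Prop :=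
  exists p : {poly nat},
  forall (n : nat) (w : 'I_n -> 'I_n -> rat), (k %| n)%N -> is_metric w ->
  exists (t : nat) (P : cycle_family n k),
    [/\ runs A (encode_instance w) t (encode_packing P),
        (t <= p.[bitsize (encode_instance w)])%N,
        is_packing P
      & rho * opt k w <= weight w P].

(* Main.v *)
Require Import Defs.
From mathcomp Require Import all_boot all_order all_algebra.
From mathcomp Require Import zify lra ring.

Import Order.TTheory GRing.Theory Num.Theory.

Set Implicit Arguments.
Unset Strict Implicit.
Unset Printing Implicit Defensive.

(** The statement asks for one program on a concrete machine together with a time bound, and this
    shapes the proof. The machine cannot multiply and the weights are fractions, so all of them are
    first multiplied by the product of the denominators; from there on everything is a natural
    number, and the potentials of the Hungarian method have to be kept from becoming negative. A
    constant exceeding the sum of all weights, added off the diagonal, rules out fixed points of the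
    permutation. The programs are written in a small language whose loop counts are fixed on entry:
    they denote total functions, and a polynomial time bound can be read off their syntax.

    In the analysis the average [R] of a block is replaced by the sum of the weights along [n!]
    steps of the permutation. As [n!] is a multiple of every cycle length, averages over all
    rotations become integer sums in which no cycle length occurs.

    The greedy order needs only averages over the rotations of a single block, since the blocks
    before it are already fixed. *)

(* An optimal packing is in particular a permutation without fixed points, so
   its weight is at most that of a maximum weight permutation [sg], which the
   Hungarian method finds. List the cycles of [sg] (the blocks) one after the
   other around a circle, and cut the circle into segments of [k] vertices, each
   closed into a cycle, in one of [k] ways (the rounds). Let [R] be the average
   edge weight of a block. If every block is rotated at random, an edge between
   consecutive vertices of a block has expected weight [R] and, by the triangle
   inequality, an edge between two blocks at least half the larger of their [R],
   hence a quarter of the sum. On average over the rounds, a block of [l < k]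
   vertices thus gets at least [R] times [l - 1/2 - (l - 1) / (2 k)], which is at
   least [(3/4 - 1/(4 k)) l] as [l >= 2], with equality for [l = 2]; longer
   blocks are no worse. Instead of random rotations, the blocks are rotated
   greedily in the order of their labels, each as well as possible with respect
   to the blocks before it: an edge between two blocks is then sure to get half
   the [R] of the later one. The reverse order gives half the [R] of the other,
   so the best of these [2 k] packings is as good as the average. *)

(** * A language with arrays and bounded loops *)

(** Loops with a count known on entry make the semantics a total function, so that correctness
    proofs need no termination argument. *)
Inductive hexpr : Type :=
| EC of nat
| ER of nat
| EA of nat & hexpr
| EAdd of hexpr & hexpr
| ESub of hexpr & hexpr
| EHalf of hexpr.

Inductive hcmd : Type :=
| CSkip
| CSet of nat & hexpr
| CPut of nat & hexpr & hexpr
| CSeq of hcmd & hcmd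
| CIf of hexpr & hcmd & hcmd
| CFor of nat & nat & hcmd.

Record hstate : Type := HState { rg : nat -> nat; ar : nat -> nat -> nat }.

Definition setr (s : hstate) (r v : nat) : hstate :=
  HState (update (rg s) r v) (ar s).

Definition seta (s : hstate) (a i v : nat) : hstate :=
  HState (rg s)
    (fun b => if b == a then fun j => if j == i then v else ar s b j else ar s b).

(* Array 0 is the low part of the memory, of size H, where the input and the
   output live; clamping the index keeps it disjoint from the other arrays. *)
Definition idx (H a i : nat) : nat := if a == 0 then minn i H.-1 else i.

Fixpoint heval (H : nat) (s : hstate) (e : hexpr) : nat :=
  match e with
  | EC v => v
  | ER r => rg s r
  | EA a e1 => ar s a (idx H a (heval H s e1))
  | EAdd e1 e2 => heval H s e1 + heval H s e2
  | ESub e1 e2 => heval H s e1 - heval H s e2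
  | EHalf e1 => (heval H s e1)./2
  end.

Fixpoint den (H : nat) (c : hcmd) (s : hstate) : hstate :=
  match c with
  | CSkip => s
  | CSet r e => setr s r (heval H s e)
  | CPut a e1 e2 => seta s a (idx H a (heval H s e1)) (heval H s e2)
  | CSeq c1 c2 => den H c2 (den H c1 s)
  | CIf e c1 c2 => if heval H s e != 0 then den H c1 s else den H c2 s
  | CFor r m c1 =>
      iter (rg s m)
        (fun s1 => let s2 := den H c1 s1 in setr s2 r (rg s2 r).+1)
        (setr s r 0)
  end.

Fixpoint wr (c : hcmd) : seq nat :=
  match c with
  | CSkip | CPut _ _ _ => [::]
  | CSet r _ => [:: r]
  | CSeq c1 c2 | CIf _ c1 c2 => wr c1 ++ wr c2
  | CFor r _ c1 => r :: wr c1
  end.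

Fixpoint wa (c : hcmd) : seq nat :=
  match c with
  | CSkip | CSet _ _ => [::]
  | CPut a _ _ => [:: a]
  | CSeq c1 c2 | CIf _ c1 c2 => wa c1 ++ wa c2
  | CFor _ _ c1 => wa c1
  end.

Fixpoint bnds (c : hcmd) : seq nat :=
  match c with
  | CSkip | CSet _ _ | CPut _ _ _ => [::]
  | CSeq c1 c2 | CIf _ c1 c2 => bnds c1 ++ bnds c2
  | CFor _ m c1 => m :: bnds c1
  end.

Fixpoint eok (e : hexpr) : bool :=
  match e with
  | EC _ | ER _ => true
  | EA a e1 => (a < 32) && eok e1
  | EAdd e1 e2 | ESub e1 e2 => eok e1 && eok e2
  | EHalf e1 => eok e1
  end.

(** The conditions on loops reconcile [den], which reads the count once on entry, with the machine
    loop, which compares the two registers before every turn. The bound 32 is the stride at which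
    the arrays are interleaved. *)
Fixpoint cok (c : hcmd) : bool :=
  match c with
  | CSkip => true
  | CSet _ e => eok e
  | CPut a e1 e2 => [&& a < 32, eok e1 & eok e2]
  | CSeq c1 c2 => cok c1 && cok c2
  | CIf e c1 c2 => [&& eok e, cok c1 & cok c2]
  | CFor r m c1 => [&& r != m, r \notin wr c1, m \notin wr c1 & cok c1]
  end.

(** * Frames: what a program leaves unchanged *)

Definition frame (rs as_ : seq nat) (s s' : hstate) : Prop :=
  (forall r, r \notin rs -> rg s' r = rg s r) /\
  (forall a, a \notin as_ -> ar s' a = ar s a).

Lemma frame_refl rs as_ s : frame rs as_ s s.
Proof. by []. Qed.

Lemma frame_trans rs as_ s1 s2 s3 :
  frame rs as_ s1 s2 -> frame rs as_ s2 s3 -> frame rs as_ s1 s3.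
Proof.
move=> [r12 a12] [r23 a23]; split=> [r hr|a ha].
  by rewrite r23 // r12.
by rewrite a23 // a12.
Qed.

Lemma frame_sub rs rs' as_ as_' s s' :
  {subset rs <= rs'} -> {subset as_ <= as_'} ->
  frame rs as_ s s' -> frame rs' as_' s s'.
Proof.
move=> hr ha [fr fa]; split=> [r nr|a na]; first by apply/fr/(contra (@hr r)).
by apply/fa/(contra (@ha a)).
Qed.

Lemma frame_setr r v s : frame [:: r] [::] s (setr s r v).
Proof. by split=> // x; rewrite inE /= /update => /negbTE->. Qed.

Lemma den_frame H c s : frame (wr c) (wa c) s (den H c s).
Proof.
elim: c s => [|r e|a e1 e2|c1 IH1 c2 IH2|e c1 IH1 c2 IH2|r m c IH] s //=.
- exact: frame_setr.
- by split=> //= b; rewrite inE => /negbTE->.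
- apply: frame_trans.
    by apply: frame_sub (IH1 s) => x hx; rewrite mem_cat hx.
  by apply: frame_sub (IH2 _) => x hx; rewrite mem_cat hx orbT.
- by case: ifP => _; [apply: frame_sub (IH1 s)|apply: frame_sub (IH2 s)] => x hx;
    rewrite mem_cat hx ?orbT.
- have fr v s' : frame (r :: wr c) (wa c) s' (setr s' r v).
    apply: frame_sub (frame_setr r v s') => // x.
    by rewrite !inE => ->.
  elim: (rg s m) => [|j IHj] /=; first exact: fr.
  apply: frame_trans IHj _; apply: frame_trans _ (fr _ _).
  by apply: frame_sub (IH _) => // x hx; rewrite inE hx orbT.
Qed.

Lemma den_seq H c1 c2 s : den H (CSeq c1 c2) s = den H c2 (den H c1 s).
Proof. by []. Qed.

Lemma den_set H r e s : den H (CSet r e) s = setr s r (heval H s e).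
Proof. by []. Qed.

Lemma den_put H a e1 e2 s :
  den H (CPut a e1 e2) s = seta s a (idx H a (heval H s e1)) (heval H s e2).
Proof. by []. Qed.

Lemma den_if H e c1 c2 s :
  den H (CIf e c1 c2) s = if heval H s e != 0 then den H c1 s else den H c2 s.
Proof. by []. Qed.

Lemma den_skip H s : den H CSkip s = s.
Proof. by []. Qed.

Definition denE := (den_seq, den_set, den_put, den_if, den_skip).

(** The frame handed to the induction step spares the invariants any mention of what the loop does
    not touch. *)
Lemma for_ind H r m c (I : nat -> hstate -> Prop) s :
  r \notin wr c -> m \notin r :: wr c ->
  I 0 (setr s r 0) ->
  (forall i s', i < rg s m -> rg s' r = i -> frame (r :: wr c) (wa c) s s' ->
     I i s' -> I i.+1 (setr (den H c s') r i.+1)) ->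
  I (rg s m) (den H (CFor r m c) s).
Proof.
move=> nr nm I0 IS.
have fr v s' : frame (r :: wr c) (wa c) s' (setr s' r v).
  apply: frame_sub (frame_setr r v s') => // x.
  by rewrite !inE => ->.
have fc s' : frame (r :: wr c) (wa c) s' (den H c s').
  by apply: frame_sub (den_frame H c s') => // x hx; rewrite inE hx orbT.
set f := fun s1 => let s2 := den H c s1 in setr s2 r (rg s2 r).+1.
have main j : j <= rg s m ->
    [/\ I j (iter j f (setr s r 0)), rg (iter j f (setr s r 0)) r = j
      & frame (r :: wr c) (wa c) s (iter j f (setr s r 0))].
  elim: j => [|j IHj] hj /=; first by split=> //; rewrite /= /update eqxx.
  have [Ij rj fj] := IHj (ltnW hj).
  move: (iter j f _) Ij rj fj => s' Ij rj fj; rewrite /f.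
  have -> : rg (den H c s') r = j by case: (den_frame H c s') => ->.
  split; [exact: IS | by rewrite /= /update eqxx |].
  exact: frame_trans fj (frame_trans (fc _) (fr _ _)).
by case: (main _ (leqnn _)).
Qed.

(** * Compilation to the machine *)

Fixpoint shiftl_expr (m : nat) (e : expr) : expr :=
  if m is m'.+1 then Add (shiftl_expr m' e) (shiftl_expr m' e) else e.

Lemma eval_shiftl s m e : eval s (shiftl_expr m e) = 2 ^ m * eval s e.
Proof.
by elim: m => [|m IH] /=; rewrite ?expn0 ?mul1n // IH addnn -mul2n mulnA -expnS.
Qed.

(* Register 0 of the machine holds H; the arrays 1 to 31 are interleaved above
   the low part of the memory, so that none of them needs a size. *)
Definition addr (a : nat) (e : expr) : expr :=
  if a == 0 then Defs.Sub e (Defs.Sub e (Defs.Sub (Reg 0) (Const 1)))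
  else Add (Reg 0) (Add (shiftl_expr 5 e) (Const a)).

Fixpoint ecomp (e : hexpr) : expr :=
  match e with
  | EC v => Const v
  | ER r => Reg r.+1
  | EA a e1 => Defs.Mem (addr a (ecomp e1))
  | EAdd e1 e2 => Add (ecomp e1) (ecomp e2)
  | ESub e1 e2 => Defs.Sub (ecomp e1) (ecomp e2)
  | EHalf e1 => Half (ecomp e1)
  end.

Definition for_guard (r m : nat) : expr := Defs.Sub (Reg m.+1) (Reg r.+1).

Definition for_step (r : nat) : expr := Add (Reg r.+1) (Const 1).

Fixpoint compile (c : hcmd) : cmd :=
  match c with
  | CSkip => Skip
  | CSet r e => SetReg r.+1 (ecomp e)
  | CPut a e1 e2 => SetMem (addr a (ecomp e1)) (ecomp e2)
  | CSeq c1 c2 => Seq (compile c1) (compile c2)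
  | CIf e c1 c2 => If (ecomp e) (compile c1) (compile c2)
  | CFor r m c1 =>
      Seq (SetReg r.+1 (Const 0))
          (While (for_guard r m) (Seq (compile c1) (SetReg r.+1 (for_step r))))
  end.

Definition sim (H : nat) (s : state) (h : hstate) : Prop :=
  [/\ reg s 0 = H, forall r, reg s r.+1 = rg h r,
      forall i, i < H -> Defs.mem s i = ar h 0 i
    & forall a i, 0 < a < 32 -> Defs.mem s (H + (32 * i + a)) = ar h a i].

(** With truncated subtraction, [e - (e - (H - 1))] is the minimum of [e] and [H - 1], which is the
    clamping of [idx]. *)
Lemma eval_addr H s h a e : 0 < H -> sim H s h -> a < 32 ->
  eval s (addr a e) =
    if a == 0 then idx H a (eval s e) else H + (32 * idx H a (eval s e) + a).
Proof.
move=> H0 [s0 _ _ _] ha; rewrite /addr /idx; case: eqP => [_|_].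
  by rewrite /= s0; lia.
rewrite -[LHS]/(reg s 0 + (eval s (shiftl_expr 5 e) + a)).
by rewrite s0 eval_shiftl.
Qed.

Lemma eval_ecomp H s h e : 0 < H -> sim H s h -> eok e ->
  eval s (ecomp e) = heval H h e.
Proof.
move=> H0 ss; have [s0 sr sl sa] := ss.
elim: e => [v|r|a e IH|e1 IH1 e2 IH2|e1 IH1 e2 IH2|e IH] /=.
- by [].
- by rewrite sr.
- case/andP=> ha /IH{}IH; rewrite (eval_addr _ H0 ss ha) IH.
  case: (posnP a) => [->|a0] /=; first by rewrite sl // /idx /=; lia.
  by rewrite sa // a0.
- by case/andP=> /IH1-> /IH2->.
- by case/andP=> /IH1-> /IH2->.
- by move/IH->.
Qed.

Lemma sim_setr H s h r v : sim H s h ->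
  sim H (State (update (reg s) r.+1 v) (Defs.mem s)) (setr h r v).
Proof. by move=> [s0 sr sl sa]; split=> //= x; rewrite /update eqSS sr. Qed.

(** For [0 < a < 32] the address [H + (32 * i + a)] lies above the low part and determines both [a]
    and [i], so a write disturbs no other cell. *)
Lemma sim_seta H s h a i v : 0 < H -> sim H s h -> a < 32 ->
  sim H (State (reg s) (update (Defs.mem s)
    (if a == 0 then idx H a i else H + (32 * idx H a i + a)) v))
    (seta h a (idx H a i) v).
Proof.
move=> H0 [s0 sr sl sa] ha; split=> //= [j hj|b j hb]; rewrite /update.
  case: (posnP a) => [->|a0] /=; first by rewrite sl.
  rewrite [0 == a]ltn_eqF //=.
  by case: eqP => [e|_]; [lia|rewrite sl].
case: (posnP a) => [a0|a0].
  have b0 : (b == 0) = false by apply: gtn_eqF; case/andP: hb.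
  rewrite a0 b0 /=.
  case: eqP => [e|_]; [move: e; rewrite /idx /=; lia|by rewrite sa].
case: (b =P a) => [->|nab] /=.
  case: (j =P idx H a i) => [->|nij]; first by rewrite eqxx.
  by case: eqP => [e|_]; [lia|rewrite sa ?a0].
by case: eqP => [e|_]; [lia|rewrite sa].
Qed.

Section Poly.
Local Open Scope ring_scope.

(* A time bound in terms of a common bound 'X on the lengths of the loops. *)
Fixpoint tpol (c : hcmd) : {poly nat} :=
  match c with
  | CSkip => 1%:P
  | CSet r e => (ecost (ecomp e)).+1%:P
  | CPut a e1 e2 => (ecost (addr a (ecomp e1)) + ecost (ecomp e2)).+1%:P
  | CSeq c1 c2 => tpol c1 + tpol c2
  | CIf e c1 c2 => (ecost (ecomp e)).+1%:P + (tpol c1 + tpol c2)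
  | CFor r m c1 => (2 + (ecost (for_guard r m)).+1)%N%:P
      + 'X * ((ecost (for_guard r m)).+1%:P
              + (tpol c1 + (ecost (for_step r)).+1%:P))
  end.

End Poly.

Definition tbound (c : hcmd) (N : nat) : nat := (tpol c).[N]%R.

Lemma tboundE N :
  [/\ tbound CSkip N = 1,
   (forall r e, tbound (CSet r e) N = (ecost (ecomp e)).+1),
   (forall a e1 e2, tbound (CPut a e1 e2) N =
      (ecost (addr a (ecomp e1)) + ecost (ecomp e2)).+1),
   (forall c1 c2, tbound (CSeq c1 c2) N = tbound c1 N + tbound c2 N) &
   (forall e c1 c2, tbound (CIf e c1 c2) N =
      (ecost (ecomp e)).+1 + (tbound c1 N + tbound c2 N))].
Proof.
split=> *; rewrite /tbound /=.
- by rewrite hornerC.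
- by rewrite hornerC.
- by rewrite hornerC.
- by rewrite hornerD.
- by rewrite !hornerD hornerC.
Qed.

Lemma tbound_for r m c N : tbound (CFor r m c) N =
  2 + (ecost (for_guard r m)).+1 +
  N * ((ecost (for_guard r m)).+1 + (tbound c N + (ecost (for_step r)).+1)).
Proof. by rewrite /tbound /= hornerD hornerM hornerX !hornerD !hornerC. Qed.

(** Registers that bound loops are never written, so the bound [N] on their initial values is still
    valid inside nested loops. *)
Lemma compile_exec H N c s h :
  0 < H -> sim H s h -> cok c ->
  (forall m, m \in bnds c -> rg h m <= N) ->
  (forall m, m \in bnds c -> m \notin wr c) ->
  exists t s', [/\ exec (compile c) s t s', sim H s' (den H c h) & t <= tbound c N].
Proof.
move=> H0; have [B1 B2 B3 B4 B5] := tboundE N.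
elim: c s h => [|r e|a e1 e2|c1 IH1 c2 IH2|e c1 IH1 c2 IH2|r m c IH] s h ss /=.
- by move=> _ _ _; exists 1, s; split; [constructor| |rewrite B1].
- move=> ok _ _; exists (ecost (ecomp e)).+1; eexists; split.
  + by constructor.
  + by rewrite (eval_ecomp H0 ss ok); apply: sim_setr.
  + by rewrite B2.
- case/and3P=> ha ok1 ok2 _ _; eexists; eexists; split.
  + by constructor.
  + rewrite (eval_ecomp H0 ss ok2) (eval_addr _ H0 ss ha) (eval_ecomp H0 ss ok1).
    exact: sim_seta.
  + by rewrite B3.
- case/andP=> ok1 ok2 hN hw.
  have [t1 [s1 [x1 ss1 ht1]]] : exists t s',
      [/\ exec (compile c1) s t s', sim H s' (den H c1 h) & t <= tbound c1 N].
    apply: IH1 => // m hm; first by apply: hN; rewrite mem_cat hm.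
    by move: (hw m); rewrite !mem_cat hm /= => /(_ isT); rewrite negb_or => /andP[? ?].
  have [t2 [s2 [x2 ss2 ht2]]] : exists t s',
      [/\ exec (compile c2) s1 t s', sim H s' (den H c2 (den H c1 h)) & t <= tbound c2 N].
    apply: IH2 => // m hm.
      have [frm _] := den_frame H c1 h.
      rewrite frm; first by apply: hN; rewrite mem_cat hm orbT.
      by move: (hw m); rewrite !mem_cat hm orbT /= => /(_ isT); rewrite negb_or => /andP[? ?].
    by move: (hw m); rewrite !mem_cat hm orbT /= => /(_ isT); rewrite negb_or => /andP[? ?].
  exists (t1 + t2), s2; split=> //; first exact: exec_seq x1 x2.
  by rewrite B4; lia.
- case/and3P=> oke ok1 ok2 hN hw; rewrite -(eval_ecomp H0 ss oke).
  case: (boolP (eval s (ecomp e) != 0)) => [nz|/negPn/eqP z].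
    have [t1 [s1 [x1 ss1 ht1]]] : exists t s',
        [/\ exec (compile c1) s t s', sim H s' (den H c1 h) & t <= tbound c1 N].
      apply: IH1 => // m hm; first by apply: hN; rewrite mem_cat hm.
      by move: (hw m); rewrite !mem_cat hm /= => /(_ isT); rewrite negb_or => /andP[? ?].
    exists (ecost (ecomp e) + t1).+1, s1; split=> //; first exact: exec_if_true.
    by rewrite B5; lia.
  have [t1 [s1 [x1 ss1 ht1]]] : exists t s',
      [/\ exec (compile c2) s t s', sim H s' (den H c2 h) & t <= tbound c2 N].
    apply: IH2 => // m hm; first by apply: hN; rewrite mem_cat hm orbT.
    by move: (hw m); rewrite !mem_cat hm orbT /= => /(_ isT); rewrite negb_or => /andP[? ?].
  exists (ecost (ecomp e) + t1).+1, s1; split=> //; first exact: exec_if_false.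
  by rewrite B5; lia.
- case/and4P=> nrm nr nm ok hN hw.
  set g := ecost (for_guard r m).
  set f := fun h1 => setr (den H c h1) r (rg (den H c h1) r).+1.
  have hfr h1 : [/\ rg (f h1) r = (rg h1 r).+1 & forall x, x \notin r :: wr c ->
      rg (f h1) x = rg h1 x].
    have [fr _] := den_frame H c h1.
    split=> [|x]; rewrite /f /= /update; first by rewrite eqxx fr.
    by rewrite inE; case: eqP => //= _; apply: fr.
  (* The induction is on the number [d] of turns that remain, so that the machine loop and [iter]
     both unfold at their first turn. *)
  have loop d s1 h1 : sim H s1 h1 -> rg h1 m = rg h m -> rg h1 r + d = rg h m ->
      (forall x, x \in bnds c -> rg h1 x <= N) ->
    exists t s', [/\ exec (While (for_guard r m)
        (Seq (compile c) (SetReg r.+1 (for_step r)))) s1 t s',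
      sim H s' (iter d f h1)
      & t <= g.+1 + d * (g.+1 + (tbound c N + (ecost (for_step r)).+1))].
    elim: d s1 h1 => [|d IHd] s1 h1 ss1 hm hd hb.
      exists g.+1, s1; split; [ | by [] | exact: leq_addr].
      by apply: exec_while_false => /=; case: ss1 => _ sr _ _; rewrite !sr; lia.
    have [t2 [s2 [x2 ss2 ht2]]] : exists t s',
        [/\ exec (compile c) s1 t s', sim H s' (den H c h1) & t <= tbound c N].
      apply: IH => // x hx; have := hw x.
      by rewrite !inE hx orbT negb_or => /(_ isT)/andP[].
    set s3 := State (update (reg s2) r.+1 (eval s2 (for_step r))) (Defs.mem s2).
    have x3 : exec (SetReg r.+1 (for_step r)) s2 (ecost (for_step r)).+1 s3.
      by constructor.
    have ss3 : sim H s3 (f h1).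
      suff -> : s3 = State (update (reg s2) r.+1 (rg (den H c h1) r).+1) (Defs.mem s2).
        exact: sim_setr.
      by rewrite /s3 /=; case: ss2 => _ -> _ _; rewrite addn1.
    have [fr fx] := hfr h1.
    have [t4 [s4 [x4 ss4 ht4]]] : exists t s', [/\ exec (While (for_guard r m)
        (Seq (compile c) (SetReg r.+1 (for_step r)))) s3 t s',
      sim H s' (iter d f (f h1))
      & t <= g.+1 + d * (g.+1 + (tbound c N + (ecost (for_step r)).+1))].
      apply: IHd => //.
      - by rewrite fx // inE negb_or eq_sym nrm.
      - by rewrite fr -hd addSnnS.
      - move=> x hx; rewrite fx; first exact: hb.
        by apply: hw; rewrite inE hx orbT.
    exists (g + (t2 + (ecost (for_step r)).+1) + t4).+1, s4.
    rewrite iterSr; split=> //; last by rewrite mulSn; lia.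
    apply: exec_while_true x4; last exact: exec_seq x2 x3.
    by rewrite /=; case: ss1 => _ sr _ _; rewrite !sr; lia.
  have [t [s' [x ss' ht]]] := loop (rg h m) _ _ (sim_setr r 0 ss)
    ltac:(by rewrite /= /update eq_sym (negbTE nrm))
    ltac:(by rewrite /= /update eqxx)
    ltac:(move=> x hx; rewrite /= /update; case: ifP => // _;
          by apply: hN; rewrite inE hx orbT).
  (* Setting the loop register to 0 costs 2. *)
  exists (2 + t), s'; split=> //.
    apply: exec_seq x; exact: (exec_setreg r.+1 (Const 0)).
  rewrite tbound_for -/g.
  have hmN : rg h m <= N by apply: hN; rewrite mem_head.
  by apply: leq_trans (leq_add (leqnn 2) ht) _; rewrite -addnA !leq_add2l leq_mul2r hmN orbT.
Qed.

(** * Sums over initial segments and over blocks *)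

Lemma leq_sum_nat m n (F G : nat -> nat) :
  (forall i, m <= i < n -> F i <= G i) ->
  \sum_(m <= i < n) F i <= \sum_(m <= i < n) G i.
Proof.
move=> h; rewrite big_nat_cond [leqRHS]big_nat_cond.
by apply: leq_sum => i; rewrite andbT; apply: h.
Qed.

(** * Permutations of an initial segment, given by functions that are arbitrary beyond it, as array
    contents are *)

Definition inj_below (n : nat) (f : nat -> nat) : Prop :=
  (forall i, i < n -> f i < n) /\
  (forall i j, i < n -> j < n -> f i = f j -> i = j).

Lemma inj_below_perm n f : inj_below n f ->
  perm_eq (map f (index_iota 0 n)) (index_iota 0 n).
Proof.
move=> [fb fi].
have u : uniq (map f (index_iota 0 n)).
  rewrite map_inj_in_uniq ?iota_uniq // => i j; rewrite !mem_index_iota.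
  by move=> /andP[_ hi] /andP[_ hj]; apply: fi.
have s : {subset map f (index_iota 0 n) <= index_iota 0 n}.
  by move=> x /mapP[i]; rewrite !mem_index_iota => /andP[_ /fb hi] ->.
have [|_ e] := uniq_min_size u s; first by rewrite size_map.
by apply: uniq_perm; rewrite ?iota_uniq.
Qed.

Lemma inj_below_onto n f y : inj_below n f -> y < n ->
  exists2 x, x < n & f x = y.
Proof.
move=> /inj_below_perm/perm_mem/(_ y) e hy.
have /mapP[x] : y \in map f (index_iota 0 n) by rewrite e mem_index_iota.
by rewrite mem_index_iota => /andP[_ hx] ->; exists x.
Qed.

Lemma sum_inj_below n f (F : nat -> nat) : inj_below n f ->
  \sum_(0 <= i < n) F (f i) = \sum_(0 <= i < n) F i.
Proof.
by move=> hf; rewrite -[RHS](perm_big _ (inj_below_perm hf)) big_map.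
Qed.

Lemma inj_below_iter n f q : inj_below n f -> inj_below n (iter q f).
Proof.
move=> [fb fi]; elim: q => [|q [IHb IHi]]; first by split.
split=> [i hi|i j hi hj] /=; first exact/fb/IHb.
by move/(fi _ _ (IHb _ hi) (IHb _ hj))/(IHi _ _ hi hj).
Qed.

Lemma modn_val n a : 0 < n -> a < n + n ->
  a %% n = if a < n then a else a - n.
Proof.
move=> n0 ha; case: ltnP => h; first by rewrite modn_small.
by rewrite -{1}(subnK h) modnDr modn_small //; lia.
Qed.

Lemma inj_below_rot n d : d <= n -> inj_below n (fun i => (i + d) %% n).
Proof.
move=> hd; split=> [i hi|i j hi hj]; first by rewrite ltn_pmod; lia.
by rewrite !modn_val; try lia; case: ifP; case: ifP; lia.
Qed.

Lemma sum_by_label n (bl F : nat -> nat) : (forall i, i < n -> bl i < n) ->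
  \sum_(0 <= i < n) F i = \sum_(0 <= s < n) \sum_(0 <= i < n | bl i == s) F i.
Proof.
move=> hb; under [RHS]eq_bigr do rewrite big_mkcond.
rewrite exchange_big_nat /=; apply: eq_big_nat => i /andP[_ /hb hi].
rewrite (bigD1_seq (bl i)) ?mem_index_iota ?iota_uniq //= eqxx big1 ?addn0 //.
by move=> s /negbTE; rewrite eq_sym => ->.
Qed.

Lemma sum_interval n s t (F : nat -> nat) : t <= n ->
  \sum_(0 <= i < n | s <= i < t) F i = \sum_(s <= i < t) F i.
Proof.
move=> tn; rewrite [RHS](@big_nat_widenl _ _ _ s 0) // [RHS](@big_nat_widen _ _ _ 0 t n) //.
Qed.

Lemma sum_ge2 s t j (f : nat -> nat) :
  s <= j -> j.+1 < t -> 0 < f j -> 0 < f j.+1 -> 2 <= \sum_(s <= i < t) f i.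
Proof.
move=> sj jt f0 f1.
rewrite (@big_cat_nat _ _ _ j) //=; last by lia.
rewrite (@big_ltn _ _ _ j t) ?(ltnW jt) // (@big_ltn _ _ _ j.+1 t) //=.
lia.
Qed.

Lemma sum_point s t j : s <= j < t -> \sum_(s <= i < t) (i == j) = 1.
Proof.
move=> hj; rewrite (bigD1_seq j) ?mem_index_iota ?iota_uniq //= eqxx big1 //.
by move=> i /negbTE->.
Qed.

(** * Blocks are intervals *)

Section Blocks.

(* [bl i] is the first position of the block of i. *)
Variables (n : nat) (bl : nat -> nat).
Hypothesis bl_start : forall i, i < n -> bl i = i \/ (0 < i /\ bl i = bl i.-1).
Hypothesis bl_two : forall i, i < n -> exists j, [/\ j < n, j <> i & bl j = bl i].

(** A position either starts a block or inherits the label of its predecessor. *)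
Lemma bl_fill i : i < n -> bl i <= i /\ forall m, bl i <= m <= i -> bl m = bl i.
Proof.
elim: i => [|i IH] hi.
  by have [h|[]//] := bl_start hi; rewrite h; split=> // m; rewrite leqn0 => /eqP->.
have [h|[_ h]] := bl_start hi.
  split=> [|m]; first by rewrite h.
  by rewrite {1}h => hm; congr bl; lia.
move: h => /= h; have [h1 h2] := IH (ltnW hi); rewrite h; split=> [|m hm]; first lia.
have [->//|ne] := eqVneq m i.+1; apply: h2; lia.
Qed.

(** [t] is one past the last position with the label; [bl_fill] at that position leaves no gap. *)
Lemma block_interval i : i < n -> exists2 t, t <= n &
  forall j, j < n -> (bl j == bl i) = (bl i <= j < t).
Proof.
move=> hi.
have ex : exists j, (j < n) && (bl j == bl i) by exists i; rewrite hi eqxx.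
have ub j : (j < n) && (bl j == bl i) -> j <= n by lia.
case: (ex_maxnP ex ub) => m /andP[hm /eqP em] mmax.
exists m.+1 => // j hj; apply/eqP/idP => [e|/andP[h1 h2]].
  have := mmax j; rewrite hj e eqxx => /(_ isT).
  by have [] := bl_fill hj; rewrite e; lia.
by have [_ f] := bl_fill hm; rewrite -em; apply: f; rewrite em; lia.
Qed.

End Blocks.

(** * Counting the edges of all the rounds *)

(** The successor in the [k]-cycles formed by the positions [q * k] to [q * k + k - 1]. *)
Definition nx (k i : nat) : nat := if k %| i.+1 then i.+1 - k else i.+1.

Lemma nx_lt n k i : k %| n -> i < n -> nx k i < n.
Proof.
rewrite /nx => kn hi; case: ifP => h; first by case: k kn h => [|k]; lia.
have : i.+1 != n by apply/eqP => e; rewrite e kn in h.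
lia.
Qed.

(* Four times the expected weight, over all rotations of the blocks, that the
   edge ij is sure to have; [R] is the average weight per vertex of a block. *)
Definition edge_val (n : nat) (bl R : nat -> nat) (i j : nat) : nat :=
  if bl i != bl j then R i + R j else if j == i.+1 %% n then 4 * R i else 0.

Lemma dvdn_sub_eq k m r : r < k -> k <= m -> (k %| m - r) = (r == m %% k).
Proof.
move=> hr hm; apply/idP/eqP => [/dvdnP[q e]|->].
  have -> : m = q * k + r by lia.
  by rewrite modnMDl modn_small.
by rewrite {1}(divn_eq m k) addnK dvdn_mull.
Qed.

(** On the circle, the edge leaving [j] is either the circle edge or, at the end of a segment, the
    closing edge, which goes back by [k - 1], hence forward by [n + 1 - k]. *)
Lemma edge_val_rot n k bl R r i : 0 < k -> k %| n -> i < n -> r < k ->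
  let j := (i + r) %% n in
  edge_val n (fun i => bl ((i + r) %% n)) (fun i => R ((i + r) %% n)) i (nx k i) =
  edge_val n bl R j (if k %| i.+1 then (j + (n.+1 - k)) %% n else j.+1 %% n).
Proof.
move=> k0 kn hi hr j.
have n0 : 0 < n by lia.
have kn' : k <= n by apply: dvdn_leq.
have e : (nx k i + r) %% n = if k %| i.+1 then (j + (n.+1 - k)) %% n else j.+1 %% n.
  rewrite /nx /j; case: ifP => h.
    have hk : k <= i.+1 by apply: dvdn_leq.
    by rewrite modnDml -(modnDr (i.+1 - k + r)); congr (_ %% _); lia.
  by rewrite -[in RHS]addn1 modnDml; congr (_ %% _); lia.
rewrite /edge_val e -/j; case: ifP => // _; congr (if _ then _ else _).
rewrite -e /j -[(_ %% _).+1]addn1 modnDml addnAC addn1.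
have hnx := nx_lt kn hi.
apply/eqP/eqP => [->|]; first by rewrite modnDml.
have hs : i.+1 %% n < n by rewrite ltn_pmod.
have [_ inj] := @inj_below_rot n r ltac:(lia).
by move=> h; apply: inj => //; rewrite h modnDml.
Qed.

(** Exactly one of the [k] rounds ends a segment at a given [j]: the circle edge leaving [j] occurs
    [k - 1] times and the closing edge once. *)
Lemma sum_edge_val_rot n k bl R : 0 < k -> k %| n -> 0 < n ->
  \sum_(0 <= r < k) \sum_(0 <= i < n)
     edge_val n (fun i => bl ((i + r) %% n)) (fun i => R ((i + r) %% n)) i (nx k i) =
  \sum_(0 <= j < n) (k.-1 * edge_val n bl R j (j.+1 %% n)
                     + edge_val n bl R j ((j + (n.+1 - k)) %% n)).
Proof.
move=> k0 kn n0; have kn' : k <= n by apply: dvdn_leq.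
(* In round [r] the circle position [j] is the position [j - r] modulo [n] of the segments. Adding
   [n] avoids a truncated difference and is harmless as [k] divides [n]. *)
pose F r j := if k %| (j + n).+1 - r then edge_val n bl R j ((j + (n.+1 - k)) %% n)
  else edge_val n bl R j (j.+1 %% n).
transitivity (\sum_(0 <= r < k) \sum_(0 <= j < n) F r j).
  apply: eq_big_nat => r /andP[_ hr].
  rewrite -(sum_inj_below _ (@inj_below_rot n (n - r) _)); last by lia.
  apply: eq_big_nat => j /andP[_ hj].
  rewrite edge_val_rot ?ltn_pmod //.
  have -> : ((j + (n - r)) %% n + r) %% n = j.
    by rewrite modnDml -addnA subnK ?modnDr ?modn_small; lia.
  rewrite /F.
  have -> : (k %| ((j + (n - r)) %% n).+1) = (k %| (j + n).+1 - r).
    have -> : (j + n).+1 - r = (j + (n - r)).+1 by lia.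
    rewrite [in RHS](divn_eq (j + (n - r)) n) -addnS dvdn_addr //.
    exact: dvdn_mull.
  by case: ifP.
rewrite exchange_big_nat; apply: eq_big_nat => j hj /=.
rewrite (eq_big_nat _ _ (F2 := fun r => if r == (j + n).+1 %% k then
   edge_val n bl R j ((j + (n.+1 - k)) %% n) else edge_val n bl R j (j.+1 %% n))); last first.
  by move=> r /andP[_ hr]; rewrite /F dvdn_sub_eq //; lia.
rewrite (bigD1_seq ((j + n).+1 %% k)) ?mem_index_iota ?iota_uniq ?ltn_pmod //= eqxx.
rewrite addnC; congr (_ + _).
rewrite (eq_bigr (fun=> edge_val n bl R j (j.+1 %% n))); last first.
  by move=> r /negbTE->.
rewrite big_const_seq iter_addn_0 mulnC; congr (_ * _).
have := count_predC (pred1 ((j + n).+1 %% k)) (index_iota 0 k).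
rewrite count_uniq_mem ?iota_uniq // mem_index_iota ltn_pmod // size_iota /=.
rewrite subn0 => e; rewrite -[in RHS]e add1n /=.
by apply: eq_count.
Qed.

Section Counting.

Variables (n k : nat) (bl R : nat -> nat).
Hypotheses (k3 : 3 <= k) (n0 : 0 < n) (kn : k %| n).
Hypothesis bl_start : forall i, i < n -> bl i = i \/ (0 < i /\ bl i = bl i.-1).
Hypothesis bl_two : forall i, i < n -> exists j, [/\ j < n, j <> i & bl j = bl i].
Hypothesis R_bl : forall i j, i < n -> j < n -> bl i = bl j -> R i = R j.

Let sc d j := (j + d) %% n.
Let diff d j : nat := bl j != bl (sc d j).

(** An edge that leaves a block by the shift [d] leaves, seen from its other end, by the shift
    [n - d]. *)
Lemma sum_diff d (F : nat -> nat) : d <= n ->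
  \sum_(0 <= j < n) diff d j * F (sc d j) = \sum_(0 <= j < n) diff (n - d) j * F j.
Proof.
move=> hd; rewrite -[RHS](sum_inj_below _ (inj_below_rot hd)).
apply: eq_big_nat => j /andP[_ hj]; congr (_ * _); rewrite /diff /sc.
by rewrite modnDml -addnA subnKC // modnDr (modn_small hj) eq_sym.
Qed.

(** The value [R i + R j] of an edge between two blocks is shared out to its two ends. Edges inside
    a block are counted as 0, whence only an inequality. *)
Lemma sum_edge_val d : 0 < d <= n ->
  \sum_(0 <= j < n) (diff d j + diff (n - d) j) * R j <=
  \sum_(0 <= j < n) edge_val n bl R j (sc d j).
Proof.
move=> hd; under eq_bigr do rewrite mulnDl.
rewrite big_split /= -sum_diff; last by lia.
rewrite -big_split /=; apply: leq_sum => j _; rewrite /edge_val /diff.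
by case: eqP => //= _; lia.
Qed.

(** For the circle edges nothing is lost: inside a block they have the full value [4 * R]. *)
Lemma sum_edge_val1 :
  \sum_(0 <= j < n) (4 * (1 - diff 1 j) + diff 1 j + diff n.-1 j) * R j =
  \sum_(0 <= j < n) edge_val n bl R j (sc 1 j).
Proof.
under eq_bigr do rewrite mulnDl.
rewrite big_split /= -subn1 -sum_diff; last by lia.
rewrite -big_split /=; apply: eq_big_nat => j hj; rewrite /edge_val /diff /sc addn1 eqxx.
by case: eqP => //= _; lia.
Qed.

(** A vertex outside the block shares its own block with a second one, so the outside is empty or
    has at least two vertices. *)
Lemma block_geometry i : i < n -> exists t, [/\ t <= n, bl i + 2 <= t,
  (forall j, j < n -> (bl j == bl i) = (bl i <= j < t)) &
  (bl i = 0 /\ t = n) \/ t - bl i + 2 <= n].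
Proof.
move=> hi; have [t tn ht] := block_interval bl_start hi.
have two m : m < n -> exists m', [/\ m' < n, m' <> m & bl m' = bl m] by apply: bl_two.
have hb : bl i < n by have [h _] := bl_fill bl_start hi; lia.
have t2 : bl i + 2 <= t.
  have [m [hm ne e]] := two _ hi.
  by have := ht _ hi; have := ht _ hm; rewrite e !eqxx; lia.
exists t; split=> //.
case: (leqP (t - bl i + 2) n) => [|big]; [by right|left].
have out m : m < n -> ~~ (bl i <= m < t) -> False.
  move=> hm nm; have [m' [hm' ne e]] := two _ hm.
  have := ht _ hm'; have := ht _ hm; rewrite e => -> h.
  by lia.
case: (posnP (bl i)) => [b0|b0].
  split=> //; apply/eqP; rewrite eqn_leq tn leqNgt; apply/negP => ht'.
  by apply: (out t ht'); lia.
by case: (out 0 n0); lia.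
Qed.

Lemma block_diff s t d : t <= n -> s + 2 <= t -> t - s + 2 <= n ->
  (forall j, j < n -> (bl j == s) = (s <= j < t)) -> 2 <= d -> d + 2 <= n ->
  2 <= \sum_(s <= j < t) diff d j.
Proof.
move=> tn st hl hb d2 dn.
(* The two vertices sent by the shift to the positions following
   [s + max d (t - s)] leave the block. *)
have out j : s <= j < t -> s + maxn d (t - s) <= j + d <= (s + maxn d (t - s)).+1 ->
    0 < diff d j.
  move=> hj hd; rewrite /diff lt0b.
  have hjn : j < n by lia.
  have -> : bl j = s by apply/eqP; rewrite hb.
  rewrite eq_sym hb; last by rewrite ltn_pmod.
  rewrite /sc modn_val //; last by lia.
  by case: ifP => h; lia.
apply: (@sum_ge2 _ _ (s + maxn d (t - s) - d)); try lia; apply: out; lia.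
Qed.

(** Only the last vertex of a block leaves it by a step forward, and only the first by a step
    backward, which is the shift [n - 1]. *)
Lemma block_ends s t : t <= n -> s + 2 <= t -> t - s + 2 <= n ->
  (forall j, j < n -> (bl j == s) = (s <= j < t)) ->
  \sum_(s <= j < t) diff 1 j = 1 /\ \sum_(s <= j < t) diff n.-1 j = 1.
Proof.
move=> tn st hl hb.
have bE j : s <= j < t -> bl j = s by move=> h; apply/eqP; rewrite hb //; lia.
split.
  rewrite -[RHS](@sum_point s t t.-1); last by lia.
  apply: eq_big_nat => j hj; rewrite /diff bE // eq_sym hb ?ltn_pmod //.
  rewrite /sc modn_val //; last by lia.
  by case: ifP => h; lia.
rewrite -[RHS](@sum_point s t s); last by lia.
apply: eq_big_nat => j hj; rewrite /diff bE // eq_sym hb ?ltn_pmod //.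
rewrite /sc modn_val //; last by lia.
by case: ifP => h; lia.
Qed.

(** The coefficient of [R j] once every edge is shared out to its ends: [k - 1] times the circle
    edges at [j], and once the closing edges at [j]. For [k = n] the closing shift [n + 1 - k] is 1,
    so the closing edges are circle edges as well. *)
Let weightof j := k.-1 * (4 * (1 - diff 1 j) + diff 1 j + diff n.-1 j) +
  (if k == n then 4 * (1 - diff 1 j) + diff 1 j + diff n.-1 j
   else diff (n.+1 - k) j + diff k.-1 j).

(** This inequality is the origin of the ratio. A block that fills the circle has no boundary edges,
    and [4 * (k - 1)] is at least [3 * k - 1]; the other blocks lose 2 on their circle edges and
    regain part of it from closing edges that leave them. *)
Lemma block_weight i : i < n ->
  \sum_(0 <= j < n | bl j == bl i) (3 * k - 1) <=
  \sum_(0 <= j < n | bl j == bl i) weightof j.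
Proof.
move=> hi; have [t [tn st hb dich]] := block_geometry hi.
have sumE F : \sum_(0 <= j < n | bl j == bl i) F j = \sum_(bl i <= j < t) F j.
  rewrite -(sum_interval _ _ tn) big_nat_cond [RHS]big_nat_cond.
  by apply: eq_bigl => j; case: (ltnP j n) => hj; rewrite ?andbF //= hb.
rewrite !sumE; case: dich => [[s0 tE]|far].
  apply: leq_sum_nat => j hj; rewrite /weightof.
  have hd d : diff d j = 0.
    rewrite /diff (eqP (_ : bl j == bl i)); last by rewrite hb; lia.
    rewrite eq_sym hb ?ltn_pmod // s0 tE /= ltn_pmod //.
  by rewrite !hd; case: ifP; lia.
have [E1 E2] := block_ends tn st far hb.
rewrite sum_nat_const_nat /weightof big_split /= -big_distrr /=.
have S4 : \sum_(bl i <= j < t) (4 * (1 - diff 1 j) + diff 1 j + diff n.-1 j) =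
    4 * (t - bl i) - 2.
  rewrite big_split /= E2.
  (* Adding [3 * diff 1 j] turns every term into 4, which does away with the truncated
     difference. *)
  have S3 : \sum_(bl i <= j < t) 3 * diff 1 j = 3 by rewrite -big_distrr /= E1.
  suff : \sum_(bl i <= j < t) (4 * (1 - diff 1 j) + diff 1 j) +
      \sum_(bl i <= j < t) 3 * diff 1 j = 4 * (t - bl i) by rewrite S3; lia.
  rewrite -big_split /= mulnC -sum_nat_const_nat.
  by apply: eq_bigr => j _; rewrite /diff; case: eqP.
have far' := far.
rewrite S4; move: (t - bl i) (leq_sub2r (bl i) st) far => l; rewrite addKn => l2 far.
case: eqP => [_|/eqP kn'].
  (* For a block of [l] vertices the excess is [k * (l - 2) + l]. *)
  by rewrite S4; nia.
have nk : 2 * k <= n.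
  move: kn n0 kn' => /dvdnP[q ->]; case: q => [|[|q]]; first by rewrite mul0n.
    by rewrite mul1n eqxx.
  by rewrite leq_mul2r orbT.
rewrite big_split /=.
(* Both closing shifts are at least 2 and at most [n - 2], because [k >= 3] and [n >= 2 * k]. With
   two leaving edges for each of them the excess is at least [(k - 3) * (l - 2)]. *)
have D1 := @block_diff (bl i) t (n.+1 - k) tn st far' hb ltac:(lia) ltac:(lia).
have D2 := @block_diff (bl i) t k.-1 tn st far' hb ltac:(lia) ltac:(lia).
by nia.
Qed.

(** [R] is constant on each block, so the inequality of [block_weight] can be multiplied by it
    before summing over the labels. *)
Lemma round_count :
  (3 * k - 1) * \sum_(0 <= j < n) R j <=
  \sum_(0 <= r < k) \sum_(0 <= i < n)
     edge_val n (fun i => bl ((i + r) %% n)) (fun i => R ((i + r) %% n)) i (nx k i).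
Proof.
rewrite sum_edge_val_rot //; last by lia.
have bln i : i < n -> bl i < n by move=> hi; have [h _] := bl_fill bl_start hi; lia.
have kn' : k <= n by apply: dvdn_leq.
apply: (@leq_trans (\sum_(0 <= j < n) weightof j * R j)).
  rewrite big_distrr /= (sum_by_label _ bln) [leqRHS](sum_by_label _ bln).
  apply: leq_sum_nat => s /andP[_ hs].
  case: (boolP (has (fun j => bl j == s) (index_iota 0 n))) => [/hasP[i]|no]; last first.
    rewrite big1_seq // => j /andP[hj hi]; case/hasP: no; by exists j.
  rewrite mem_index_iota => /andP[_ hi] /eqP <-.
  have RE F : \sum_(0 <= j < n | bl j == bl i) F j * R j =
      R i * \sum_(0 <= j < n | bl j == bl i) F j.
    rewrite big_distrr /= big_nat_cond [RHS]big_nat_cond.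
    apply: eq_bigr => j /andP[/andP[_ hj] /eqP e].
    by rewrite mulnC (R_bl hj hi e).
  by rewrite (RE (fun=> 3 * k - 1)) RE leq_mul2l block_weight // orbT.
rewrite /weightof.
under eq_bigr do rewrite mulnDl -mulnA.
rewrite big_split /= -big_distrr /= sum_edge_val1 [leqRHS]big_split /= -big_distrr /=.
rewrite [X in _ <= k.-1 * X + _](_ : _ = \sum_(0 <= j < n) edge_val n bl R j (sc 1 j)); last first.
  by apply: eq_bigr => j _; rewrite /sc addn1.
rewrite leq_add2l.
case: eqP => [e|ne].
  rewrite e sum_edge_val1.
  by apply: leq_sum => j _; rewrite /sc subSnn.
apply: leq_trans (sum_edge_val (_ : 0 < n.+1 - k <= n)); last by lia.
by apply: leq_sum => j _; rewrite (_ : n - (n.+1 - k) = k.-1) //; lia.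
Qed.

End Counting.

(** * Greedy rotation of the blocks *)

Lemma sum_shift T (F : nat -> nat) : F T = F 0 ->
  \sum_(0 <= q < T) F q.+1 = \sum_(0 <= q < T) F q.
Proof.
move=> e; apply/eqP; rewrite -(eqn_add2l (F 0)); apply/eqP.
by rewrite -big_nat_recl // big_nat_recr //= e addnC.
Qed.

Section Greedy.

Variables (n k T : nat) (A : nat -> nat -> nat) (sg : nat -> nat).
Hypotheses (k0 : 0 < k) (kn : k %| n).
Hypothesis A_sym : forall i j, i < n -> j < n -> A i j = A j i.
Hypothesis A_tri : forall i j l, i < n -> j < n -> l < n -> A i l <= A i j + A j l.
Hypothesis sgP : inj_below n sg.
Hypothesis sgT : forall x, x < n -> iter T sg x = x.
Hypothesis T0 : 0 < T.

(** [T] times the average edge weight of the cycle of [x]: [T] is a period of every vertex. *)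
Definition orbit_weight (x : nat) : nat :=
  \sum_(0 <= q < T) A (iter q sg x) (iter q.+1 sg x).

Lemma iter_lt q x : x < n -> iter q sg x < n.
Proof. by have [h _] := inj_below_iter q sgP; apply: h. Qed.

Lemma orbit_weight_iter q x : x < n -> orbit_weight (iter q sg x) = orbit_weight x.
Proof.
move=> hx; elim: q => [//|q IH]; rewrite -IH /orbit_weight /=.
set y := iter q sg x; have hy : y < n by apply: iter_lt.
rewrite -[RHS]sum_shift; last by rewrite /= sgT.
by apply: eq_bigr => p _; rewrite -!iterSr.
Qed.

(** The triangle inequality through [v] is applied to every edge of the cycle; going round, each
    distance to [v] is used twice. *)
Lemma orbit_weight_star x v : x < n -> v < n ->
  orbit_weight x <= 2 * \sum_(0 <= q < T) A (iter q sg x) v.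
Proof.
move=> hx hv; rewrite mul2n -addnn.
rewrite -{2}(@sum_shift T (fun q => A (iter q sg x) v)); last by rewrite /= sgT.
rewrite -big_split /=; apply: leq_sum => q _.
rewrite [X in _ <= _ + X]A_sym //; last by have [h _] := sgP; apply/h/iter_lt.
by apply: A_tri => //; [apply: iter_lt | have [h _] := sgP; apply/h/iter_lt].
Qed.

(* The labels [bl] are the cycles of [sg], and [a] lists every cycle
   in its cyclic order as long as consecutive positions have the same label. *)
Definition arrangement (bl a : nat -> nat) : Prop :=
  [/\ inj_below n a,
      forall i, i < n -> bl (i.+1 %% n) = bl i -> a (i.+1 %% n) = sg (a i),
      forall i j q, i < n -> j < n -> a j = iter q sg (a i) -> bl j = bl i
    & forall i j, i < n -> j < n -> bl i = bl j -> exists q, a j = iter q sg (a i)].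

Definition turn (bl : nat -> nat) (b q : nat) (a : nat -> nat) : nat -> nat :=
  fun i => if bl i == b then iter q sg (a i) else a i.

Lemma iter_mulT m x : x < n -> iter (m * T) sg x = x.
Proof. by move=> hx; elim: m => [//|m IH]; rewrite mulSn iterD IH sgT. Qed.

(** Completing [q] whole periods undoes [q] steps, so no inverse of [sg] has to be introduced. *)
Lemma iter_back q x : x < n -> iter (q * T - q) sg (iter q sg x) = x.
Proof. by move=> hx; rewrite -iterD subnK ?iter_mulT // leq_pmulr. Qed.

(** A turned block keeps the vertices of its cycle, and these occur in no other block; this is why
    injectivity survives. *)
Lemma turn_arrangement bl b q a : arrangement bl a -> arrangement bl (turn bl b q a).
Proof.
case=> [[ab ai] c3 c4 c5]; split.
- split=> [i hi|i j hi hj]; rewrite /turn.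
    by case: ifP => _; [apply/iter_lt/ab | apply: ab].
  case: ifP => ei; case: ifP => ej.
  + by have [_ inj] := inj_below_iter q sgP; move/inj => /(_ (ab _ hi) (ab _ hj)); apply: ai.
  + by move=> e; move: ej ei; rewrite (c4 i j q) // => ->.
  + by move=> e; move: ei ej; rewrite (c4 j i q) // => ->.
  + exact: ai.
- move=> i hi e; rewrite /turn e; case: ifP => _; last exact: c3.
  by rewrite c3 // -iterS iterSr.
- move=> i j p hi hj; rewrite /turn; case: ifP => ej; case: ifP => ei.
  + by move: ei ej => /eqP-> /eqP->.
  + by move=> e; apply: (c4 _ _ (q * T - q + p)) => //; rewrite iterD -e iter_back // ab.
  + by rewrite -iterD; apply: c4.
  + exact: c4.
- move=> i j hi hj e; have [p ep] := c5 i j hi hj e; exists p; rewrite /turn e ep.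
  by case: ifP => // _; rewrite -!iterD addnC.
Qed.

Definition placed_weight (b : nat) (bl a : nat -> nat) : nat :=
  \sum_(0 <= i < n | (bl i < b) && (bl (nx k i) < b)) A (a i) (a (nx k i)).

(* Twice the weight that the edge leaving position [i] is sure to get when the
   blocks are placed in the order of their labels. *)
Definition dir_val (bl R : nat -> nat) (i : nat) : nat :=
  if bl i < bl (nx k i) then R (nx k i)
  else if bl (nx k i) < bl i then R i
  else if nx k i == i.+1 %% n then 2 * R i else 0.

Definition greedy_step (b : nat) (bl a a' : nat -> nat) : Prop :=
  (exists q, forall i, i < n -> a' i = turn bl b q a i) /\
  (forall q, placed_weight b.+1 bl (turn bl b q a) <= placed_weight b.+1 bl a').

Lemma eq_placed_weight b bl a a' : (forall i, i < n -> a i = a' i) ->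
  placed_weight b bl a = placed_weight b bl a'.
Proof.
move=> e; rewrite /placed_weight big_nat_cond [RHS]big_nat_cond.
apply: eq_bigr => i /andP[/andP[_ hi] _].
by rewrite !e // nx_lt.
Qed.

Lemma eq_arrangement bl a a' : (forall i, i < n -> a i = a' i) ->
  arrangement bl a -> arrangement bl a'.
Proof.
move=> e [[ab ai] c3 c4 c5].
have lt_mod i : i < n -> i.+1 %% n < n by move=> hi; rewrite ltn_pmod // (leq_ltn_trans _ hi).
split.
- by split=> [i hi|i j hi hj]; rewrite -!e //; [apply: ab | apply: ai].
- by move=> i hi eb; rewrite -!e ?lt_mod //; apply: c3.
- by move=> i j q hi hj; rewrite -!e //; apply: c4.
- by move=> i j hi hj eb; rewrite -!e //; apply: c5.
Qed.

(** If only one end of the edge lies in block [b], the other one is fixed and [orbit_weight_star]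
    applies. If both do and they are consecutive, the turned edge runs along the whole cycle. *)
Lemma turn_edge bl R b a i : arrangement bl a ->
  (forall j, j < n -> orbit_weight (a j) = R j) ->
  i < n -> bl i <= b -> bl (nx k i) <= b ->
  (bl i == b) || (bl (nx k i) == b) ->
  dir_val bl R i <=
  2 * \sum_(0 <= q < T) A (turn bl b q a i) (turn bl b q a (nx k i)).
Proof.
case=> [[ab ai] c3 c4 c5] hR hi ib nb; have hn := nx_lt kn hi.
rewrite /turn /dir_val; case: (ltngtP (bl i) (bl (nx k i))) => h e.
- have -> : (bl i == b) = false by lia.
  have -> : bl (nx k i) == b by lia.
  rewrite -hR //; apply: leq_trans (orbit_weight_star (ab _ hn) (ab _ hi)) _.
  rewrite leq_mul2l /=; apply: leq_sum => q _.
  by rewrite A_sym //; [apply/iter_lt/ab | apply: ab].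
- have -> : (bl (nx k i) == b) = false by lia.
  have -> : bl i == b by lia.
  rewrite -hR //; apply: orbit_weight_star; exact: ab.
- rewrite h; have -> : bl (nx k i) == b by lia.
  case: eqP => // es; rewrite leq_mul2l /= -hR //.
  by apply: leq_sum => q _; rewrite es c3 -?es // iterSr.
Qed.

(** The best turn is at least as good as the average of the turns [0] to [T - 1]. These leave the
    edges placed before unchanged, and [turn_edge] bounds the new ones on average. *)
Lemma greedy_stepP bl R b a a' :
  arrangement bl a -> (forall j, j < n -> orbit_weight (a j) = R j) ->
  greedy_step b bl a a' ->
  \sum_(0 <= i < n | (bl i < b) && (bl (nx k i) < b)) dir_val bl R i
    <= 2 * T * placed_weight b bl a ->
  [/\ arrangement bl a', (forall j, j < n -> orbit_weight (a' j) = R j)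
    & \sum_(0 <= i < n | (bl i < b.+1) && (bl (nx k i) < b.+1)) dir_val bl R i
      <= 2 * T * placed_weight b.+1 bl a'].
Proof.
move=> ha hR [[q0 eq0] gmax] IH.
have [ab _ _ _] := ha; have [{}ab _] := ab.
split.
- apply: eq_arrangement (turn_arrangement b q0 ha) => i hi.
  by rewrite eq0.
- move=> j hj; rewrite eq0 // -hR // /turn; case: ifP => // _.
  by rewrite orbit_weight_iter // ab.
have sumq : \sum_(0 <= q < T) placed_weight b.+1 bl (turn bl b q a)
    <= T * placed_weight b.+1 bl a'.
  rewrite -[T in T * _]subn0 -sum_nat_const_nat; exact: leq_sum.
rewrite -mulnA; apply: leq_trans _ (leq_mul (leqnn 2) sumq).
rewrite /placed_weight exchange_big_nat /= big_distrr /=.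
rewrite (bigID (fun i => (bl i < b) && (bl (nx k i) < b))) /=.
rewrite [leqRHS](bigID (fun i => (bl i < b) && (bl (nx k i) < b))) /=.
apply: leq_add.
  have sub i : [&& bl i < b.+1, bl (nx k i) < b.+1 & (bl i < b) && (bl (nx k i) < b)]
      = (bl i < b) && (bl (nx k i) < b) by lia.
  under eq_bigl do rewrite -andbA sub.
  under [leqRHS]eq_bigl do rewrite -andbA sub.
  apply: leq_trans IH _; rewrite /placed_weight big_distrr /=; apply: leq_sum => i /andP[h1 h2].
  rewrite -mulnA leq_mul2l /= -[T in T * _]subn0 -sum_nat_const_nat; apply: leq_sum => q _.
  by rewrite /turn !ifN //; lia.
rewrite big_nat_cond [leqRHS]big_nat_cond; apply: leq_sum => i.
move=> /andP[/andP[_ hi] /andP[/andP[h1 h2] h3]].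
by apply: turn_edge => //; lia.
Qed.

Lemma greedy_bound bl R (cfg : nat -> nat -> nat) :
  (forall i, i < n -> bl i <= n) ->
  arrangement bl (cfg 0) -> (forall j, j < n -> orbit_weight (cfg 0 j) = R j) ->
  (forall b, b <= n -> greedy_step b bl (cfg b) (cfg b.+1)) ->
  [/\ arrangement bl (cfg n.+1), (forall j, j < n -> orbit_weight (cfg n.+1 j) = R j)
    & \sum_(0 <= i < n) dir_val bl R i
      <= 2 * T * \sum_(0 <= i < n) A (cfg n.+1 i) (cfg n.+1 (nx k i))].
Proof.
move=> bn h0 hR hs.
have main b : b <= n.+1 -> [/\ arrangement bl (cfg b),
    (forall j, j < n -> orbit_weight (cfg b j) = R j)
    & \sum_(0 <= i < n | (bl i < b) && (bl (nx k i) < b)) dir_val bl R i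
      <= 2 * T * placed_weight b bl (cfg b)].
  elim: b => [|b IH] hb; first by split=> //; rewrite big_pred0.
  have [i1 i2 i3] := IH (ltnW hb).
  exact: greedy_stepP i1 i2 (hs b hb) i3.
have [m1 m2 m3] := main _ (leqnn _); split=> //.
have allP F : \sum_(0 <= i < n | (bl i < n.+1) && (bl (nx k i) < n.+1)) F i =
    \sum_(0 <= i < n) F i.
  rewrite big_nat_cond [RHS]big_nat_cond; apply: eq_bigl => i.
  by case: (ltnP i n) => hi; rewrite ?andbF //= !ltnS !bn // nx_lt.
by move: m3; rewrite /placed_weight !allP.
Qed.

(** Reversing the order exchanges the end whose [R] is gained, so the two orders together gain both;
    inside a block, [2 * R] is gained twice. *)
Lemma dir_val_compl bl R i : (forall i, i < n -> bl i <= n) -> i < n ->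
  dir_val bl R i + dir_val (fun i => n - bl i) R i = edge_val n bl R i (nx k i).
Proof.
move=> bn hi; have h1 := bn _ hi; have h2 := bn _ (nx_lt kn hi).
rewrite /dir_val /edge_val; case: (ltngtP (bl i) (bl (nx k i))) => h.
- have -> : (n - bl i < n - bl (nx k i)) = false by lia.
  have -> : n - bl (nx k i) < n - bl i by lia.
  by rewrite addnC.
- by have -> : n - bl i < n - bl (nx k i) by lia.
- by rewrite h ltnn ?eqxx /=; case: (nx k i =P _) => _; lia.
Qed.

End Greedy.

(** * All the rounds *)

Lemma eq_dir_val n k R bl bl' i : k %| n -> (forall i, i < n -> bl i = bl' i) ->
  i < n -> dir_val n k bl R i = dir_val n k bl' R i.
Proof. by move=> kn e hi; rewrite /dir_val !e // nx_lt. Qed.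

(** * Reversed and shifted labels *)

Section Labels.

Variables (n : nat) (sg : nat -> nat).
Hypothesis n0 : 0 < n.

Lemma arrangement_compl bl a : (forall i, i < n -> bl i <= n) ->
  arrangement n sg bl a -> arrangement n sg (fun i => n - bl i) a.
Proof.
move=> bn [h1 h2 h3 h4]; split=> //.
- move=> i hi e; apply: h2 => //.
  have := bn _ hi; have := bn (i.+1 %% n) (ltn_pmod _ n0); lia.
- by move=> i j q hi hj /h3 ->.
- by move=> i j hi hj e; apply: h4 => //; have := bn _ hi; have := bn _ hj; lia.
Qed.

Lemma arrangement_shift bl a : arrangement n sg bl a ->
  arrangement n sg (fun i => bl (i.+1 %% n)) (fun i => a (i.+1 %% n)).
Proof.
have lt_mod i : i.+1 %% n < n by rewrite ltn_pmod.
have [_ inj] := @inj_below_rot n 1 n0.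
move=> [[ab ai] h2 h3 h4]; split.
- split=> [i hi|i j hi hj e]; first exact: ab.
  by apply: inj => //; rewrite !addn1; apply: ai.
- by move=> i hi; apply: h2.
- by move=> i j q hi hj; apply: h3.
- by move=> i j hi hj; apply: h4.
Qed.

Lemma eq_arrangement_labels bl bl' a : (forall i, i < n -> bl i = bl' i) ->
  arrangement n sg bl a -> arrangement n sg bl' a.
Proof.
move=> e [h1 h2 h3 h4]; split=> //.
- by move=> i hi; rewrite -!e ?ltn_pmod //; apply: h2.
- by move=> i j q hi hj; rewrite -!e //; apply: h3.
- by move=> i j hi hj; rewrite -!e //; apply: h4.
Qed.

End Labels.

(** * The arrangement obtained by listing the cycles *)

Section Base.

Variables (n T : nat) (sg bl a : nat -> nat).
Hypotheses (n0 : 0 < n) (T0 : 0 < T).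
Hypothesis sgP : inj_below n sg.
Hypothesis sgT : forall x, x < n -> iter T sg x = x.
Hypothesis aP : inj_below n a.
Hypothesis bl_succ : forall i, i < n ->
  bl i = i \/ [/\ 0 < i, bl i = bl i.-1 & a i = sg (a i.-1)].
Hypothesis bl_closed : forall i, i < n ->
  exists j, [/\ j < n, bl j = bl i & a j = sg (a i)].

Lemma bl_succ_start i : i < n -> bl i = i \/ (0 < i /\ bl i = bl i.-1).
Proof. by move=> /bl_succ[->|[]]; [left|right]. Qed.

Lemma base_next i : 0 < i -> i < n -> bl i = bl i.-1 -> a i = sg (a i.-1).
Proof.
move=> i0 hi e; have [e'|[]//] := bl_succ hi.
have hi1 : i.-1 < n by lia.
by have [h _] := bl_fill bl_succ_start hi1; lia.
Qed.

Lemma base_iter i m : i < n -> bl i <= m <= i -> a m = iter (m - bl i) sg (a (bl i)).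
Proof.
move=> hi; have [h1 h2] := bl_fill bl_succ_start hi.
elim: m => [|m IH] hm; first by have -> : bl i = 0 by lia.
have [e|ne] := eqVneq (bl i) m.+1; first by rewrite e subnn.
have hm' : bl i <= m <= i by lia.
rewrite subSn; last by lia.
by rewrite /= -IH // base_next ?h2 //=; lia.
Qed.

Lemma base_arrangement : arrangement n sg bl a.
Proof.
have [ab ai] := aP; split=> //.
- move=> i hi; have [hs _] := bl_fill bl_succ_start hi.
  have [->|ne] := eqVneq i n.-1; last first.
    have hi1 : i.+1 < n by lia.
    by rewrite modn_small // => e; rewrite base_next.
  (* Equal labels across the end of the circle mean that there is a single block. The image of the
     last vertex can then only be at position 0, since the vertex at any other position is the image
     of its predecessor. *)
  rewrite (prednK n0) modnn => e.
  have [b0 _] := bl_fill bl_succ_start n0; have hn1 : n.-1 < n by lia.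
  have all0 m : m < n -> bl m = 0.
    by move=> hm; have [_ h] := bl_fill bl_succ_start hn1; rewrite h; lia.
  have [j [hj _ ej]] := bl_closed hn1; rewrite -ej.
  case: (posnP j) => [->//|j0].
  have hj1 : j.-1 < n by lia.
  move: ej; rewrite base_next ?all0 //.
  have [_ inj] := sgP => /inj; rewrite !ab // => /(_ isT isT)/ai.
  by rewrite hj1 hn1 => /(_ isT isT); lia.
- move=> i j q hi hj e.
  have [j' [hj' ej' e']] : exists j', [/\ j' < n, bl j' = bl i & a j' = iter q sg (a i)].
    elim: q {e} => [|q [j' [hj' ej' e']]]; first by exists i.
    have [m [hm em e'']] := bl_closed hj'; exists m; split=> //; first by rewrite em.
    by rewrite e'' e'.
  by rewrite (ai _ _ hj hj') // e e'.
- move=> i j hi hj e.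
  have [hsi _] := bl_fill bl_succ_start hi; have [hsj _] := bl_fill bl_succ_start hj.
  have hs : bl i < n by lia.
  (* From [i] back to the start of the block, then forward to [j]. *)
  exists (j - bl i + ((i - bl i) * T - (i - bl i))).
  rewrite (base_iter hi (m := i)) ?hsi ?leqnn // iterD (iter_back sgT) ?ab //.
  by rewrite (base_iter hj (m := j)) ?hsj ?leqnn // e.
Qed.

Lemma base_two : (forall x, x < n -> sg x <> x) ->
  forall i, i < n -> exists j, [/\ j < n, j <> i & bl j = bl i].
Proof.
move=> der i hi; have [j [hj e ej]] := bl_closed hi; exists j; split=> // eji.
by have [ab _] := aP; apply: (der (a i)); rewrite ?ab // -ej eji.
Qed.

End Base.

Section Rounds.

Variables (n k T : nat) (A : nat -> nat -> nat) (sg : nat -> nat).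
Hypotheses (k3 : 3 <= k) (kn : k %| n) (n0 : 0 < n).
Hypothesis A_sym : forall i j, i < n -> j < n -> A i j = A j i.
Hypothesis A_tri : forall i j l, i < n -> j < n -> l < n -> A i l <= A i j + A j l.
Hypothesis sgP : inj_below n sg.
Hypothesis sgT : forall x, x < n -> iter T sg x = x.
Hypothesis T0 : 0 < T.

Variables (bl a : nat -> nat).
Hypothesis aP : inj_below n a.
Hypothesis bl_start : forall i, i < n -> bl i = i \/ (0 < i /\ bl i = bl i.-1).
Hypothesis bl_two : forall i, i < n -> exists j, [/\ j < n, j <> i & bl j = bl i].
Hypothesis bl_arr : arrangement n sg bl a.

Let ow := orbit_weight T A sg.

Definition cyc_shift (f : nat -> nat) (r i : nat) : nat := f ((i + r) %% n).

Definition run_beaten (best r : nat) (lab : nat -> nat) : Prop :=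
  exists bl' (cfg : nat -> nat -> nat),
  [/\ forall i, i < n -> bl' i = lab i,
      arrangement n sg bl' (cfg 0),
      forall j, j < n -> ow (cfg 0 j) = cyc_shift (fun i => ow (a i)) r j,
      forall b, b <= n -> greedy_step n k A sg b bl' (cfg b) (cfg b.+1)
    & \sum_(0 <= i < n) A (cfg n.+1 i) (cfg n.+1 (nx k i)) <= best].

(* What is known of the weight [best] when the two greedy runs of round [r],
   one for each order of the labels, did not beat it. *)
Definition round_beaten (best r : nat) : Prop :=
  run_beaten best r (cyc_shift bl r) /\ run_beaten best r (fun i => n - cyc_shift bl r i).

(** Every iterate of [sg] permutes the vertices, so each of the [T] terms of the orbit weights sums
    to the weight of [sg]. *)
Lemma sum_orbit_weight :
  \sum_(0 <= j < n) ow (a j) = T * \sum_(0 <= x < n) A x (sg x).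
Proof.
rewrite (sum_inj_below ow aP) /ow /orbit_weight exchange_big_nat /=.
rewrite -[T in T * _]subn0 -sum_nat_const_nat; apply: eq_bigr => q _.
exact: (sum_inj_below (fun x => A x (sg x)) (inj_below_iter q sgP)).
Qed.

Lemma rounds_bound best : (forall r, r < k -> round_beaten best r) ->
  (3 * k - 1) * \sum_(0 <= x < n) A x (sg x) <= 4 * k * best.
Proof.
move=> hr; rewrite -(leq_pmul2l T0) mulnCA -sum_orbit_weight.
have k0 : 0 < k by lia.
have bln i : i < n -> bl i <= n.
  by move=> hi; have [h _] := bl_fill bl_start hi; lia.
have ow_bl i j : i < n -> j < n -> bl i = bl j -> ow (a i) = ow (a j).
  have [_ _ _ c5] := bl_arr; have [ab _] := aP.
  move=> hi hj /(c5 _ _ hi hj)[q ->].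
  by rewrite /ow (orbit_weight_iter _ sgP sgT) // ab.
apply: leq_trans (round_count k3 n0 kn bl_start bl_two ow_bl) _.
(* Each round accounts for [2 * T * best] from either of its two runs. *)
have -> : T * (4 * k * best) = \sum_(0 <= r < k) (4 * T * best).
  by rewrite sum_nat_const_nat; nia.
apply: leq_sum_nat => r /andP[_ hrk].
have rot_n i : i < n -> cyc_shift bl r i <= n.
  by move=> hi; apply: bln; rewrite ltn_pmod.
have [[bl1 [cfg1 [e1 a1 b1 c1 d1]]] [bl2 [cfg2 [e2 a2 b2 c2 d2]]]] := hr r hrk.
have bound1 i : i < n -> bl1 i <= n by move=> hi; rewrite e1 ?rot_n.
have bound2 i : i < n -> bl2 i <= n by move=> hi; rewrite e2 // leq_subr.
have [_ _ f1] := greedy_bound k0 kn A_sym A_tri sgP sgT T0 bound1 a1 b1 c1.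
have [_ _ f2] := greedy_bound k0 kn A_sym A_tri sgP sgT T0 bound2 a2 b2 c2.
have -> : 4 * T * best = 2 * T * best + 2 * T * best by nia.
apply: leq_trans (leq_add (leq_mul (leqnn (2 * T)) d1) (leq_mul (leqnn (2 * T)) d2)).
apply: leq_trans (leq_add f1 f2); rewrite -big_split /=.
apply: leq_sum_nat => i /andP[_ hi].
rewrite (eq_dir_val _ kn e1 hi) (eq_dir_val _ kn e2 hi).
by rewrite (dir_val_compl k0 kn T0).
Qed.

End Rounds.

(** By the pigeonhole principle two of the first [n + 1] iterates coincide, and injectivity cancels
    the common steps. *)
Lemma inj_below_period n sg x : inj_below n sg -> x < n ->
  exists l, [/\ 0 < l, l <= n & iter l sg x = x].
Proof.
move=> hs hx; have hb q : iter q sg x < n by have [h _] := inj_below_iter q hs; apply: h.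
have nu : ~~ uniq (map (fun q => iter q sg x) (iota 0 n.+1)).
  apply/negP => u; suff /(uniq_leq_size u) :
      {subset map (fun q => iter q sg x) (iota 0 n.+1) <= iota 0 n}.
    by rewrite size_map !size_iota ltnn.
  by move=> y /mapP[q _ ->]; rewrite mem_iota add0n hb.
have {nu} [i [j [ij jn e]]] : exists i j, [/\ i < j, j <= n & iter i sg x = iter j sg x].
  case/(uniqPn 0): nu => i [j [ij]]; rewrite size_map size_iota => jn.
  rewrite !(nth_map 0) ?size_iota // ?nth_iota //; try lia.
  by rewrite !add0n => e; exists i, j.
exists (j - i); split; [lia|lia|].
have [_ inj] := inj_below_iter i hs; apply: inj => //.
by rewrite -iterD subnKC // ltnW.
Qed.

(** The common period [T] of the analysis. It occurs in proofs only: the program tries [n] turns per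
    block. *)
Lemma inj_below_fact n sg x : inj_below n sg -> x < n -> iter n`! sg x = x.
Proof.
move=> hs hx; have [l [l0 ln e]] := inj_below_period hs hx.
have /dvdnP[q ->] : l %| n`! by apply: dvdn_fact; rewrite l0.
by elim: q => [//|q IH]; rewrite mulSn iterD IH.
Qed.

(** * The program of the rounds *)

Lemma for_map H r m c a s (g : nat -> nat) :
  r \notin wr c -> m \notin r :: wr c ->
  (forall i s', i < rg s m -> rg s' r = i -> frame (r :: wr c) (wa c) s s' ->
     (forall j, ar s' a j = if j < i then g j else ar s a j) ->
     forall j, ar (den H c s') a j = if j == i then g i else ar s' a j) ->
  forall j, ar (den H (CFor r m c) s) a j = if j < rg s m then g j else ar s a j.
Proof.
move=> nr nm step.
apply: (for_ind (I := fun i s' => forall j, ar s' a j =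
  if j < i then g j else ar s a j)) => // i s' hi ri fr IH j.
by rewrite /= (step i s') // IH ltnS; case: (ltngtP j i) => [_|_|->].
Qed.

Lemma for_put H r m a e s (g : nat -> nat) : a != 0 -> r != m ->
  (forall i s', i < rg s m -> rg s' r = i -> frame [:: r] [:: a] s s' ->
     (forall j, ar s' a j = if j < i then g j else ar s a j) -> heval H s' e = g i) ->
  forall j, ar (den H (CFor r m (CPut a (ER r) e)) s) a j =
    if j < rg s m then g j else ar s a j.
Proof.
move=> a0 rm step; apply: for_map => //; first by rewrite /= inE eq_sym rm.
move=> i s' hi ri fr IH j.
rewrite den_put /= /idx (negbTE a0) eqxx ri (step i s') //=.
Qed.

Lemma for_sum H r m c f s (F : nat -> nat) :
  r \notin wr c -> m \notin r :: wr c -> f != r ->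
  (forall i s', i < rg s m -> rg s' r = i -> frame (r :: wr c) (wa c) s s' ->
     rg s' f = rg s f + \sum_(0 <= j < i) F j ->
     rg (den H c s') f = rg s' f + F i) ->
  rg (den H (CFor r m c) s) f = rg s f + \sum_(0 <= i < rg s m) F i.
Proof.
move=> nr nm nf step.
apply: (for_ind (I := fun i s' => rg s' f = rg s f + \sum_(0 <= j < i) F j)) => //.
  by rewrite big_nil addn0 /= /update (negbTE nf).
move=> i s' hi ri fr IH; rewrite /= /update (negbTE nf) (step i s') // IH.
by rewrite big_nat_recr //= addnA.
Qed.

Definition neqe (x y : hexpr) : hexpr := EAdd (ESub x y) (ESub y x).

Lemma heval_neqe H s x y : (heval H s (neqe x y) != 0) = (heval H s x != heval H s y).
Proof. by rewrite /=; lia. Qed.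

(* The registers that bound the loops, constant in the main program: [n], [n * n],
   [k], a bound on the lengths of the denominators, and [n + 1]. *)
Notation rN := 0 (only parsing).
Notation rN2 := 1 (only parsing).
Notation rK := 2 (only parsing).
Notation rL := 3 (only parsing).
Notation rN1 := 4 (only parsing).

Notation aROW := 1 (only parsing).
Notation aA := 2 (only parsing).
Notation aSG := 10 (only parsing).
Notation aAA := 12 (only parsing).
Notation aBL := 13 (only parsing).
Notation aNX := 14 (only parsing).
Notation aTB := 15 (only parsing).
Notation aBEST := 16 (only parsing).

Notation ri := 10 (only parsing).
Notation rf := 11 (only parsing).
Notation rq := 12 (only parsing).
Notation rb := 13 (only parsing).
Notation rbv := 14 (only parsing).
Notation rbest := 15 (only parsing).
Notation rr := 16 (only parsing).

Definition p_copy (dst src : nat) : hcmd := CFor ri rN (CPut dst (ER ri) (EA src (ER ri))).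

Definition p_turn : hcmd :=
  CFor ri rN (CIf (neqe (EA aBL (ER ri)) (ER rb)) CSkip
    (CPut aAA (ER ri) (EA aSG (EA aAA (ER ri))))).

(** Weights are counted from 1, so that a configuration of weight 0 still beats the initial 0 of
    [rbv] and [rbest] and is recorded. *)
Definition p_weight : hcmd :=
  CSeq (CSet rf (EC 1))
  (CFor ri rN
    (CIf (EAdd (ESub (EA aBL (ER ri)) (ER rb)) (ESub (EA aBL (EA aNX (ER ri))) (ER rb)))
       CSkip
       (CSet rf (EAdd (ER rf)
          (EA aA (EAdd (EA aROW (EA aAA (ER ri))) (EA aAA (EA aNX (ER ri))))))))).

Definition p_try : hcmd :=
  CSeq p_turn (CSeq p_weight
  (CIf (ESub (ER rf) (ER rbv)) (CSeq (CSet rbv (ER rf)) (p_copy aTB aAA)) CSkip)).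

Definition p_step : hcmd :=
  CSeq (CSet rbv (EC 0)) (CSeq (CFor rq rN p_try) (p_copy aAA aTB)).

Definition p_compl : hcmd :=
  CFor ri rN (CPut aBL (ER ri) (ESub (ER rN) (EA aBL (ER ri)))).

(** The labels are complemented before each run, so two calls cover both orders and restore the
    labels. *)
Definition p_dir : hcmd :=
  CSeq p_compl (CSeq (CFor rb rN1 p_step)
  (CIf (ESub (ER rbv) (ER rbest))
     (CSeq (CSet rbest (ER rbv)) (p_copy aBEST aAA)) CSkip)).

(** Entry 0 is first copied to position [n], which lets the shift be done in place in increasing
    order. *)
Definition p_shift : hcmd :=
  CSeq (CPut aAA (ER rN) (EA aAA (EC 0))) (CSeq (CPut aBL (ER rN) (EA aBL (EC 0)))
  (CFor ri rN (CSeq (CPut aAA (ER ri) (EA aAA (EAdd (ER ri) (EC 1))))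
                    (CPut aBL (ER ri) (EA aBL (EAdd (ER ri) (EC 1))))))).

Definition p_rounds : hcmd :=
  CSeq (CSet rbest (EC 0)) (CFor rr rK (CSeq p_dir (CSeq p_dir p_shift))).

Lemma copy_spec H dst src s : dst != 0 -> src != 0 -> dst != src ->
  forall j, ar (den H (p_copy dst src) s) dst j =
    if j < rg s rN then ar s src j else ar s dst j.
Proof.
move=> d0 s0 ds; apply: for_put => // i s' hi ri_ [fr fa] _ /=.
by rewrite /idx (negbTE s0) ri_ fa // inE eq_sym.
Qed.

Section RoundsProgram.

Variables (H n k : nat) (A : nat -> nat -> nat) (sg : nat -> nat).
Hypotheses (k3 : 3 <= k) (kn : k %| n) (n0 : 0 < n).
Hypothesis A_sym : forall i j, i < n -> j < n -> A i j = A j i.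
Hypothesis A_tri : forall i j l, i < n -> j < n -> l < n -> A i l <= A i j + A j l.
Hypothesis sgP : inj_below n sg.

Definition rounds_data (s : hstate) : Prop :=
  [/\ [/\ rg s rN = n, rg s rN1 = n.+1 & rg s rK = k],
      forall i j, i < n -> j < n -> ar s aA (ar s aROW i + j) = A i j,
      forall i, i < n -> ar s aNX i = nx k i
    & forall x, x < n -> ar s aSG x = sg x].

Lemma rounds_data_frame rs as_ s s' :
  all (fun r => r \notin rs) [:: rN; rN1; rK] ->
  all (fun a => a \notin as_) [:: aA; aROW; aNX; aSG] ->
  frame rs as_ s s' -> rounds_data s -> rounds_data s'.
Proof.
move=> /and4P[r1 r2 r3 _] /and5P[a1 a2 a3 a4 _] [fr fa] [[h1 h2 h3] h4 h5 h6].
by split; [split; rewrite fr | move=> i j ??; rewrite !fa ?h4 | move=> i ?; rewrite fa ?h5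
  | move=> x ?; rewrite fa ?h6].
Qed.

Lemma turn_spec s : rounds_data s -> (forall i, i < n -> ar s aAA i < n) ->
  forall j, j < n -> ar (den H p_turn s) aAA j = turn sg (ar s aBL) (rg s rb) 1 (ar s aAA) j.
Proof.
move=> [[hN _ _] _ _ hsg] hA j hj.
rewrite (for_map (g := turn sg (ar s aBL) (rg s rb) 1 (ar s aAA))) // ?hN ?hj //.
move=> i s' hi ri_ [fr fa] IH l; rewrite den_if heval_neqe /= ri_ /idx /=.
rewrite fa // fr // /turn; case: eqP => [e|ne] /=.
  case: eqP => // _.
  by rewrite IH ltnn fa // hsg // hA.
by case: eqP => // ->; rewrite IH ltnn.
Qed.

Lemma weight_spec s : rounds_data s -> (forall i, i < n -> ar s aAA i < n) ->
  rg (den H p_weight s) rf =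
    1 + placed_weight n k A (rg s rb).+1 (ar s aBL) (ar s aAA).
Proof.
move=> [[hN _ _] hA hnx _] hAA; rewrite den_seq den_set.
set s1 := setr s rf _.
have s1N : rg s1 rN = n by [].
rewrite (for_sum (F := fun i => if (ar s aBL i < (rg s rb).+1)
   && (ar s aBL (nx k i) < (rg s rb).+1)
   then A (ar s aAA i) (ar s aAA (nx k i)) else 0)) //.
  by rewrite s1N /placed_weight [in RHS]big_mkcond.
move=> i s'; rewrite s1N => hi ri_ [fr fa] _; rewrite den_if /= ri_ /idx /=.
have hn : nx k i < n by apply: nx_lt.
rewrite !fa // fr //= /update /= hnx // -/(nx k i) !ltnS.
have -> : (ar s 13 i - rg s 13 + (ar s 13 (nx k i) - rg s 13) != 0) =
   ~~ ((ar s 13 i <= rg s 13) && (ar s 13 (nx k i) <= rg s 13)) by lia.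
case: (_ && _) => /=; last by rewrite addn0.
by rewrite /update /= hA ?hAA.
Qed.

Lemma turn_iterS bl b q a i : i < n ->
  turn sg bl b 1 (turn sg bl b q a) i = turn sg bl b q.+1 a i.
Proof. by move=> hi; rewrite /turn; case: (bl i == b). Qed.

(** The block is turned before it is weighed; hence the amounts tried are 1 to [n]. *)
Lemma try_spec s a0 : rounds_data s -> (forall i, i < n -> a0 i < n) ->
  let bl := ar s aBL in let b := rg s rb in
  let pw q := 1 + placed_weight n k A b.+1 bl (turn sg bl b q a0) in
  (forall i, i < n -> ar s aAA i = a0 i) -> rg s rbv = 0 ->
  let s' := den H (CFor rq rN p_try) s in
  exists q0, [/\ forall i, i < n -> ar s' aTB i = turn sg bl b q0 a0 i,
    rg s' rbv = pw q0 & forall q, 0 < q <= n -> pw q <= pw q0].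
Proof.
move=> ds ha0 bl b pw hs bv0 s'.
have tb q i : i < n -> turn sg bl b q a0 i < n.
  move=> hi; rewrite /turn; case: ifP => _; last exact: ha0.
  by have [h _] := inj_below_iter q sgP; apply/h/ha0.
have hN : rg s rN = n by case: ds => [[]].
pose I m s' := (forall i, i < n -> ar s' aAA i = turn sg bl b m a0 i) /\
  (forall q, 0 < q <= m -> pw q <= rg s' rbv) /\
  (m = 0 -> rg s' rbv = 0) /\
  (0 < m -> exists q0, (forall i, i < n -> ar s' aTB i = turn sg bl b q0 a0 i) /\
     rg s' rbv = pw q0).
suff : I (rg s rN) s'.
  rewrite hN => -[_ [h2 [_ /(_ n0)[q0 [h3 h4]]]]].
  by exists q0; split=> // q /h2; rewrite h4.
apply: for_ind => //.
  split=> [i hi|]; first by rewrite /= hs // /turn; case: ifP.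
  by split=> // q; lia.
move=> m s1 hm rq_ frs1 [i1 [i2 [i4 i3]]].
have ds1 : rounds_data s1 by apply: rounds_data_frame frs1 ds.
have [fr1 fa1] := frs1.
have hAA1 i : i < n -> ar s1 aAA i < n by move=> hi; rewrite i1 ?tb.
rewrite /p_try 2!den_seq.
set s2 := den H p_turn s1; set s3 := den H p_weight s2.
have frs2 := den_frame H p_turn s1; have [fr2 fa2] := frs2.
have frs3 := den_frame H p_weight s2; have [fr3 fa3] := frs3.
have ds2 : rounds_data s2 by apply: rounds_data_frame frs2 ds1.
have bl1 : ar s1 aBL =1 bl by move=> i; rewrite fa1.
have b1 : rg s1 rb = b by apply: fr1.
have AA2 i : i < n -> ar s2 aAA i = turn sg bl b m.+1 a0 i.
  move=> hi; rewrite turn_spec // -[RHS](turn_iterS _ _ _ _ hi) {1}/turn b1 bl1 i1 //.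
have hAA2 i : i < n -> ar s2 aAA i < n by move=> hi; rewrite AA2 ?tb.
have f3 : rg s3 rf = pw m.+1.
  rewrite weight_spec // (fr2 rb) // b1 /pw.
  congr (1 + _); transitivity
    (placed_weight n k A b.+1 (ar s2 aBL) (turn sg bl b m.+1 a0)).
    by apply: eq_placed_weight => //; lia.
  rewrite /placed_weight; apply: eq_bigl => i.
  by rewrite !(fa2 aBL) // !bl1.
have AA3 i : i < n -> ar s3 aAA i = turn sg bl b m.+1 a0 i.
  by move=> hi; rewrite fa3 // AA2.
have bv3 : rg s3 rbv = rg s1 rbv by rewrite fr3 // fr2.
have TB3 : ar s3 aTB =1 ar s1 aTB by move=> i; rewrite fa3 // fa2.
have N3 : rg s3 rN = n by rewrite fr3 // fr2 // fr1.
rewrite den_if.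
have -> : (heval H s3 (ESub (ER rf) (ER rbv)) != 0) = (rg s1 rbv < pw m.+1).
  by rewrite /= f3 bv3; lia.
case: ltnP => hlt; last first.
  rewrite den_skip; split=> [i hi|]; first by rewrite /= AA3.
  split=> [q hq|]; [|split=> // _]; rewrite /= /update /= bv3.
    have [->|ne] := eqVneq q m.+1; first by [].
    by apply: i2; lia.
  case: (posnP m) => [m0|/i3[q0 [h1 h2]]].
    by move: hlt; rewrite i4.
  by exists q0; split=> // i hi; rewrite TB3 h1.
rewrite den_seq den_set; set s4 := setr s3 _ _.
have frs5 := den_frame H (p_copy aTB aAA) s4; have [fr5 fa5] := frs5.
split=> [i hi|]; first by rewrite /= fa5 //= AA3.
split=> [q hq|]; [|split=> // _]; rewrite /= /update /= fr5 //= /update /= f3.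
  have [->//|ne] := eqVneq q m.+1.
  by apply: leq_trans (ltnW hlt); apply: i2; lia.
exists m.+1; split=> // i hi.
by rewrite copy_spec //= /update /= N3 hi AA3.
Qed.

(** A cycle has some period [l <= n], so [q] may be reduced modulo [l], with [l] in place of 0. Thus
    the [n] turns tried include every possible outcome. *)
Lemma turn_period bl b q a : arrangement n sg bl a ->
  exists2 q', 0 < q' <= n & forall i, i < n -> turn sg bl b q a i = turn sg bl b q' a i.
Proof.
move=> [[ab _] _ _ c5].
case: (boolP (has (fun i => bl i == b) (iota 0 n))) => [/hasP[i0]|/hasPn no]; last first.
  exists 1 => [|i hi]; first by rewrite n0.
  by rewrite /turn (negbTE (no i _)) // mem_iota.
rewrite mem_iota add0n => /andP[_ hi0] /eqP ei0.
have [l [l0 ln el]] := inj_below_period sgP (ab _ hi0).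
have perm_l i m : i < n -> bl i = b -> iter (m * l) sg (a i) = a i.
  move=> hi ei; have [p ->] := c5 _ _ hi0 hi (etrans ei0 (esym ei)).
  elim: m => [//|m IH]; rewrite mulSn iterD IH -iterD addnC iterD el //.
exists (if q %% l == 0 then l else q %% l).
  have := ltn_pmod q l0; case: ifP; lia.
move=> i hi; rewrite /turn; case: eqP => // ei.
rewrite {1}(divn_eq q l) addnC iterD perm_l //.
case: eqP => [->|_] //; by rewrite -[LHS](perm_l i 1 hi ei) mul1n.
Qed.

Lemma step_spec s a0 : rounds_data s -> arrangement n sg (ar s aBL) a0 ->
  (forall i, i < n -> ar s aAA i = a0 i) ->
  let bl := ar s aBL in let b := rg s rb in
  let s' := den H p_step s in
  exists a', [/\ greedy_step n k A sg b bl a0 a',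
    forall i, i < n -> ar s' aAA i = a' i &
    rg s' rbv = 1 + placed_weight n k A b.+1 bl a'].
Proof.
move=> ds ha hs bl b s'; have [[ab _] _ _ _] := ha.
rewrite /s' /p_step den_seq den_set; set s1 := setr s rbv _.
have ds1 : rounds_data s1 by apply: rounds_data_frame (frame_setr _ _ _) ds.
have [q0 [h1 h2 h3]] := try_spec ds1 ab hs (erefl _).
rewrite den_seq; set s2 := den H (CFor rq rN p_try) s1 in h1 h2 *.
have N2 : rg s2 rN = n.
  have [fr _] := den_frame H (CFor rq rN p_try) s1.
  by rewrite fr //; case: ds1 => [[]].
exists (turn sg bl b q0 a0); split.
- split; first by exists q0.
  move=> q; have [q' hq' e] := turn_period b q ha.
  rewrite (_ : placed_weight _ _ _ _ _ (turn _ _ _ q _) =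
    placed_weight n k A b.+1 bl (turn sg bl b q' a0)).
    by have := h3 _ hq'; rewrite leq_add2l.
  by apply: eq_placed_weight => //; lia.
- by move=> i hi; rewrite copy_spec //= N2 hi h1.
- have [fr _] := den_frame H (p_copy aAA aTB) s2.
  by rewrite fr.
Qed.

Definition cfg_weight (a : nat -> nat) : nat := \sum_(0 <= i < n) A (a i) (a (nx k i)).

Lemma eq_cfg_weight a a' : (forall i, i < n -> a i = a' i) -> cfg_weight a = cfg_weight a'.
Proof.
by move=> e; apply: eq_big_nat => i /andP[_ hi]; rewrite !e // nx_lt.
Qed.

Lemma placed_all bl a : (forall i, i < n -> bl i <= n) ->
  placed_weight n k A n.+1 bl a = cfg_weight a.
Proof.
move=> bn; rewrite /placed_weight /cfg_weight big_nat_cond [RHS]big_nat_cond.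
apply: eq_bigl => i; case: (ltnP i n) => hi; rewrite ?andbF //=.
by rewrite !ltnS !bn // nx_lt.
Qed.

Lemma greedy_spec s a0 : rounds_data s -> arrangement n sg (ar s aBL) a0 ->
  (forall i, i < n -> ar s aAA i = a0 i) -> (forall i, i < n -> ar s aBL i <= n) ->
  let bl := ar s aBL in
  let s' := den H (CFor rb rN1 p_step) s in
  exists cfg, [/\ cfg 0 = a0,
    forall b, b <= n -> greedy_step n k A sg b bl (cfg b) (cfg b.+1),
    forall i, i < n -> ar s' aAA i = cfg n.+1 i &
    rg s' rbv = 1 + cfg_weight (cfg n.+1)].
Proof.
move=> ds ha hs bn bl s'.
have N1 : rg s rN1 = n.+1 by case: ds => [[]].
pose I m s' := exists cfg, [/\ cfg 0 = a0,
  forall b, b < m -> greedy_step n k A sg b bl (cfg b) (cfg b.+1),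
  arrangement n sg bl (cfg m),
  forall i, i < n -> ar s' aAA i = cfg m i &
  0 < m -> rg s' rbv = 1 + placed_weight n k A m bl (cfg m)].
suff : I (rg s rN1) s'.
  rewrite N1 => -[cfg [c0 c1 c2 c3 c4]]; exists cfg; split=> //.
  by rewrite c4 // placed_all.
apply: for_ind => //; first by exists (fun=> a0).
move=> m s1 hm rb_ frs1 [cfg [c0 c1 c2 c3 c4]].
have ds1 : rounds_data s1 by apply: rounds_data_frame frs1 ds.
have [_ fa1] := frs1.
have ebl i : i < n -> bl i = ar s1 aBL i by rewrite fa1.
have ha1 : arrangement n sg (ar s1 aBL) (cfg m).
  exact: (@eq_arrangement_labels n sg n0 bl).
have [a' [g1 g2 g3]] := step_spec ds1 ha1 c3; rewrite rb_ in g1 g3.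
have pwE x : placed_weight n k A m.+1 (ar s1 aBL) x = placed_weight n k A m.+1 bl x.
  by apply: eq_bigl => i; rewrite !fa1.
have turnE q x i : turn sg (ar s1 aBL) m q x i = turn sg bl m q x i.
  by rewrite /turn fa1.
exists (fun c => if c <= m then cfg c else a').
rewrite leq0n ltnn; split=> //.
- move=> b; rewrite ltnS => hbm; move: (hbm); rewrite {1}leq_eqVlt => /orP[/eqP->|hb]; last first.
    by rewrite hb hbm; apply: c1.
  rewrite leqnn ltnn; case: g1 => [[q eq] gm]; split.
    by exists q => i hi; rewrite eq // turnE.
  move=> q'; rewrite -!pwE; apply: leq_trans (gm q').
  rewrite leq_eqVlt; apply/orP; left; apply/eqP.
  by apply: eq_placed_weight => //; lia.
- case: g1 => [[q eq] _].
  apply: (@eq_arrangement n sg bl (turn sg bl m q (cfg m))) => //.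
  + by move=> i hi; rewrite eq // turnE.
  + by apply: (turn_arrangement sgP (fun x hx => inj_below_fact sgP hx)) => //; apply: fact_gt0.
- by move=> _; rewrite /= /update /= g3 pwE.
Qed.

Let ow := orbit_weight n`! A sg.

Let sgT x (hx : x < n) : iter n`! sg x = x := inj_below_fact sgP hx.

(** The guard is there because [aBEST] is meaningless until the first run has been recorded. *)
Definition best_valid (s : hstate) : Prop :=
  0 < rg s rbest ->
  inj_below n (ar s aBEST) /\ 1 + cfg_weight (ar s aBEST) = rg s rbest.

Lemma compl_spec s : rounds_data s ->
  forall i, i < n -> ar (den H p_compl s) aBL i = n - ar s aBL i.
Proof.
move=> [[hN _ _] _ _ _] i hi.
rewrite (for_put (g := fun i => n - ar s aBL i)) ?hN ?hi //.
by move=> j s' hj rj [fr _] IH /=; rewrite rj /idx /= IH ltnn fr // hN.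
Qed.

Lemma eq_inj_below f g : (forall i, i < n -> f i = g i) -> inj_below n f -> inj_below n g.
Proof.
move=> e [fb fi]; split=> [i hi|i j hi hj]; first by rewrite -e // fb.
by rewrite -!e //; apply: fi.
Qed.

Lemma dir_spec s : rounds_data s -> (forall i, i < n -> ar s aBL i <= n) ->
  arrangement n sg (ar s aBL) (ar s aAA) -> best_valid s ->
  let s' := den H p_dir s in
  [/\ [/\ rounds_data s', forall i, i < n -> ar s' aBL i = n - ar s aBL i,
      arrangement n sg (ar s' aBL) (ar s' aAA) &
      forall j, j < n -> ow (ar s' aAA j) = ow (ar s aAA j)],
    exists cfg, [/\ cfg 0 = ar s aAA,
      forall b, b <= n -> greedy_step n k A sg b (ar s' aBL) (cfg b) (cfg b.+1)
      & cfg_weight (cfg n.+1) <= (rg s' rbest).-1],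
    rg s rbest <= rg s' rbest, 0 < rg s' rbest & best_valid s'].
Proof.
move=> ds bn ha bv s'.
have ds' : rounds_data s' by apply: rounds_data_frame (den_frame H p_dir s) ds.
rewrite /s' /p_dir 2!den_seq in ds' *.
have cs := compl_spec ds.
have frs1 := den_frame H p_compl s.
set s1 := den H p_compl s in cs frs1 ds' *.
have [fr1 fa1] := frs1.
have ds1 : rounds_data s1 by apply: rounds_data_frame frs1 ds.
have bn1 i : i < n -> ar s1 aBL i <= n by move=> hi; rewrite cs // leq_subr.
have ha1 : arrangement n sg (ar s1 aBL) (ar s aAA).
  apply: (@eq_arrangement_labels n sg n0 (fun i => n - ar s aBL i)).
    by move=> i hi; rewrite cs.
  exact: arrangement_compl.
have AA1 i : i < n -> ar s1 aAA i = ar s aAA i by rewrite fa1.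
have [cfg [c0 c1 c2 c3]] := greedy_spec ds1 ha1 AA1 bn1.
have frs2 := den_frame H (CFor rb rN1 p_step) s1.
set s2 := den H (CFor rb rN1 p_step) s1 in c2 c3 frs2 ds' *.
have [fr2 fa2] := frs2.
have ds2 : rounds_data s2 by apply: rounds_data_frame frs2 ds1.
have k0 : 0 < k by lia.
have [g1 g2 _] := greedy_bound k0 kn A_sym A_tri sgP sgT (fact_gt0 n) bn1
  (eq_ind_r (fun c => arrangement n sg (ar s1 aBL) c) ha1 c0)
  (fun j _ => erefl : ow (cfg 0 j) = ow (cfg 0 j)) c1.
set s3 := den H (CIf _ _ _) s2 in ds' *.
have frs3 : frame (wr (CSeq (CSet rbest (ER rbv)) (p_copy aBEST aAA)))
    (wa (CSeq (CSet rbest (ER rbv)) (p_copy aBEST aAA))) s2 s3.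
  by rewrite /s3 den_if; case: ifP => _; [apply: den_frame | apply: frame_refl].
have [fr3 fa3] := frs3.
have BL3 i : ar s3 aBL i = ar s1 aBL i by rewrite fa3 // fa2.
have AA3 i : i < n -> ar s3 aAA i = cfg n.+1 i by move=> hi; rewrite fa3 // c2.
have best12 : rg s2 rbest = rg s rbest by rewrite fr2 // fr1.
have best3 : rg s3 rbest = maxn (rg s rbest) (rg s2 rbv).
  rewrite /s3 den_if /= best12; case: ifP => hc; last by lia.
  have [fr4 _] := den_frame H (p_copy aBEST aAA) (setr s2 rbest (rg s2 rbv)).
  by rewrite fr4 //= /update /=; lia.
split.
- split=> //.
  + by move=> i hi; rewrite BL3 cs.
  + apply: (@eq_arrangement_labels n sg n0 (ar s1 aBL)) => [i hi|]; first by rewrite BL3.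
    by apply: (@eq_arrangement n sg _ (cfg n.+1)) => // i hi; rewrite AA3.
  + by move=> j hj; rewrite AA3 // /ow g2 // c0.
- exists cfg; split=> //; last by rewrite best3 c3; lia.
  move=> b hb; have [[q eq] gm] := c1 b hb; split.
    by exists q => i hi; rewrite eq // /turn BL3.
  move=> q'; apply: leq_trans (leq_trans _ (gm q')) _; rewrite leq_eqVlt;
    apply/orP; left; apply/eqP.
    rewrite /placed_weight; under eq_bigl do rewrite !BL3.
    by apply: eq_bigr => i _; rewrite /turn !BL3.
  by apply: eq_bigl => i; rewrite !BL3.
- by rewrite best3 leq_maxl.
- by rewrite best3 c3; lia.
- rewrite /best_valid best3 => _; rewrite /s3 den_if /= best12.
  case: (ltnP (rg s rbest) (rg s2 rbv)) => hc.
    have -> : rg s2 14 - rg s 15 != 0 by lia.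
    have E i : i < n -> cfg n.+1 i =
        ar (den H (p_copy aBEST aAA) (setr s2 rbest (rg s2 rbv))) aBEST i.
      move=> hi; rewrite copy_spec //= /update /=.
      by case: ds2 => [[-> _ _] _ _ _]; rewrite hi c2.
    have [inj _ _ _] := g1; split; first exact: eq_inj_below E inj.
    by rewrite -(eq_cfg_weight E) -c3; lia.
  have -> : (rg s2 14 - rg s 15 != 0) = false by lia.
  have b0 : 0 < rg s rbest by have := c3; lia.
  have [v1 v2] := bv b0.
  have E i : i < n -> ar s aBEST i = ar s2 aBEST i by rewrite fa2 // fa1.
  split; first exact: eq_inj_below E v1.
  by rewrite -(eq_cfg_weight E) v2; lia.
Qed.

Lemma shift_spec s : rounds_data s ->
  let s' := den H p_shift s in
  (forall i, i < n -> ar s' aAA i = ar s aAA (i.+1 %% n)) /\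
  (forall i, i < n -> ar s' aBL i = ar s aBL (i.+1 %% n)).
Proof.
move=> ds s'; rewrite /s' /p_shift 2!den_seq !den_put.
have [[hN _ _] _ _ _] := ds.
set s1 := seta s _ _ _; set s2 := seta s1 _ _ _.
have E a i : i <= n -> a = aAA \/ a = aBL -> ar s2 a i = ar s a (i %% n).
  move=> hi ha; have [->|ne] := eqVneq i n.
    rewrite modnn; case: ha => ->; rewrite /s2 /s1 /= /idx /= hN eqxx //=.
  rewrite modn_small; last by lia.
  by case: ha => ->; rewrite /s2 /s1 /= /idx /= hN ?(negbTE ne).
have hN2 : rg s2 rN = n by [].
clearbody s2; split=> i hi.
- rewrite (for_map (g := fun i => ar s aAA (i.+1 %% n))) // ?hN2 ?hi //.
  move=> j s3 hj rj _ IH l; rewrite den_seq !den_put /= /update rj /idx /=.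
  case: eqP => // _; rewrite IH addn1 ltnNge leqnSn /= E //; by left.
- rewrite (for_map (g := fun i => ar s aBL (i.+1 %% n))) // ?hN2 ?hi //.
  move=> j s3 hj rj _ IH l; rewrite den_seq !den_put /= /update rj /idx /=.
  case: eqP => // _; rewrite IH addn1 ltnNge leqnSn /= E //; by right.
Qed.

Lemma rounds_spec s : rounds_data s -> inj_below n (ar s aAA) ->
  (forall i, i < n -> ar s aBL i = i \/ (0 < i /\ ar s aBL i = ar s aBL i.-1)) ->
  (forall i, i < n -> exists j, [/\ j < n, j <> i & ar s aBL j = ar s aBL i]) ->
  arrangement n sg (ar s aBL) (ar s aAA) ->
  let s' := den H p_rounds s in
  inj_below n (ar s' aBEST) /\
  (3 * k - 1) * \sum_(0 <= x < n) A x (sg x) <= 4 * k * cfg_weight (ar s' aBEST).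
Proof.
move=> ds aP bl_start bl_two ha s'.
set bl0 := ar s aBL in bl_start bl_two ha *.
set a0 := ar s aAA in aP ha *.
have bl0n i : i < n -> bl0 i <= n.
  by move=> hi; have [h _] := bl_fill bl_start hi; lia.
pose beaten s r := round_beaten n k n`! A sg bl0 a0 (rg s rbest).-1 r.
pose I r s' := [/\ rounds_data s', forall i, i < n -> ar s' aBL i = cyc_shift n bl0 r i,
  arrangement n sg (ar s' aBL) (ar s' aAA) /\
   (forall j, j < n -> ow (ar s' aAA j) = cyc_shift n (fun i => ow (a0 i)) r j),
  forall r', r' < r -> beaten s' r' &
  best_valid s' /\ (0 < r -> 0 < rg s' rbest)].
rewrite /s' /p_rounds den_seq den_set; set s1 := setr s rbest _.
have ds1 : rounds_data s1 by apply: rounds_data_frame (frame_setr _ _ _) ds.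
have K1 : rg s1 rK = k by case: ds1 => [[]].
suff : I (rg s1 rK) (den H (CFor rr rK (CSeq p_dir (CSeq p_dir p_shift))) s1).
  rewrite K1; set s2 := den _ _ _ => -[i1 i2 i3 i4 [i5 i6]].
  have [v1 v2] := i5 (i6 (ltn_trans (ltn0Sn 1) k3)); split=> //.
  have -> : cfg_weight (ar s2 aBEST) = (rg s2 rbest).-1 by rewrite -v2.
  exact: (rounds_bound k3 kn n0 A_sym A_tri sgP sgT (fact_gt0 n) aP bl_start bl_two ha i4).
apply: for_ind => //.
  split.
  - by apply: rounds_data_frame (frame_setr rr 0 s1) ds1.
  - by move=> i hi; rewrite /cyc_shift addn0 modn_small.
  - by split=> // j hj; rewrite /cyc_shift addn0 modn_small.
  - by [].
  - by split=> //; rewrite /best_valid.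
move=> r s2 hr rr_ frs2 [i1 i2 [i3 i3'] i4 [i5 i6]].
rewrite 2!den_seq.
have bn2 i : i < n -> ar s2 aBL i <= n by move=> hi; rewrite i2 // /cyc_shift bl0n ?ltn_pmod.
have [[d1 e1 a1 o1] [cfg1 [c10 c11 c12]] m1 p1 v1] := dir_spec i1 bn2 i3 i5.
set s3 := den H p_dir s2 in d1 e1 a1 o1 c11 c12 m1 p1 v1 *.
have bn3 i : i < n -> ar s3 aBL i <= n by move=> hi; rewrite e1 // leq_subr.
have [[d2 e2 a2 o2] [cfg2 [c20 c21 c22]] m2 p2 v2] := dir_spec d1 bn3 a1 v1.
set s4 := den H p_dir s3 in d2 e2 a2 o2 c21 c22 m2 p2 v2 *.
have frs5 := den_frame H p_shift s4; have [fr5 fa5] := frs5.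
have [h1 h2] := shift_spec d2.
set s5 := den H p_shift s4 in frs5 fr5 fa5 h1 h2 *.
have rotS f j : j < n -> cyc_shift n f r (j.+1 %% n) = cyc_shift n f r.+1 j.
  by move=> hj; rewrite /cyc_shift modnDml addSnnS.
have b4 i : i < n -> ar s4 aBL i = ar s2 aBL i.
  by move=> hi; rewrite e2 // e1 // subKn // bn2.
have best5 : rg s5 rbest = rg s4 rbest by rewrite fr5.
have lt_mod i : i.+1 %% n < n by rewrite ltn_pmod.
clearbody s5 s4 s3; split.
- apply: (rounds_data_frame _ _ (frame_setr rr r.+1 s5)) => //.
  exact: rounds_data_frame frs5 d2.
- by move=> i hi; rewrite /= h2 // b4 // i2 // rotS.
- split=> [|j hj] /=; last by rewrite h1 // o2 // o1 // i3' // rotS.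
  apply: (@eq_arrangement_labels n sg n0 (fun i => ar s4 aBL (i.+1 %% n))).
    by move=> i hi; rewrite h2.
  apply: (@eq_arrangement n sg _ (fun i => ar s4 aAA (i.+1 %% n))) => //.
    by move=> i hi; rewrite h1.
  exact: arrangement_shift.
- move=> r' hr'; rewrite /beaten /= /update /= best5.
  (* The best weight only grows, so the rounds beaten earlier stay beaten. *)
  have mono x y lab : x <= y -> run_beaten n k n`! A sg a0 x r' lab ->
      run_beaten n k n`! A sg a0 y r' lab.
    move=> xy [bl' [cfg [q1 q2 q3 q4 q5]]]; exists bl', cfg; split=> //.
    exact: leq_trans xy.
  have le24 : (rg s2 rbest).-1 <= (rg s4 rbest).-1 by lia.
  have [er|ne] := eqVneq r' r; last first.
    have [|x1 x2] := i4 r'; first by lia.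
    by split; [apply: mono x1 | apply: mono x2].
  (* The second run of the round had the labels complemented twice, that is, the original order; the
     first one had the reverse order. *)
  rewrite er; split.
    exists (ar s4 aBL), cfg2; split=> //.
    + by move=> i hi; rewrite b4 // i2.
    + rewrite c20; apply: (@eq_arrangement_labels n sg n0 (fun i => n - ar s3 aBL i)).
        by move=> i hi; rewrite e2.
      exact: arrangement_compl.
    + by move=> j hj; rewrite c20 -/ow o1 // i3'.
  exists (ar s3 aBL), cfg1; split=> //.
  + by move=> i hi; rewrite e1 // i2.
  + rewrite c10; apply: (@eq_arrangement_labels n sg n0 (fun i => n - ar s2 aBL i)).
      by move=> i hi; rewrite e1.
    exact: arrangement_compl.
  + by move=> j hj; rewrite c10 -/ow i3'.
  + by apply: leq_trans c12 _; lia.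
- split=> [|_] /=; last by rewrite /update /= best5.
  rewrite /best_valid /= /update /= best5 => h.
  have [w1 w2] := v2 h.
  have E i : i < n -> ar s4 aBEST i = ar s5 aBEST i by rewrite fa5.
  by split; [apply: eq_inj_below E w1 | rewrite -(eq_cfg_weight E)].
Qed.

End RoundsProgram.

(** * The Hungarian method *)

Section Hungarian.

Variables (n : nat) (G : nat -> nat -> nat).

(* [p j] is one more than the row matched to the column [j], and 0 if [j] is
   free; the column [n] is a dummy holding the row that is being inserted. *)
Definition tight (u v p : nat -> nat) (c j : nat) : Prop :=
  u (p c).-1 + v j = G (p c).-1 j.

Definition dual_feasible (u v : nat -> nat) : Prop :=
  forall x j, x < n -> j < n -> G x j <= u x + v j.

(** The first [m] rows are matched along tight edges. Keeping [v] at 0 on free columns bounds every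
    dual step by the row potentials, which therefore stay natural numbers. *)
Definition matched (m : nat) (u v p : nat -> nat) : Prop :=
  [/\ dual_feasible u v,
      forall j, j < n -> 0 < p j -> p j <= m /\ tight u v p j j,
      forall i j, i < n -> j < n -> 0 < p i -> p i = p j -> i = j,
      forall x, x < m -> exists2 j, j < n & p j = x.+1
    & forall j, j < n -> p j = 0 -> v j = 0].

(* The columns of the alternating tree, the latest first. *)
Fixpoint tree (u v p way : nat -> nat) (l : seq nat) : Prop :=
  if l is c :: l' then
    (if c == n then l' = [::] else way c \in l' /\ tight u v p (way c) c)
    /\ tree u v p way l'
  else True.

(** [mv j] is the least slack of the column [j] over the rows of the tree, attained at [way j]; it
    is written without subtraction. *)
Definition slack_ok (u v p mv way : nat -> nat) (us : seq nat) (j : nat) : Prop :=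
  [/\ way j \in us, mv j + G (p (way j)).-1 j = u (p (way j)).-1 + v j
    & forall c, c \in us -> mv j + G (p c).-1 j <= u (p c).-1 + v j].

(** [us] are the columns already scanned and [j0] is the latest one. Before the first scan [mv] and
    [way] are left over from the previous insertion, hence the condition on [us] in the last
    clause. *)
Record search (x : nat) (u v p mv way : nat -> nat) (us : seq nat) (j0 : nat) : Prop :=
  Search {
    search_matched : matched x u v p;
    search_dummy : p n = x.+1;
    search_uniq : uniq (j0 :: us);
    search_le : forall c, c \in j0 :: us -> c <= n;
    search_pos : forall c, c \in us -> 0 < p c;
    search_tree : tree u v p way (j0 :: us);
    search_slack : us != [::] -> forall j, j < n -> j \notin us ->
      slack_ok u v p mv way us j
  }.

Lemma eq_tree u v p way u' v' p' way' l :
  (forall c, c \in l -> way c = way' c) ->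
  (forall c d, c \in l -> d \in l -> tight u v p c d -> tight u' v' p' c d) ->
  tree u v p way l -> tree u' v' p' way' l.
Proof.
elim: l => [//|c l IH] hw ht [h1 h2]; split.
  move: h1; case: eqP => // _ [h3 h4]; rewrite -hw ?mem_head //; split=> //.
  by apply: ht => //; rewrite ?mem_head // inE h3 orbT.
apply: IH h2 => [d hd|d e hd he]; first by apply: hw; rewrite inE hd orbT.
by apply: ht; rewrite inE ?hd ?he orbT.
Qed.

Lemma tree_suffix u v p way l1 l2 : tree u v p way (l1 ++ l2) -> tree u v p way l2.
Proof. by elim: l1 => // c l1 IH [_ /IH]. Qed.

Section Grow.

Variables (x : nat) (u v p mv way : nat -> nat) (us : seq nat) (j0 : nat).
Hypothesis xn : x < n.
Hypothesis S : search x u v p mv way us j0.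
Hypothesis p0 : 0 < p j0.
Let us' := j0 :: us.
Let rows := [seq (p c).-1 | c <- us'].

Variables (mv1 way1 : nat -> nat).
Let cur j := u (p j0).-1 + v j - G (p j0).-1 j.
Hypothesis scan : forall j, j < n -> j \notin us' ->
  if (us == [::]) || (cur j < mv j) then mv1 j = cur j /\ way1 j = j0
  else mv1 j = mv j /\ way1 j = way j.
Hypothesis scan_way : forall j, j \in us' -> way1 j = way j.

Lemma search_pos' c : c \in us' -> 0 < p c.
Proof. by rewrite inE => /orP[/eqP->//|]; apply: search_pos S c. Qed.

Lemma search_row c : c \in us' -> (p c).-1 < n.
Proof.
move=> hc; have c0 := search_pos' hc.
have [_ h _ _ _] := search_matched S.
have := search_le S hc; rewrite leq_eqVlt => /orP[/eqP->|cn].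
  by rewrite (search_dummy S).
by have [] := h _ cn c0; lia.
Qed.

Variable f : nat.
Hypotheses (fn : f < n) (pf : p f = 0).

Lemma scan_slack j : j < n -> j \notin us' -> slack_ok u v p mv1 way1 us' j.
Proof.
move=> hj nj; have := scan hj nj.
have feas c : c \in us' -> G (p c).-1 j <= u (p c).-1 + v j.
  by move=> hc; have [h _ _ _ _] := search_matched S; apply: h => //; apply: search_row.
have curE : cur j + G (p j0).-1 j = u (p j0).-1 + v j.
  by rewrite /cur subnK // feas ?mem_head.
rewrite /slack_ok; case: eqP => [us0|/eqP usn].
  move=> /= [-> ->]; split=> // [|c]; first by rewrite /us' mem_head.
  by rewrite /us' us0 inE => /eqP->; rewrite curE.
have nj' : j \notin us by move: nj; rewrite inE negb_or => /andP[].
have [s1 s2 s3] := search_slack S usn hj nj'.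
rewrite /=; case: ltnP => hc [-> ->]; split=> //.
- by rewrite mem_head.
- move=> c; rewrite inE => /orP[/eqP->|hc']; first by rewrite curE.
  by have := s3 _ hc'; lia.
- by rewrite inE s1 orbT.
- by move=> c; rewrite inE => /orP[/eqP->|/s3//]; lia.
Qed.

Variables (delta j1 : nat).
Hypotheses (j1n : j1 < n) (nj1 : j1 \notin us') (deltaE : delta = mv1 j1).
Hypothesis delta_min : forall j, j < n -> j \notin us' -> delta <= mv1 j.

Variables (u' v' mv' : nat -> nat).
Hypothesis u'E : forall y, y < n -> u' y = if y \in rows then u y - delta else u y.
Hypothesis v'E : forall j, j <= n -> v' j = if j \in us' then v j + delta else v j.
Hypothesis mv'E : forall j, j < n -> j \notin us' -> mv' j = mv1 j - delta.

Lemma free_notin : f \notin us'.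
Proof. by apply/negP => /search_pos'; rewrite pf. Qed.

(** At a free column [v] is 0, so the slack there is at most the row potential, and [delta] is at
    most that slack. The differences [u y - delta] are therefore exact. *)
Lemma delta_le c : c \in us' -> delta <= u (p c).-1.
Proof.
move=> hc; have [_ _ h] := scan_slack fn free_notin.
have [_ _ _ _ /(_ f fn pf) vf] := search_matched S.
have := delta_min fn free_notin; have := h _ hc; lia.
Qed.

Lemma row_used c : c \in us' -> u' (p c).-1 = u (p c).-1 - delta.
Proof. move=> hc; by rewrite u'E ?search_row // ifT // (map_f (fun c => (p c).-1)). Qed.

Lemma col_row j : j < n -> 0 < p j -> ((p j).-1 \in rows) = (j \in us').
Proof.
move=> hj j0'; apply/idP/idP => [/mapP[c hc e]|]; last exact: (map_f (fun c => (p c).-1)).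
have c0 := search_pos' hc; have {}e : p j = p c by lia.
have [_ h2 h3 _ _] := search_matched S.
have := search_le S hc; rewrite leq_eqVlt => /orP[/eqP cn|cn].
  by have [] := h2 _ hj j0'; rewrite e cn (search_dummy S) ltnn.
by rewrite (h3 _ _ hj cn j0' e).
Qed.

(** Lowering [u] on the rows and raising [v] on the columns of the tree by the least slack keeps its
    edges tight, keeps the dual feasible and makes the edge that reaches [j1] tight. *)
Lemma grow : search x u' v' p mv' way1 us' j1.
Proof.
have [m1 m2 m3 m4 m5] := search_matched S.
have v'En j : j < n -> v' j = if j \in us' then v j + delta else v j.
  by move=> hj; rewrite v'E // ltnW.
have tight_used c d : c \in us' -> d \in us' -> tight u v p c d -> tight u' v' p c d.
  move=> hc hd; rewrite /tight row_used // v'E ?hd; last exact: (search_le S).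
  by have := delta_le hc; lia.
split.
- split.
  + move=> y j hy hj; rewrite u'E // v'En //.
    case: ifP => hyr; last by have := m1 _ _ hy hj; case: ifP; lia.
    case/mapP: hyr hy => c hc -> hy; have := delta_le hc.
    case: ifP => hju; first by have := m1 _ _ hy hj; lia.
    have [_ _ /(_ c hc)] := scan_slack hj (negbT hju).
    have := delta_min hj (negbT hju); lia.
  + move=> j hj pj; have [h t] := m2 _ hj pj; split=> //.
    rewrite /tight u'E ?v'En //; last by lia.
    rewrite col_row //; case: ifP => hju; last exact: t.
    by move: t; rewrite /tight; have := delta_le hju; lia.
  + exact: m3.
  + exact: m4.
  + move=> j hj pj; rewrite v'En // ifN ?m5 //.
    by apply/negP => /search_pos'; rewrite pj.
- exact: search_dummy S.
- by rewrite cons_uniq nj1 (search_uniq S).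
- by move=> c; rewrite inE => /orP[/eqP->|/(search_le S)//]; rewrite ltnW.
- exact: search_pos'.
- split.
    rewrite ltn_eqF //; have [s1 s2 s3] := scan_slack j1n nj1; split=> //.
    rewrite /tight row_used // v'En // (negbTE nj1).
    by have := delta_le s1; rewrite deltaE; lia.
  by apply: eq_tree (search_tree S) => // c hc; rewrite scan_way.
- move=> _ j hj nj; have [s1 s2 s3] := scan_slack hj nj; split=> //.
    rewrite row_used // mv'E // v'En // (negbTE nj).
    by have := delta_le s1; have := delta_min hj nj; lia.
  move=> c hc; rewrite row_used // mv'E // v'En // (negbTE nj).
  have := s3 _ hc; have := delta_le hc; have := delta_min hj nj; lia.
Qed.

End Grow.

(* The hole [j0] moves along the tree to the dummy column. *)
Record hole (x : nat) (u v p way : nat -> nat) (us : seq nat) (j0 : nat) : Prop :=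
  Hole {
    hole_dual : dual_feasible u v;
    hole_uniq : uniq (j0 :: us);
    hole_le : forall c, c \in j0 :: us -> c <= n;
    hole_tree : tree u v p way (j0 :: us);
    hole_pos : forall c, c \in us -> 0 < p c;
    hole_tight : forall j, j <= n -> j != j0 -> 0 < p j ->
      p j <= x.+1 /\ (j < n -> tight u v p j j);
    hole_inj : forall i j, i <= n -> j <= n -> i != j0 -> j != j0 ->
      0 < p i -> p i = p j -> i = j;
    hole_onto : forall y, y <= x -> exists j, [/\ j <= n, j != j0 & p j = y.+1];
    hole_free : forall j, j < n -> j != j0 -> p j = 0 -> v j = 0
  }.

Lemma hole_start x u v p mv way us j0 : j0 < n -> p j0 = 0 ->
  search x u v p mv way us j0 -> hole x u v p way us j0.
Proof.
move=> jn pj S; have [m1 m2 m3 m4 m5] := search_matched S.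
have pn := search_dummy S.
split=> //; try by case: S.
- move=> j; rewrite leq_eqVlt => /orP[/eqP->|hj] _ p0; first by rewrite pn ltnn.
  by have [h t] := m2 _ hj p0; split=> //; lia.
- move=> i j hi hj _ _; move: hi hj; rewrite (leq_eqVlt i) (leq_eqVlt j).
  move=> /orP[/eqP->|hi] /orP[/eqP->|hj] // p0 e.
  + by have [] := m2 _ hj; rewrite -e // pn ltnn.
  + by have [] := m2 _ hi p0; rewrite e pn ltnn.
  + exact: m3.
- move=> y; rewrite leq_eqVlt => /orP[/eqP->|hy].
    by exists n; rewrite leqnn pn gtn_eqF.
  have [j hj ej] := m4 _ hy; exists j; split=> //; first exact: ltnW.
  by apply/eqP => e; rewrite e pj in ej.
- by move=> j hj _; apply: m5.
Qed.

(** The row of the parent [way j0] moves to [j0] along a tight edge and leaves the hole behind. What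
    follows the parent in [us] is still a tree, and it is shorter. *)
Lemma hole_move x u v p way us j0 p' : j0 != n -> hole x u v p way us j0 ->
  (forall j, j <= n -> p' j = if j == j0 then p (way j0) else p j) ->
  exists2 us', size us' < size us & hole x u v p' way us' (way j0).
Proof.
move=> nj0 h p'E; have := hole_tree h; rewrite /= (negbTE nj0) => -[[wu wt] tr].
move: h tr; case/splitPr: wu => l1 us1 h tr; exists us1.
  by rewrite size_cat /= addnS ltnS leq_addl.
have := hole_uniq h; rewrite cons_uniq mem_cat negb_or cat_uniq.
move=> /andP[/andP[_ nj] /and3P[_ _ un]].
set j1 := way j0 in wt p'E h tr nj un *.
have j10 : j1 != j0 by apply: contraNneq nj => ->; rewrite mem_head.
have in_us c : c \in j1 :: us1 -> c \in l1 ++ j1 :: us1 by rewrite mem_cat orbC => ->.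
have le_n c : c \in j1 :: us1 -> c <= n.
  by move=> /in_us hc; apply: (hole_le h); rewrite inE hc orbT.
have j1n : j1 <= n by apply: le_n; rewrite mem_head.
have p1 : 0 < p j1 by apply: (hole_pos h); rewrite in_us ?mem_head.
have p'j c : c \in j1 :: us1 -> p' c = p c.
  move=> hc; rewrite p'E ?le_n //; case: eqP => // e.
  by move: nj; rewrite -e hc.
split=> //.
- exact: hole_dual h.
- apply: eq_tree (tree_suffix tr) => // c d hc hd.
  by rewrite /tight p'j.
- move=> c hc; have hc' : c \in j1 :: us1 by rewrite inE hc orbT.
  by rewrite p'j //; apply: (hole_pos h); apply: in_us.
- move=> j hj nj1; rewrite p'E //; case: eqP => [->|/eqP nj0'] p0.
    have [h1 _] := hole_tight h j1n j10 p1; split=> // _.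
    rewrite /tight p'E ?eqxx //; apply: (hole_le h); exact: mem_head.
  have [h1 h2] := hole_tight h hj nj0' p0; split=> // /h2.
  by rewrite /tight p'E // (negbTE nj0').
- move=> i j hi hj ni nj'; rewrite !p'E //.
  case: (i =P j0) => [->|/eqP ni0]; case: (j =P j0) => [->|/eqP nj0'] // p0 e.
  + by have := hole_inj h j1n hj j10 nj0' p0 e => e'; rewrite -e' eqxx in nj'.
  + by have := hole_inj h hi j1n ni0 j10 p0 e => e'; rewrite e' eqxx in ni.
  + exact: (hole_inj h).
- move=> y hy; have [j [hj nj0' e]] := hole_onto h hy.
  have [ej|ne] := eqVneq j j1.
    exists j0; rewrite p'E ?eqxx -?ej //; last by apply: (hole_le h); exact: mem_head.
    split=> //; first by apply: (hole_le h); exact: mem_head.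
    by rewrite eq_sym.
  by exists j; rewrite p'E // (negbTE nj0').
- move=> j hj nj1; rewrite p'E ?(ltnW hj) //; case: eqP => [->|/eqP nj0'] p0.
    by rewrite p0 in p1.
  exact: (hole_free h).
Qed.

Lemma hole_end x u v p way j0 us : j0 = n -> hole x u v p way us j0 ->
  matched x.+1 u v p.
Proof.
move=> -> h; split.
- exact: hole_dual h.
- move=> j hj p0; have [h1 h2] := hole_tight h (ltnW hj) (negbT (ltn_eqF hj)) p0.
  by split=> //; apply: h2.
- move=> i j hi hj; apply: (hole_inj h); rewrite ?(ltnW hi) ?(ltnW hj) //.
    by rewrite ltn_eqF.
  by rewrite ltn_eqF.
- move=> y hy; have [|j [hj nj e]] := hole_onto h (_ : y <= x); first by [].
  by exists j => //; rewrite ltn_neqAle nj.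
- by move=> j hj; apply: (hole_free h); rewrite ?ltn_eqF.
Qed.

Lemma hole_nil x u v p way j0 : hole x u v p way [::] j0 -> j0 = n.
Proof.
by move=> h; have := hole_tree h; rewrite /=; case: eqP => // _ [[]].
Qed.

Lemma hole_dummy x u v p way us : hole x u v p way us n -> us = [::].
Proof. by move=> h; have := hole_tree h; rewrite /= eqxx => -[]. Qed.

(* Complementary slackness. *)
Lemma matched_optimal u v p sg : matched n u v p ->
  (forall j, j < n -> 0 < p j -> sg (p j).-1 = j) ->
  inj_below n sg /\ forall f, inj_below n f ->
    \sum_(0 <= x < n) G x (f x) <= \sum_(0 <= x < n) G x (sg x).
Proof.
move=> [m1 m2 m3 m4 m5] hsg.
have row x : x < n -> exists2 j, j < n & p j = x.+1 /\ sg x = j.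
  move=> hx; have [j hj e] := m4 _ hx; exists j => //; split=> //.
  by rewrite -[x]/(x.+1.-1) -e hsg // e.
have inj : inj_below n sg.
  split=> [x hx|x y hx hy e]; first by have [j hj [_ ->]] := row _ hx.
  have [j hj [e1 s1]] := row _ hx; have [j' hj' [e2 s2]] := row _ hy.
  by move: e e1; rewrite s1 s2 => ->; rewrite e2 => -[].
split=> // f hf.
apply: (@leq_trans (\sum_(0 <= x < n) (u x + v (f x)))).
  by apply: leq_sum_nat => x /andP[_ hx]; apply: m1 => //; case: hf => h _; apply: h.
rewrite big_split /= (sum_inj_below v hf) -(sum_inj_below v inj) -big_split /=.
apply: leq_sum_nat => x /andP[_ hx].
have [j hj [e s]] := row _ hx; have p0 : 0 < p j by rewrite e.
by have [_] := m2 _ hj p0; rewrite /tight e s => ->.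
Qed.

Lemma matched_free m u v p : m < n -> matched m u v p ->
  exists2 j, j < n & p j = 0.
Proof.
move=> mn [m1 m2 m3 m4 m5].
case: (boolP (has (fun j => p j == 0) (iota 0 n))) => [/hasP[j]|/hasPn no].
  by rewrite mem_iota => /andP[_ hj] /eqP e; exists j.
have pos j : j < n -> 0 < p j by move=> hj; rewrite lt0n no // mem_iota.
have u' : uniq (map p (iota 0 n)).
  rewrite map_inj_in_uniq ?iota_uniq // => i j; rewrite !mem_iota => /andP[_ hi] /andP[_ hj].
  by apply: m3 => //; apply: pos.
have s : {subset map p (iota 0 n) <= iota 1 m}.
  move=> y /mapP[j]; rewrite !mem_iota => /andP[_ hj] ->.
  by have [h _] := m2 _ hj (pos _ hj); rewrite pos //= add1n ltnS.
by have := uniq_leq_size u' s; rewrite size_map !size_iota leqNgt mn.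
Qed.

(** The map from rows to their columns is injective on [n] rows, hence onto. *)
Lemma matched_full u v p j : matched n u v p -> j < n -> 0 < p j.
Proof.
move=> [_ _ _ m4 _] hj; pose g x := find (fun i => p i == x.+1) (iota 0 n).
have gP x : x < n -> g x < n /\ p (g x) = x.+1.
  move=> hx; have [i hi e] := m4 _ hx.
  have h : has (fun i => p i == x.+1) (iota 0 n).
    by apply/hasP; exists i; rewrite ?mem_iota ?e.
  have hg : g x < n by rewrite -[n](size_iota 0) -has_find.
  by have := nth_find 0 h; rewrite nth_iota // add0n => /eqP.
have inj : inj_below n g.
  split=> [x /gP[]//|x y hx hy e].
  by have [_ e1] := gP _ hx; have [_ e2] := gP _ hy; move: e1; rewrite e e2 => -[].
have [x hx <-] := inj_below_onto inj hj.
by have [_ ->] := gP _ hx.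
Qed.

End Hungarian.

(** * The program of the Hungarian method *)

Notation rS := 5 (only parsing).
Notation aG := 3 (only parsing).
Notation aU := 4 (only parsing).
Notation aV := 5 (only parsing).
Notation aP := 6 (only parsing).
Notation aMV := 7 (only parsing).
Notation aWAY := 8 (only parsing).
Notation aUSED := 9 (only parsing).
Notation aUR := 17 (only parsing).

Notation rx := 20 (only parsing).
Notation rt := 21 (only parsing).
Notation rj := 22 (only parsing).
Notation rj0 := 23 (only parsing).
Notation rdone := 24 (only parsing).
Notation ri0 := 25 (only parsing).
Notation rcur := 26 (only parsing).
Notation rfirst := 27 (only parsing).
Notation rdelta := 28 (only parsing).
Notation rj1 := 29 (only parsing).

(** [1 - rt] is positive exactly in the first turn of a search, when [aMV] has to be overwritten;
    [rfirst] tells that no candidate for the minimum has been met yet. *)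
Definition p_scan : hcmd :=
  CFor rj rN
   (CIf (EA aUSED (ER rj)) CSkip
   (CSeq (CSet rcur (ESub (EAdd (EA aU (ER ri0)) (EA aV (ER rj)))
                          (EA aG (EAdd (EA aROW (ER ri0)) (ER rj)))))
   (CSeq (CIf (EAdd (ESub (EA aMV (ER rj)) (ER rcur)) (ESub (EC 1) (ER rt)))
             (CSeq (CPut aMV (ER rj) (ER rcur)) (CPut aWAY (ER rj) (ER rj0))) CSkip)
         (CIf (EAdd (ER rfirst) (ESub (ER rdelta) (EA aMV (ER rj))))
             (CSeq (CSet rdelta (EA aMV (ER rj)))
             (CSeq (CSet rj1 (ER rj)) (CSet rfirst (EC 0)))) CSkip)))).

(** The loop has [n + 1] turns in order to include the dummy column. *)
Definition p_update : hcmd :=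
  CFor rj rN1
   (CSeq (CIf (EA aUSED (ER rj))
            (CPut aV (ER rj) (EAdd (EA aV (ER rj)) (ER rdelta)))
            (CPut aMV (ER rj) (ESub (EA aMV (ER rj)) (ER rdelta))))
         (CIf (EA aUR (ER rj))
            (CPut aU (ER rj) (ESub (EA aU (ER rj)) (ER rdelta))) CSkip)).

Definition p_mark : hcmd :=
  CSeq (CPut aUSED (ER rj0) (EC 1))
  (CSeq (CSet ri0 (ESub (EA aP (ER rj0)) (EC 1)))
  (CSeq (CPut aUR (ER ri0) (EC 1)) (CSeq (CSet rfirst (EC 1)) (CSet rdelta (EC 0))))).

Definition p_grow : hcmd :=
  CSeq p_mark (CSeq p_scan (CSeq p_update
  (CSeq (CSet rj0 (ER rj1)) (CIf (EA aP (ER rj0)) CSkip (CSet rdone (EC 1)))))).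

Definition p_search : hcmd := CFor rt rN (CIf (ER rdone) CSkip p_grow).

Definition p_augment : hcmd :=
  CFor rt rN (CIf (neqe (ER rj0) (ER rN))
    (CSeq (CSet rj1 (EA aWAY (ER rj0)))
    (CSeq (CPut aP (ER rj0) (EA aP (ER rj1))) (CSet rj0 (ER rj1)))) CSkip).

Definition p_reset : hcmd :=
  CFor rj rN1 (CSeq (CPut aUSED (ER rj) (EC 0)) (CPut aUR (ER rj) (EC 0))).

Definition p_insert : hcmd :=
  CSeq (CPut aP (ER rN) (EAdd (ER rx) (EC 1)))
  (CSeq (CSet rj0 (ER rN)) (CSeq (CSet rdone (EC 0))
  (CSeq p_reset (CSeq p_search p_augment)))).

(** The potentials [u = 2 * S] and [v = 0] are feasible at the start, all entries of [aG] being at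
    most [2 * S]. The last loop inverts the matching. *)
Definition p_hungarian : hcmd :=
  CSeq (CFor rj rN (CPut aU (ER rj) (EAdd (ER rS) (ER rS))))
  (CSeq (CFor rx rN p_insert)
        (CFor rj rN (CPut aSG (ESub (EA aP (ER rj)) (EC 1)) (ER rj)))).

Section HungarianProgram.

Variables (H n : nat) (G : nat -> nat -> nat).

Definition hung_data (s : hstate) : Prop :=
  [/\ rg s rN = n, rg s rN1 = n.+1
    & forall i j, i < n -> j < n -> ar s aG (ar s aROW i + j) = G i j].

Lemma hung_data_frame rs as_ s s' :
  all (fun r => r \notin rs) [:: rN; rN1] ->
  all (fun a => a \notin as_) [:: aG; aROW] ->
  frame rs as_ s s' -> hung_data s -> hung_data s'.
Proof.
move=> /and3P[r1 r2 _] /and3P[a1 a2 _] [fr fa] [h1 h2 h3].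
by split; rewrite ?fr // => i j ??; rewrite !fa ?h3.
Qed.

Lemma scan_spec s : hung_data s -> rg s ri0 < n -> rg s rfirst = 1 ->
  (exists2 f, f < n & ar s aUSED f = 0) ->
  let s' := den H p_scan s in
  let cur j := ar s aU (rg s ri0) + ar s aV j - G (rg s ri0) j in
  [/\ forall j, ar s aUSED j != 0 \/ n <= j ->
        ar s' aMV j = ar s aMV j /\ ar s' aWAY j = ar s aWAY j,
      forall j, j < n -> ar s aUSED j = 0 ->
        if (rg s rt == 0) || (cur j < ar s aMV j)
        then ar s' aMV j = cur j /\ ar s' aWAY j = rg s rj0
        else ar s' aMV j = ar s aMV j /\ ar s' aWAY j = ar s aWAY j
    & [/\ rg s' rj1 < n, ar s aUSED (rg s' rj1) = 0,
          rg s' rdelta = ar s' aMV (rg s' rj1)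
        & forall j, j < n -> ar s aUSED j = 0 -> rg s' rdelta <= ar s' aMV j]].
Proof.
move=> [hN _ hG] i0n first1 [f fn fu] s' cur.
pose upd j := (rg s rt == 0) || (cur j < ar s aMV j).
pose mvF j := if ar s aUSED j != 0 then ar s aMV j
  else if upd j then cur j else ar s aMV j.
pose wayF j := if ar s aUSED j != 0 then ar s aWAY j
  else if upd j then rg s rj0 else ar s aWAY j.
pose I m s' := [/\ forall j, ar s' aMV j = if j < m then mvF j else ar s aMV j,
  forall j, ar s' aWAY j = if j < m then wayF j else ar s aWAY j &
  (rg s' rfirst = 1 /\ (forall j, j < m -> ar s aUSED j != 0)) \/
  [/\ rg s' rfirst = 0, rg s' rj1 < m, ar s aUSED (rg s' rj1) = 0,
     rg s' rdelta = mvF (rg s' rj1) &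
     forall j, j < m -> ar s aUSED j = 0 -> rg s' rdelta <= mvF j]].
have : I (rg s rN) s'.
  apply: for_ind => //; first by split=> //; left.
  move=> m s1; rewrite hN => hm rjE [fr fa] [i1 i2 i3].
  have u1 : ar s1 aUSED = ar s aUSED by rewrite fa.
  have U1 : ar s1 aU = ar s aU by rewrite fa.
  have V1 : ar s1 aV = ar s aV by rewrite fa.
  have R1 : ar s1 aROW = ar s aROW by rewrite fa.
  have G1 : ar s1 aG = ar s aG by rewrite fa.
  have e0 : rg s1 ri0 = rg s ri0 by rewrite fr.
  have et : rg s1 rt = rg s rt by rewrite fr.
  have ej0 : rg s1 rj0 = rg s rj0 by rewrite fr.
  have M1 : ar s1 aMV m = ar s aMV m by rewrite i1 ltnn.
  rewrite den_if.
  have -> : heval H s1 (EA aUSED (ER rj)) = ar s aUSED m by rewrite /= rjE /idx /= u1.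
  case: (boolP (ar s aUSED m != 0)) => used.
    have mv_m : mvF m = ar s aMV m by rewrite /mvF used.
    have way_m : wayF m = ar s aWAY m by rewrite /wayF used.
    split=> /= [j|j|].
    - by rewrite i1 ltnS; case: (ltngtP j m) => // ->.
    - by rewrite i2 ltnS; case: (ltngtP j m) => // ->.
    - rewrite /update /=; case: i3 => [[h1 h2]|[h1 h2 h3 h4 h5]].
        left; split=> // j; rewrite ltnS leq_eqVlt => /orP[/eqP->//|]; exact: h2.
      right; split=> //; first exact: ltnW.
      move=> j; rewrite ltnS leq_eqVlt => /orP[/eqP->|]; last exact: h5.
      by move=> e; rewrite e in used.
  have used0 : ar s aUSED m = 0 by apply/eqP; rewrite negbK in used.
  have mv_m : mvF m = if upd m then cur m else ar s aMV m by rewrite /mvF used0.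
  have way_m : wayF m = if upd m then rg s rj0 else ar s aWAY m by rewrite /wayF used0.
  rewrite !denE; set s2 := setr s1 rcur _.
  have s2a : ar s2 = ar s1 by [].
  have s2r : rg s2 = update (rg s1) rcur (cur m).
    by rewrite /s2 /= /idx /= rjE U1 V1 e0 G1 R1 hG.
  clearbody s2.
  set s3 := (if heval H s2 _ != 0 then _ else _).
  have condE : (heval H s2 (EAdd (ESub (EA aMV (ER rj)) (ER rcur))
      (ESub (EC 1) (ER rt))) != 0) = upd m.
    by rewrite /= s2r s2a /update /idx /= rjE M1 et /upd; lia.
  have [s31 s32 s33] : [/\ forall j, ar s3 aMV j = if j == m then mvF m else ar s1 aMV j,
      forall j, ar s3 aWAY j = if j == m then wayF m else ar s1 aWAY j &
      rg s3 = rg s2].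
    rewrite /s3 condE mv_m way_m; case: (upd m); split=> //.
    - by move=> j; rewrite /= s2r s2a /update /idx /= rjE.
    - by move=> j; rewrite /= s2r s2a /update /idx /= rjE ej0.
    - by move=> j /=; rewrite s2a; case: eqP => // ->.
    - by move=> j /=; rewrite s2a i2; case: eqP => // ->; rewrite ltnn.
  have rj3 : rg s3 rj = m by rewrite s33 s2r /update /= rjE.
  clearbody s3.
  have cond2 : (heval H s3 (EAdd (ER rfirst) (ESub (ER rdelta) (EA aMV (ER rj)))) != 0)
      = (rg s1 rfirst != 0) || (mvF m < rg s1 rdelta).
    by rewrite /= rj3 /idx /= s31 eqxx s33 s2r /update /=; lia.
  rewrite cond2.
  have A1 j : (if j == m then mvF m else ar s1 aMV j) = (if j < m.+1 then mvF j else ar s aMV j).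
    by rewrite i1 ltnS; case: (ltngtP j m) => // ->.
  have A2 j : (if j == m then wayF m else ar s1 aWAY j) = (if j < m.+1 then wayF j else ar s aWAY j).
    by rewrite i2 ltnS; case: (ltngtP j m) => // ->.
  case: ifP => hc; split=> /= [j|j|]; rewrite ?s31 ?s32 //.
  - right; rewrite /update /idx /= rj3 eqxx; split=> //.
    move=> j; rewrite ltnS leq_eqVlt => /orP[/eqP->//|hj] uj.
    case: i3 => [[_ h2]|[h1 h2 h3 h4 h5]]; first by have := h2 _ hj; rewrite uj.
    by move: hc; rewrite h1 /= => hc; apply: leq_trans (ltnW hc) (h5 _ hj uj).
  - rewrite s33 s2r /update /=; case: i3 => [[h1 h2]|[h1 h2 h3 h4 h5]].
      by move: hc; rewrite h1.
    right; split=> //; first exact: ltnW.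
    move=> j; rewrite ltnS leq_eqVlt => /orP[/eqP->|]; last exact: h5.
    by move: hc; rewrite h1 /= => /negbT; rewrite -leqNgt.
rewrite hN => -[I1 I2 I3].
split.
- move=> j hj; rewrite I1 I2; case: ltnP => // jn.
  by case: hj => [u|]; [rewrite /mvF /wayF u | lia].
- by move=> j hj uj; rewrite I1 I2 hj /mvF /wayF uj /= -/(upd j); case: (upd j).
- case: I3 => [[_ h2]|[h1 h2 h3 h4 h5]]; first by have := h2 _ fn; rewrite fu.
  by split=> //; [rewrite I1 h2 | move=> j hj uj; rewrite I1 hj; apply: h5].
Qed.

Lemma update_spec s : hung_data s -> let s' := den H p_update s in
  [/\ forall j, j <= n -> ar s' aV j =
        if ar s aUSED j != 0 then ar s aV j + rg s rdelta else ar s aV j,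
      forall j, j <= n -> ar s' aMV j =
        if ar s aUSED j != 0 then ar s aMV j else ar s aMV j - rg s rdelta
    & forall j, j <= n -> ar s' aU j =
        if ar s aUR j != 0 then ar s aU j - rg s rdelta else ar s aU j].
Proof.
move=> [_ hN1 _] s'; split=> j hj.
- rewrite (for_map (g := fun j => if ar s aUSED j != 0
    then ar s aV j + rg s rdelta else ar s aV j)) // ?hN1 ?ltnS ?hj //.
  move=> i s1 hi ri [fr fa] IH l; rewrite den_seq.
  have [_ fa2] := den_frame H (CIf (EA aUR (ER rj))
     (CPut aU (ER rj) (ESub (EA aU (ER rj)) (ER rdelta))) CSkip) (den H (CIf (EA aUSED (ER rj))
            (CPut aV (ER rj) (EAdd (EA aV (ER rj)) (ER rdelta)))
            (CPut aMV (ER rj) (ESub (EA aMV (ER rj)) (ER rdelta)))) s1).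
  rewrite fa2 // den_if /= ri /idx /= fa //.
  by case: (ar s 9 i != 0) => /=; case: eqP => // e; rewrite ?e ?IH ?ltnn ?fr.
- rewrite (for_map (g := fun j => if ar s aUSED j != 0
    then ar s aMV j else ar s aMV j - rg s rdelta)) // ?hN1 ?ltnS ?hj //.
  move=> i s1 hi ri [fr fa] IH l; rewrite den_seq.
  have [_ fa2] := den_frame H (CIf (EA aUR (ER rj))
     (CPut aU (ER rj) (ESub (EA aU (ER rj)) (ER rdelta))) CSkip) (den H (CIf (EA aUSED (ER rj))
            (CPut aV (ER rj) (EAdd (EA aV (ER rj)) (ER rdelta)))
            (CPut aMV (ER rj) (ESub (EA aMV (ER rj)) (ER rdelta)))) s1).
  rewrite fa2 // den_if /= ri /idx /= fa //.
  by case: (ar s 9 i != 0) => /=; case: eqP => // e; rewrite ?e ?IH ?ltnn ?fr.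
- rewrite (for_map (g := fun j => if ar s aUR j != 0
    then ar s aU j - rg s rdelta else ar s aU j)) // ?hN1 ?ltnS ?hj //.
  move=> i s1 hi ri [fr fa] IH l; rewrite den_seq.
  set s2 := den H (CIf (EA aUSED (ER rj)) _ _) s1.
  have [fr2 fa2] := den_frame H (CIf (EA aUSED (ER rj))
            (CPut aV (ER rj) (EAdd (EA aV (ER rj)) (ER rdelta)))
            (CPut aMV (ER rj) (ESub (EA aMV (ER rj)) (ER rdelta)))) s1.
  have E1 : ar s2 aU = ar s1 aU by rewrite fa2.
  have E2 : ar s2 aUR = ar s aUR by rewrite fa2 // fa.
  have E3 : rg s2 rj = i by rewrite fr2.
  have E4 : rg s2 rdelta = rg s rdelta by rewrite fr2 // fr.
  rewrite den_if /= E3 /idx /= E2.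
  case: (ar s 17 i != 0) => /=; rewrite ?E3 /idx /= ?E3 ?E1 ?E4;
    by case: eqP => // e; rewrite ?e ?IH ?ltnn.
Qed.

Definition tree_state (x : nat) (us : seq nat) (s : hstate) : Prop :=
  [/\ search n G x (ar s aU) (ar s aV) (ar s aP) (ar s aMV) (ar s aWAY) us (rg s rj0),
      forall c, c <= n -> (ar s aUSED c != 0) = (c \in us)
    & forall y, y < n -> (ar s aUR y != 0) = (y \in [seq (ar s aP c).-1 | c <- us])].

Lemma mark_spec s : let s' := den H p_mark s in
  [/\ forall c, ar s' aUSED c = if c == rg s rj0 then 1 else ar s aUSED c,
      rg s' ri0 = (ar s aP (rg s rj0)).-1,
      forall y, ar s' aUR y = if y == (ar s aP (rg s rj0)).-1 then 1 else ar s aUR y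
    & rg s' rfirst = 1].
Proof. by rewrite /p_mark !denE /= /update /idx /= subn1; split. Qed.

Lemma grow_spec s x us : hung_data s -> x < n -> tree_state x us s ->
  0 < ar s aP (rg s rj0) -> (rg s rt == 0) = (us == [::]) ->
  let s' := den H p_grow s in
  tree_state x (rg s rj0 :: us) s' /\
  rg s' rdone = if ar s' aP (rg s' rj0) == 0 then 1 else rg s rdone.
Proof.
move=> ds xn [S hused hur] p0 ht s'.
rewrite /s' /p_grow 3!den_seq.
have frs1 := den_frame H p_mark s; have [fr1 fa1] := frs1.
have [k1 k2 k3 k4] := mark_spec s.
set s1 := den H p_mark s in frs1 fr1 fa1 k1 k2 k3 k4 *.
have ds1 : hung_data s1 by apply: hung_data_frame frs1 ds.
have i0n : rg s1 ri0 < n by rewrite k2; apply: (search_row xn S p0 (mem_head _ _)).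
have [f fn pf] := matched_free xn (search_matched S).
have ff := free_notin S p0 pf.
have used1 c : c <= n -> (ar s1 aUSED c != 0) = (c \in rg s rj0 :: us).
  by move=> hc; rewrite k1 inE; case: (c =P rg s rj0) => //= _; apply: hused.
have used1' c : c < n -> c \notin rg s rj0 :: us -> ar s1 aUSED c = 0.
  by move=> hc nc; apply/eqP; rewrite -[_ == _]negbK used1 ?(ltnW hc).
have ex : exists2 f, f < n & ar s1 aUSED f = 0 by exists f => //; apply: used1'.
have [q1 q2 [q3 q4 q5 q6]] := scan_spec ds1 i0n k4 ex.
have frs2 := den_frame H p_scan s1; have [fr2 fa2] := frs2.
set s2 := den H p_scan s1 in frs2 fr2 fa2 q1 q2 q3 q4 q5 q6 *.
have ds2 : hung_data s2 by apply: hung_data_frame frs2 ds1.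
have [w1 w2 w3] := update_spec ds2.
have frs3 := den_frame H p_update s2; have [fr3 fa3] := frs3.
set s3 := den H p_update s2 in frs3 fr3 fa3 w1 w2 w3 *.
have U1 : ar s1 aU = ar s aU by rewrite fa1.
have V1 : ar s1 aV = ar s aV by rewrite fa1.
have P1 : ar s1 aP = ar s aP by rewrite fa1.
have M1 : ar s1 aMV = ar s aMV by rewrite fa1.
have W1 : ar s1 aWAY = ar s aWAY by rewrite fa1.
have t1 : rg s1 rt = rg s rt by rewrite fr1.
have j01 : rg s1 rj0 = rg s rj0 by rewrite fr1.
rewrite U1 V1 M1 W1 t1 j01 k2 in q2 w1 w3 *.
rewrite M1 W1 in q1.
have U2 : ar s2 aU = ar s aU by rewrite fa2.
have V2 : ar s2 aV = ar s aV by rewrite fa2.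
have P3 : ar s3 aP = ar s aP by rewrite fa3 // fa2.
have W3 : ar s3 aWAY = ar s2 aWAY by rewrite fa3.
have E2 : ar s2 aUSED = ar s1 aUSED by rewrite fa2.
have R2 : ar s2 aUR = ar s1 aUR by rewrite fa2.
have j13 : rg s3 rj1 = rg s2 rj1 by rewrite fr3.
have nj1 : rg s2 rj1 \notin rg s rj0 :: us by rewrite -used1 ?q4 // ltnW.
have G' : search n G x (ar s3 aU) (ar s3 aV) (ar s aP) (ar s3 aMV) (ar s2 aWAY)
    (rg s rj0 :: us) (rg s2 rj1).
  apply: (grow xn S p0 (mv1 := ar s2 aMV) (way1 := ar s2 aWAY) _ _ fn pf q3 nj1 q5).
  - move=> j hj nj; rewrite -ht; apply: q2 => //; exact: used1'.
  - move=> j hj; have [] := q1 j; last by [].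
    by left; rewrite used1 // (search_le S).
  - by move=> j hj nj; apply: q6 => //; apply: used1'.
  - move=> y hy; rewrite w3 ?(ltnW hy) // R2 k3 U2 /=.
    by rewrite inE; case: (y =P (ar s aP (rg s rj0)).-1) => //= _; rewrite hur.
  - by move=> j hj; rewrite w1 // E2 used1 // V2.
  - move=> j hj nj; rewrite w2 ?(ltnW hj) // E2 used1 ?(ltnW hj) // (negbTE nj) //.
rewrite den_seq den_set; set s4 := setr s3 rj0 _.
have a4 : ar s4 = ar s3 by [].
have r4 : rg s4 rj0 = rg s2 rj1 by rewrite /s4 /= /update /= j13.
have d4 : rg s4 rdone = rg s rdone by rewrite /s4 /= /update /= fr3 // fr2 // fr1.
clearbody s4.
have guard : heval H s4 (EA aP (ER rj0)) = ar s aP (rg s2 rj1).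
  by rewrite /= /idx /= r4 a4 P3.
have T4 : tree_state x (rg s rj0 :: us) s4.
  split.
  - by rewrite a4 P3 W3 r4.
  - by move=> c hc; rewrite a4 fa3 // E2 used1.
  - move=> y hy; rewrite a4 P3 fa3 // R2 k3 /= inE.
    case: (y =P (ar s aP (rg s rj0)).-1) => //= _; exact: hur.
rewrite den_if guard; case: eqP => [e|/eqP ne] /=.
  by split; [exact: T4 | rewrite /= /update /= a4 P3 r4 e].
by rewrite a4 P3 r4 (negbTE ne).
Qed.

Lemma search_spec s x : hung_data s -> x < n -> tree_state x [::] s ->
  rg s rdone = 0 -> rg s rj0 = n -> let s' := den H p_search s in
  exists us, [/\ tree_state x us s', size us <= n &
    ar s' aP (rg s' rj0) = 0].
Proof.
move=> ds xn ts done0 j0n s'.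
have hN : rg s rN = n by case: ds.
pose I t s1 := hung_data s1 /\ exists us, [/\ tree_state x us s1, size us <= t &
  if rg s1 rdone == 0 then size us = t /\ 0 < ar s1 aP (rg s1 rj0)
  else ar s1 aP (rg s1 rj0) = 0].
have : I (rg s rN) s'.
  apply: for_ind => //.
    split; first by apply: hung_data_frame (frame_setr rt 0 s) ds.
    exists [::]; split=> //; rewrite /= /update /= done0 j0n; split=> //.
    by have [S _ _] := ts; rewrite (search_dummy S).
  move=> t s1 ht rtE frs [ds1 [us [ts1 sz hd]]].
  have ds' s2 v : hung_data s2 -> hung_data (setr s2 rt v).
    by apply: hung_data_frame (frame_setr rt v s2).
  have guardE : heval H s1 (ER rdone) = rg s1 rdone by [].
  have den0 : rg s1 rdone = 0 -> den H (CIf (ER rdone) CSkip p_grow) s1 = den H p_grow s1.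
    by move=> d0; rewrite den_if guardE d0.
  have den1 : rg s1 rdone != 0 -> den H (CIf (ER rdone) CSkip p_grow) s1 = s1.
    by move=> d0; rewrite den_if guardE d0.
  move: hd; case: (eqVneq (rg s1 rdone) 0) => [d0 [szt pj]|dn pj].
    rewrite (den0 d0).
    have g1 : (rg s1 rt == 0) = (us == [::]) by rewrite rtE -szt size_eq0.
    have [g2 g3] := grow_spec ds1 xn ts1 pj g1.
    have ds2 : hung_data (den H p_grow s1).
      by apply: hung_data_frame (den_frame H p_grow s1) ds1.
    move: (den H p_grow s1) g2 g3 ds2 => s2 g2 g3 ds2.
    split; first exact: ds'.
    exists (rg s1 rj0 :: us); split; [exact: g2 | by rewrite /= szt |].
    rewrite /= /update /= g3 d0; case: (posnP (ar s2 aP _)) => [->//|pp] /=.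
    by rewrite szt.
  rewrite (den1 dn); split; first exact: ds'.
  by exists us; split; [exact: ts1 | exact: leqW | rewrite /= /update /= (negbTE dn)].
rewrite hN => -[_ [us [ts' sz hd]]]; exists us; split=> //.
move: hd; case: eqP => // _ [szn pj].
have [S _ _] := ts'; have [f fn pf] := matched_free xn (search_matched S).
(* If the search were unfinished after [n] turns, the scanned columns, the current one and a free
   one would be [n + 2] distinct columns among [n + 1]. *)
have u : uniq (f :: rg s' rj0 :: us) by rewrite cons_uniq (free_notin S pj pf) (search_uniq S).
have sub : {subset f :: rg s' rj0 :: us <= iota 0 n.+1}.
  move=> c; rewrite inE mem_iota add0n ltnS => /orP[/eqP->|]; first exact: ltnW.
  exact: (search_le S).
by have := uniq_leq_size u sub; rewrite size_iota /= szn ltnn.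
Qed.

(** Each move shortens the list, so [n] turns bring the hole to the dummy column; the turns left
    over do nothing. *)
Lemma augment_spec s x us : hung_data s -> size us <= n ->
  hole n G x (ar s aU) (ar s aV) (ar s aP) (ar s aWAY) us (rg s rj0) ->
  let s' := den H p_augment s in matched n G x.+1 (ar s aU) (ar s aV) (ar s' aP).
Proof.
move=> ds sz h s'; have hN : rg s rN = n by case: ds.
pose I t s1 := exists us, size us <= n - t /\
  hole n G x (ar s aU) (ar s aV) (ar s1 aP) (ar s aWAY) us (rg s1 rj0).
suff : I (rg s rN) s'.
  rewrite hN => -[us']; rewrite subnn leqn0 size_eq0 => -[/eqP-> h'].
  exact: hole_end (hole_nil h') h'.
apply: for_ind => //; first by exists us; rewrite subn0.
move=> t s1 ht rtE [fr fa] [us1 [sz1 h1]].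
have N1 : rg s1 rN = n by rewrite fr.
have W1 : ar s1 aWAY = ar s aWAY by rewrite fa.
rewrite den_if heval_neqe /= N1; case: eqP => [e|/eqP ne] /=.
  exists [::]; rewrite /= /update /=; split=> //.
  by move: h1; rewrite e => h1; rewrite -(hole_dummy h1).
have [|us2 sz2 h2] := hole_move (p' := fun j =>
   if j == rg s1 rj0 then ar s1 aP (ar s aWAY (rg s1 rj0)) else ar s1 aP j) ne h1.
  by [].
exists us2; split; first by lia.
by rewrite /= /update /idx /= W1.
Qed.

Lemma reset_spec s : hung_data s -> let s' := den H p_reset s in
  forall j, j <= n -> ar s' aUSED j = 0 /\ ar s' aUR j = 0.
Proof.
move=> [_ hN1 _] s' j hj; split.
  rewrite (for_map (g := fun=> 0)) // ?hN1 ?ltnS ?hj //.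
  by move=> i s1 hi ri _ IH l; rewrite den_seq !den_put /= ri /idx /=; case: eqP.
rewrite (for_map (g := fun=> 0)) // ?hN1 ?ltnS ?hj //.
by move=> i s1 hi ri _ IH l; rewrite den_seq !den_put /= ri /idx /=; case: eqP.
Qed.

Lemma eq_matched m u v p p' : (forall j, j < n -> p j = p' j) ->
  matched n G m u v p -> matched n G m u v p'.
Proof.
move=> e [m1 m2 m3 m4 m5]; split=> //.
- by move=> j hj; rewrite -e // /tight -e //; apply: m2.
- by move=> i j hi hj; rewrite -!e //; apply: m3.
- by move=> x hx; have [j hj ej] := m4 x hx; exists j; rewrite // -e.
- by move=> j hj; rewrite -e //; apply: m5.
Qed.

Lemma insert_spec s : hung_data s -> rg s rx < n ->
  matched n G (rg s rx) (ar s aU) (ar s aV) (ar s aP) ->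
  let s' := den H p_insert s in
  matched n G (rg s rx).+1 (ar s' aU) (ar s' aV) (ar s' aP).
Proof.
move=> ds xn hm s'; have hN : rg s rN = n by case: ds.
rewrite /s' /p_insert 5!den_seq !den_set den_put.
set s1 := setr _ rdone _.
have ds1 : hung_data s1.
  apply: (hung_data_frame (rs := [:: rj0; rdone]) (as_ := [:: aP])) ds => //.
  split=> [r|a]; rewrite !inE ?negb_or /s1 /= /update.
    by case/andP=> /negbTE-> /negbTE->.
  by move/negbTE->.
have P1 j : ar s1 aP j = if j == n then (rg s rx).+1 else ar s aP j.
  by rewrite /s1 /= /idx /= hN addn1.
have U1 : ar s1 aU = ar s aU by [].
have V1 : ar s1 aV = ar s aV by [].
have j01 : rg s1 rj0 = n by rewrite /s1 /= /update /= hN.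
have d1 : rg s1 rdone = 0 by rewrite /s1 /= /update /=.
have x1 : rg s1 rx = rg s rx by [].
clearbody s1.
have frs2 := den_frame H p_reset s1; have [fr2 fa2] := frs2.
have rs2 := reset_spec ds1.
set s2 := den H p_reset s1 in frs2 fr2 fa2 rs2 *.
have ds2 : hung_data s2 by apply: hung_data_frame frs2 ds1.
have P2 : ar s2 aP = ar s1 aP by rewrite fa2.
have ts2 : tree_state (rg s rx) [::] s2.
  split.
  - have -> : rg s2 rj0 = n by rewrite fr2.
    have -> : ar s2 aU = ar s aU by rewrite fa2.
    have -> : ar s2 aV = ar s aV by rewrite fa2.
    rewrite P2; split=> //.
    + by apply: eq_matched hm => j hj; rewrite P1 ltn_eqF.
    + by rewrite P1 eqxx.
    + by move=> c; rewrite inE => /eqP->.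
    + by rewrite /= eqxx.
  - by move=> c hc; have [-> _] := rs2 _ hc.
  - by move=> y hy; have [_ ->] := rs2 _ (ltnW hy).
have d2 : rg s2 rdone = 0 by rewrite fr2.
have j02 : rg s2 rj0 = n by rewrite fr2.
have [us [[S3 _ _] sz3 p3]] := search_spec ds2 xn ts2 d2 j02.
have frs3 := den_frame H p_search s2.
set s3 := den H p_search s2 in frs3 S3 p3 *.
have ds3 : hung_data s3 by apply: hung_data_frame frs3 ds2.
have jn : rg s3 rj0 < n.
  rewrite ltn_neqAle (search_le S3) ?mem_head // andbT; apply/eqP => e.
  by have := search_dummy S3; rewrite -e p3.
have h3 := hole_start jn p3 S3.
have := augment_spec ds3 sz3 h3.
have [_ fa4] := den_frame H p_augment s3.
by rewrite (fa4 aU) // (fa4 aV).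
Qed.

Lemma hungarian_spec s : hung_data s ->
  (forall j, ar s aV j = 0) -> (forall j, ar s aP j = 0) ->
  (forall x j, x < n -> j < n -> G x j <= rg s rS + rg s rS) ->
  let s' := den H p_hungarian s in
  inj_below n (ar s' aSG) /\
  forall f, inj_below n f ->
    \sum_(0 <= x < n) G x (f x) <= \sum_(0 <= x < n) G x (ar s' aSG x).
Proof.
move=> ds v0 p0 hG s'; have hN : rg s rN = n by case: ds.
rewrite /s' /p_hungarian 2!den_seq; set c0 := CFor rj rN (CPut aU _ _).
have frs1 := den_frame H c0 s; have [fr1 fa1] := frs1.
have U1 j : j < n -> ar (den H c0 s) aU j = rg s rS + rg s rS.
  move=> hj; rewrite (for_put (g := fun=> rg s rS + rg s rS)) // ?hN ?hj //.
  by move=> i s1 hi ri [fr _] _ /=; rewrite fr.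
set s1 := den H c0 s in frs1 fr1 fa1 U1 *.
have ds1 : hung_data s1 by apply: hung_data_frame frs1 ds.
pose I m s2 := hung_data s2 /\ matched n G m (ar s2 aU) (ar s2 aV) (ar s2 aP).
have : I (rg s1 rN) (den H (CFor rx rN p_insert) s1).
  apply: for_ind => //.
    split; first by apply: hung_data_frame (frame_setr rx 0 s1) ds1.
    have P1 j : ar s1 aP j = 0 by rewrite fa1.
    have V1 j : ar s1 aV j = 0 by rewrite fa1.
    split=> //= [x j hx hj|j hj|i j hi hj]; rewrite ?P1 //.
    by rewrite U1 // V1 addn0 hG.
  move=> m s2 hm2 rxE frs [ds2 m2].
  have xn : rg s2 rx < n by rewrite rxE; case: ds1 hm2 => ->.
  rewrite -rxE in m2.
  have := insert_spec ds2 xn m2; rewrite rxE => m3; split=> //.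
  have ds3 : hung_data (den H p_insert s2).
    by apply: hung_data_frame (den_frame H p_insert s2) ds2.
  exact: hung_data_frame (frame_setr rx m.+1 (den H p_insert s2)) ds3.
have -> : rg s1 rN = n by case: ds1.
set s2 := den H (CFor rx rN p_insert) s1 => -[ds2 m2].
set s3 := den H _ s2.
apply: (matched_optimal m2) => j hj pj.
have [t1 t2 t3 t4 t5] := m2.
pose K m s4 := forall i, i < m -> ar s4 aSG (ar s2 aP i).-1 = i.
have hN2 : rg s2 rN = n by case: ds2.
suff : K (rg s2 rN) s3 by apply; rewrite hN2.
apply: for_ind => // m s4; rewrite hN2 => hm rjE [fr fa] IH i hi.
have P4 : ar s4 aP = ar s2 aP by rewrite fa.
rewrite den_put /= /idx /= rjE P4 subn1.
have pos l : l < n -> 0 < ar s2 aP l.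
  exact: matched_full m2.
have hin : i < n by lia.
(* Two columns that write to the same entry hold the same row, hence are equal. *)
case: eqP => [e|ne].
  apply: t3 => //; first exact: pos.
  by have := pos _ hin; have := pos _ hm; lia.
by apply: IH; move: hi; rewrite ltnS leq_eqVlt => /orP[/eqP e|//]; rewrite e in ne.
Qed.

End HungarianProgram.

(** * Listing the cycles of a permutation *)

Section Listing.

Variables (n : nat) (sg : nat -> nat).
Hypothesis sgP : inj_below n sg.

(* The first [c] positions of [a] list a set of whole cycles of [sg], except
   that the block starting at [s] may be incomplete. *)
Record listing (s c : nat) (a bl seen : nat -> nat) : Prop := Listing {
  listing_lt : forall i, i < c -> a i < n;
  listing_inj : forall i j, i < c -> j < c -> a i = a j -> i = j;
  listing_seen : forall y, y < n -> reflect (exists2 i, i < c & a i = y) (seen y != 0);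
  listing_succ : forall i, i < c ->
    bl i = i \/ [/\ 0 < i, bl i = bl i.-1 & a i = sg (a i.-1)];
  listing_closed : forall i, i < s ->
    exists j, [/\ j < s, bl j = bl i & a j = sg (a i)]
}.

Record walking (x s c : nat) (a bl : nat -> nat) : Prop := Walking {
  walking_le : s <= c;
  walking_bl : forall i, s <= i < c -> bl i = s;
  walking_iter : forall i, s <= i < c -> a i = iter (i - s) sg x
}.

Lemma listing_le s c a bl seen : listing s c a bl seen -> c <= n.
Proof.
move=> [h1 h2 _ _ _].
have u : uniq (map a (iota 0 c)).
  rewrite map_inj_in_uniq ?iota_uniq // => i j; rewrite !mem_iota => /andP[_ hi] /andP[_ hj].
  exact: h2.
have sub : {subset map a (iota 0 c) <= iota 0 n}.
  by move=> y /mapP[i]; rewrite !mem_iota => /andP[_ /h1 h] ->.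
by have := uniq_leq_size u sub; rewrite size_map !size_iota.
Qed.

Lemma listing_append x s c a bl seen a' bl' seen' : x < n ->
  let y := iter (c - s) sg x in
  listing s c a bl seen -> walking x s c a bl -> seen y = 0 ->
  (forall i, a' i = if i == c then y else a i) ->
  (forall i, bl' i = if i == c then s else bl i) ->
  (forall z, seen' z = if z == y then 1 else seen z) ->
  listing s c.+1 a' bl' seen' /\ walking x s c.+1 a' bl'.
Proof.
move=> xn y L W sy aE blE seenE.
have yn : y < n by have [h _] := inj_below_iter (c - s) sgP; apply: h.
have [h1 h2 h3 h4 h5] := L; have [w1 w2 w3] := W.
have ny i : i < c -> a i <> y.
  by move=> hi e; have /(h3 _ yn) : (exists2 i, i < c & a i = y); [exists i | rewrite sy].
have old i : i < c -> a' i = a i /\ bl' i = bl i by move=> hi; rewrite aE blE ltn_eqF.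
split; split.
- by move=> i hi; rewrite aE; case: eqP => // ne; apply: h1; lia.
- move=> i j hi hj; rewrite !aE; case: (i =P c) => [->|ni]; case: (j =P c) => [->//|nj].
  + by move=> e; case: (@ny j) => //; lia.
  + by move=> e; case: (@ny i) => //; lia.
  + by apply: h2; lia.
- move=> z hz; rewrite seenE; case: (z =P y) => [->|nz].
    by left; exists c; rewrite // aE eqxx.
  apply: (iffP (h3 _ hz)) => -[i hi e].
    by exists i; [exact: ltnW | have [-> _] := old _ hi].
  move: hi; rewrite ltnS leq_eqVlt => /orP[/eqP ic|hi].
    by case: nz; rewrite -e ic aE eqxx.
  by exists i => //; have [<- _] := old _ hi.
- move=> i; rewrite ltnS leq_eqVlt => /orP[/eqP->|hi].
    have [sc|sc] := leqP c s; first by left; rewrite blE eqxx; lia.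
    right; have hc : c.-1 < c by lia.
    have [-> ->] := old _ hc; rewrite aE blE eqxx w2; last by lia.
    split=> //; first by lia.
    by rewrite w3 ?/y; [rewrite -iterS; congr iter; lia | lia].
  have [-> ->] := old _ hi; have [->|[i0 e1 e2]] := h4 _ hi; first by left.
  have hi1 : i.-1 < c by lia.
  by right; have [-> ->] := old _ hi1.
- move=> i hi; have [j [hj e1 e2]] := h5 _ hi; exists j.
  have [-> ->] := old i (leq_trans hi w1).
  by have [-> ->] := old j (leq_trans hj w1).
- exact: leqW.
- move=> i hi; rewrite blE; case: eqP => // ne; apply: w2; lia.
- move=> i hi; rewrite aE; case: eqP => [->//|ne]; apply: w3; lia.
Qed.

Lemma listing_close x s c a bl seen : x < n ->
  listing s c a bl seen -> walking x s c a bl ->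
  c = s + n \/ seen (iter (c - s) sg x) != 0 ->
  listing c c a bl seen /\ exists2 i, i < c & a i = x.
Proof.
move=> xn L W hend; have [h1 h2 h3 h4 h5] := L; have [w1 w2 w3] := W.
set y := iter (c - s) sg x in hend.
have itn q z : z < n -> iter q sg z < n by have [h _] := inj_below_iter q sgP; apply: h.
(* If all [n] turns appended a vertex, every vertex is listed, so [y] is listed in either case. *)
have [i ic ei] : exists2 i, i < c & a i = y.
  case: hend => [e|/(h3 _ (itn _ _ xn))//].
  have cn : c = n by have := listing_le L; lia.
  apply: (inj_below_onto (n := c)); last by rewrite cn itn.
  by split=> // j; rewrite {2}cn; apply: h1.
(* Nothing was appended: [x] itself had been seen before. *)
have [sc|sc] := eqVneq c s.
  by split; [rewrite {1}sc; split=> // | exists i => //; rewrite ei /y sc subnn].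
have as_ : a s = x by rewrite w3 ?subnn //; lia.
split; last by exists s => //; lia.
have hc1 : c.-1 < c by lia.
have yE : y = sg (a c.-1).
  by rewrite w3 /y; [rewrite -iterS; congr iter; lia | lia].
(* The finished cycles are closed under [sg], hence also under its inverse. *)
have si : s <= i.
  rewrite leqNgt; apply/negP => hi.
  have back q : exists2 j, j < s & a j = iter q sg (a i).
    elim: q => [|q [j hj ej]]; first by exists i.
    by have [j' [hj' _ ej']] := h5 _ hj; exists j'; rewrite // ej' ej.
  have [j hj ej] := back n`!.-1.
  have : a j = a c.-1.
    by rewrite ej ei yE -iterSr prednK ?fact_gt0 // (inj_below_fact sgP) // h1.
  have jc : j < c by lia.
  by move=> e; have := h2 _ _ jc hc1 e; lia.
(* Inside the current block [y] can only be its first vertex: otherwise the predecessor of position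
   [i] and the last vertex would have the same image. *)
have {si}is_ : i = s.
  apply/eqP; rewrite eqn_leq si andbT leqNgt; apply/negP => hi.
  have e : sg (a i.-1) = sg (a c.-1).
    rewrite -yE -ei (w3 i.-1) ?(w3 i) -?iterS; try lia.
    by have -> : (i.-1 - s).+1 = i - s by lia.
  have ic1 : i.-1 < c by lia.
  have [_ sinj] := sgP; move: (sinj _ _ (h1 _ ic1) (h1 _ hc1) e).
  by move=> e'; have := h2 _ _ ic1 hc1 e'; lia.
split=> // j hj; have [js|js] := ltnP j s.
  by have [j' [hj' e1 e2]] := h5 _ js; exists j'; split=> //; lia.
have [jc|jc] := eqVneq j c.-1.
  exists s; split; first by lia.
    by rewrite !w2 //; lia.
  by rewrite jc -yE -ei is_.
exists j.+1; split; first by lia.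
  by rewrite !w2 //; lia.
rewrite (w3 j) ?(w3 j.+1) -?iterS; try lia.
by have -> : j.+1 - s = (j - s).+1 by lia.
Qed.

End Listing.

Notation aSEEN := 11 (only parsing).
Notation ry := 30 (only parsing).
Notation rs0 := 31 (only parsing).
Notation rcnt := 32 (only parsing).

Definition p_visit : hcmd :=
  CIf (EA aSEEN (ER ry)) CSkip
  (CSeq (CPut aSEEN (ER ry) (EC 1))
  (CSeq (CPut aAA (ER rcnt) (ER ry))
  (CSeq (CPut aBL (ER rcnt) (ER rs0))
  (CSeq (CSet rcnt (EAdd (ER rcnt) (EC 1)))
        (CSet ry (EA aSG (ER ry))))))).

Definition p_walk : hcmd :=
  CSeq (CSet ry (ER rx)) (CSeq (CSet rs0 (ER rcnt)) (CFor rt rN p_visit)).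

Definition p_cycles : hcmd := CSeq (CSet rcnt (EC 0)) (CFor rx rN p_walk).

Section ListingProgram.

Variables (H n : nat) (sg : nat -> nat).
Hypothesis sgP : inj_below n sg.

Lemma walk_spec s : rg s rN = n -> (forall y, y < n -> ar s aSG y = sg y) ->
  rg s rx < n ->
  listing n sg (rg s rcnt) (rg s rcnt) (ar s aAA) (ar s aBL) (ar s aSEEN) ->
  let s' := den H p_walk s in
  [/\ listing n sg (rg s' rcnt) (rg s' rcnt) (ar s' aAA) (ar s' aBL) (ar s' aSEEN),
      exists2 i, i < rg s' rcnt & ar s' aAA i = rg s rx
    & forall i, i < rg s rcnt -> ar s' aAA i = ar s aAA i /\ rg s rcnt <= rg s' rcnt].
Proof.
move=> hN hsg xn L s'; set c := rg s rcnt in L *; set x := rg s rx in xn *.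
rewrite /s' /p_walk 2!den_seq !den_set; set s1 := setr _ rs0 _.
have [y1 s01 c1 N1] : [/\ rg s1 ry = x, rg s1 rs0 = c, rg s1 rcnt = c & rg s1 rN = n].
  by rewrite /s1 /= /update /=.
have a1 : ar s1 = ar s by [].
clearbody s1.
pose I t s2 := [/\ listing n sg c (rg s2 rcnt) (ar s2 aAA) (ar s2 aBL) (ar s2 aSEEN),
   walking sg x c (rg s2 rcnt) (ar s2 aAA) (ar s2 aBL),
   rg s2 ry = iter (rg s2 rcnt - c) sg x,
   rg s2 rcnt = c + t \/ ar s2 aSEEN (rg s2 ry) != 0
  & forall i, i < c -> ar s2 aAA i = ar s aAA i].
have : I (rg s1 rN) (den H (CFor rt rN p_visit) s1).
  apply: for_ind => //.
    split; rewrite /= /update /= ?a1 ?c1 ?subnn ?addn0 //; last by left.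
    split; first exact: leqnn.
      by move=> i; lia.
    by move=> i; lia.
  move=> t s2 ht rtE [fr fa] [i1 i2 i3 i4 i5].
  rewrite /p_visit den_if.
  have -> : heval H s2 (EA aSEEN (ER ry)) = ar s2 aSEEN (rg s2 ry) by [].
  case: (boolP (ar s2 aSEEN (rg s2 ry) != 0)) => sy.
    by split=> //=; right.
  have sy0 : ar s2 aSEEN (rg s2 ry) = 0 by apply/eqP; rewrite negbK in sy.
  have cE : rg s2 rcnt = c + t by case: i4 => //; rewrite sy0.
  rewrite i3 in sy0.
  have s02 : rg s2 rs0 = c by rewrite fr.
  have SG2 : ar s2 aSG = ar s aSG by rewrite fa // a1.
  have yn : iter (rg s2 rcnt - c) sg x < n.
    by have [h _] := inj_below_iter (rg s2 rcnt - c) sgP; apply: h.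
  have [//|//|//|L' W'] := listing_append sgP xn i1 i2 sy0
    (a' := fun i => if i == rg s2 rcnt then iter (rg s2 rcnt - c) sg x else ar s2 aAA i)
    (bl' := fun i => if i == rg s2 rcnt then c else ar s2 aBL i)
    (seen' := fun z => if z == iter (rg s2 rcnt - c) sg x then 1 else ar s2 aSEEN z).
  have c2 : c <= rg s2 rcnt by rewrite cE leq_addr.
  rewrite !denE /I /= /update /idx /= i3 s02 addn1 SG2; split=> //.
  + by rewrite subSn //= hsg.
  + by left; rewrite cE addnS.
  + by move=> i hi; rewrite ltn_eqF ?i5 //; lia.
rewrite N1; set s2 := den _ _ _ => -[i1 i2 i3 i4 i5].
rewrite i3 in i4; have [L' ex] := listing_close sgP xn i1 i2 i4.
split=> // i hi; split; first exact: i5.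
exact: walking_le i2.
Qed.

Lemma cycles_spec s : rg s rN = n -> (forall y, y < n -> ar s aSG y = sg y) ->
  (forall y, ar s aSEEN y = 0) ->
  let s' := den H p_cycles s in let a := ar s' aAA in let bl := ar s' aBL in
  [/\ inj_below n a,
      forall i, i < n -> bl i = i \/ [/\ 0 < i, bl i = bl i.-1 & a i = sg (a i.-1)]
    & forall i, i < n -> exists j, [/\ j < n, bl j = bl i & a j = sg (a i)]].
Proof.
move=> hN hsg seen0 s'.
rewrite /s' /p_cycles den_seq den_set; set s1 := setr s rcnt _.
pose I m s2 :=
  listing n sg (rg s2 rcnt) (rg s2 rcnt) (ar s2 aAA) (ar s2 aBL) (ar s2 aSEEN) /\
  (forall y, y < m -> exists2 i, i < rg s2 rcnt & ar s2 aAA i = y).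
have N1 : rg s1 rN = n by [].
have : I (rg s1 rN) (den H (CFor rx rN p_walk) s1).
  apply: for_ind => //.
    split=> //; split=> //= y hy; rewrite seen0 eqxx.
    by right => -[].
  move=> m s2 hm rxE [fr fa] [i1 i2].
  have N2 : rg s2 rN = n by rewrite fr.
  have SG2 y : y < n -> ar s2 aSG y = sg y by move=> hy; rewrite fa // hsg.
  have x2 : rg s2 rx < n by rewrite rxE -N1.
  have [L' ex keep] := walk_spec N2 SG2 x2 i1.
  split; first exact: L'.
  move=> y; rewrite ltnS leq_eqVlt => /orP[/eqP->|/i2[i hi <-]].
    by rewrite -rxE; exact: ex.
  have [e le] := keep _ hi; exists i; last exact: e.
  exact: leq_trans hi le.
rewrite N1; set s2 := den _ _ _ => -[L cov].
have cn : rg s2 rcnt = n.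
  apply/eqP; rewrite eqn_leq (listing_le L) /=.
  have sub : {subset iota 0 n <= map (ar s2 aAA) (iota 0 (rg s2 rcnt))}.
    move=> y; rewrite mem_iota => /andP[_ /cov[i hi <-]].
    by apply: map_f; rewrite mem_iota.
  by have := uniq_leq_size (iota_uniq 0 n) sub; rewrite size_map !size_iota.
rewrite cn in L; have [h1 h2 h3 h4 h5] := L.
by split.
Qed.

End ListingProgram.

Notation rd := 33 (only parsing).

(* [rd] counts the positions left in the current segment. *)
Definition p_next : hcmd :=
  CSeq (CSet rd (ER rK)) (CFor ri rN
   (CSeq (CSet rd (ESub (ER rd) (EC 1)))
   (CIf (ER rd) (CPut aNX (ER ri) (EAdd (ER ri) (EC 1)))
      (CSeq (CPut aNX (ER ri) (ESub (EAdd (ER ri) (EC 1)) (ER rK))) (CSet rd (ER rK)))))).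

Lemma next_spec H s n k : rg s rN = n -> rg s rK = k -> 0 < k ->
  forall i, i < n -> ar (den H p_next s) aNX i = nx k i.
Proof.
move=> hN hK k0; rewrite /p_next den_seq den_set; set s1 := setr s rd _.
have [N1 K1 d1] : [/\ rg s1 rN = n, rg s1 rK = k & rg s1 rd = k].
  by rewrite /s1 /= /update /=.
clearbody s1.
pose I m s2 := rg s2 rd = k - m %% k /\ forall i, i < m -> ar s2 aNX i = nx k i.
suff : I (rg s1 rN) (den H (CFor ri rN (CSeq (CSet rd (ESub (ER rd) (EC 1)))
   (CIf (ER rd) (CPut aNX (ER ri) (EAdd (ER ri) (EC 1)))
      (CSeq (CPut aNX (ER ri) (ESub (EAdd (ER ri) (EC 1)) (ER rK))) (CSet rd (ER rK)))))) s1).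
  by rewrite N1 => -[].
apply: for_ind => //; first by split; rewrite //= /update /= mod0n subn0.
move=> m s2 hm riE [fr fa] [i1 i2].
have K2 : rg s2 rK = k by rewrite fr.
rewrite den_seq den_set; set s3 := setr s2 rd _.
have [d3 r3 K3 a3] : [/\ rg s3 rd = (k - m %% k).-1, rg s3 ri = m, rg s3 rK = k & ar s3 = ar s2].
  by rewrite /s3 /= /update /= i1 subn1.
clearbody s3; rewrite den_if.
have -> : heval H s3 (ER rd) = (k - m %% k).-1 by [].
have mk := ltn_pmod m k0.
have dvd : (k %| m.+1) = ((k - m %% k).-1 == 0).
  rewrite {1}(divn_eq m k) -addnS dvdn_addr ?dvdn_mull //.
  apply/idP/eqP => [/dvdn_leq h|h]; first by have := h isT; lia.
  by have -> : (m %% k).+1 = k by lia.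
case: (eqVneq (k - m %% k).-1 0) dvd => hc dvd /=.
  rewrite /I /= /update /idx /= r3 K3 a3; split.
    by move/eqP: dvd => ->; rewrite subn0.
  move=> i; rewrite ltnS leq_eqVlt => /orP[/eqP->|hi].
    by rewrite eqxx /nx (idP dvd) addn1.
  by rewrite ltn_eqF ?i2.
rewrite /I /= /update /idx /= r3 d3 a3; split.
  have -> : m.+1 %% k = (m %% k).+1; last by lia.
  by rewrite -addn1 -modnDml addn1 modn_small; lia.
move=> i; rewrite ltnS leq_eqVlt => /orP[/eqP->|hi].
  by rewrite eqxx /nx dvd addn1.
by rewrite ltn_eqF ?i2.
Qed.

(** * Integer weights *)

Notation rps := 40 (only parsing).
Notation re := 41 (only parsing).
Notation rv := 42 (only parsing).
Notation rf2 := 43 (only parsing).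
Notation rb2 := 44 (only parsing).
Notation racc := 45 (only parsing).
Notation rt2 := 46 (only parsing).
Notation rrow := 47 (only parsing).

(** The input starts with [n], so the matrix entry [e] occupies the positions [2 * e + 1] and
    [2 * e + 2]. *)
Definition num_at (e : hexpr) : hexpr := EA 0 (EAdd (EAdd e e) (EC 1)).

Definition den_at (e : hexpr) : hexpr := EA 0 (EAdd (EAdd e e) (EC 2)).

(** The sum bounds every denominator, so its length is enough for all the multiplications. *)
Definition p_sumden : hcmd :=
  CSeq (CSet rps (EC 0)) (CFor re rN2 (CSet rps (EAdd (ER rps) (den_at (ER re))))).

(** Binary multiplication by doubling [rv] and halving [rb2]; the guard is the lowest bit of [rb2].
    Throughout, [racc + rv * rb2] is the product. *)
Definition p_mul : hcmd :=
  CSeq (CSet racc (EC 0))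
  (CFor rt2 rL
    (CSeq (CIf (ESub (ER rb2) (EAdd (EHalf (ER rb2)) (EHalf (ER rb2))))
             (CSet racc (EAdd (ER racc) (ER rv))) CSkip)
    (CSeq (CSet rv (EAdd (ER rv) (ER rv))) (CSet rb2 (EHalf (ER rb2)))))).

Definition p_entry : hcmd :=
  CSeq (CSet rv (num_at (ER re)))
  (CFor rf2 rN2 (CIf (neqe (ER re) (ER rf2))
     (CSeq (CSet rb2 (den_at (ER rf2))) (CSeq p_mul (CSet rv (ER racc)))) CSkip)).

(** [rS] ends as one more than the sum of all entries, hence exceeds the weight of any
    permutation. *)
Definition p_scale : hcmd :=
  CSeq (CSet rS (EC 1))
  (CFor re rN2 (CSeq p_entry (CSeq (CPut aA (ER re) (ER rv))
     (CSet rS (EAdd (ER rS) (ER rv)))))).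

(** Row offsets by repeated addition, so that matrix accesses need no product. *)
Definition p_rows : hcmd :=
  CSeq (CSet rrow (EC 0))
  (CFor re rN (CSeq (CPut aROW (ER re) (ER rrow)) (CSet rrow (EAdd (ER rrow) (ER rN))))).

(* The large constant added off the diagonal makes every maximum weight
   permutation free of fixed points. *)
Definition p_weights : hcmd :=
  CFor re rN (CFor rf2 rN (CIf (neqe (ER re) (ER rf2))
    (CPut aG (EAdd (EA aROW (ER re)) (ER rf2))
       (EAdd (ER rS) (EA aA (EAdd (EA aROW (ER re)) (ER rf2)))))
    (CPut aG (EAdd (EA aROW (ER re)) (ER rf2)) (EC 0)))).

Lemma mul_spec H s : rg s rb2 < 2 ^ rg s rL ->
  rg (den H p_mul s) racc = rg s rv * rg s rb2.
Proof.
move=> hb; rewrite /p_mul den_seq den_set; set s1 := setr s racc _.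
pose I t s2 := rg s2 racc + rg s2 rv * rg s2 rb2 = rg s rv * rg s rb2 /\
  rg s2 rb2 < 2 ^ (rg s rL - t).
have L1 : rg s1 rL = rg s rL by [].
set c := CFor _ _ _.
suff : I (rg s1 rL) (den H c s1).
  rewrite L1 => -[]; rewrite subnn expn0 ltnS leqn0 => + /eqP b0.
  by rewrite b0 muln0 addn0.
apply: for_ind => //; first by rewrite /I /= /update /= subn0.
move=> t s2 ht _ _ [i1 i2].
have b2 := odd_double_half (rg s2 rb2).
have pow : 2 ^ (rg s rL - t) = 2 * 2 ^ (rg s rL - t.+1).
  by rewrite -expnS; congr (2 ^ _); move: ht; rewrite L1; lia.
rewrite pow in i2.
rewrite !denE /I.
have -> : (heval H s2 (ESub (ER rb2) (EAdd (EHalf (ER rb2)) (EHalf (ER rb2)))) != 0)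
   = odd (rg s2 rb2).
  by rewrite /= -{1}b2 -addnn addnK; case: (odd _).
case: (odd (rg s2 rb2)) b2 => b2 /=; rewrite /update /=; split; lia.
Qed.

Section Scale.

Variables (H N : nat) (num dn : nat -> nat).

(** The fraction [num e / dn e] times the product of all the denominators, a factor common to all
    entries. *)
Definition scaled (e : nat) : nat := num e * \prod_(0 <= f < N | f != e) dn f.

Definition scale_data (s : hstate) : Prop :=
  [/\ rg s rN2 = N,
      forall e, e < N -> heval H s (num_at (EC e)) = num e,
      forall e, e < N -> heval H s (den_at (EC e)) = dn e
    & forall e, e < N -> dn e < 2 ^ rg s rL].

Lemma scale_data_frame rs as_ s s' :
  all (fun r => r \notin rs) [:: rN2; rL] -> 0 \notin as_ ->
  frame rs as_ s s' -> scale_data s -> scale_data s'.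
Proof.
move=> /and3P[r1 r2 _] a0 [fr fa] [h1 h2 h3 h4]; split.
- by rewrite fr.
- by move=> e he; rewrite /= fa // -h2.
- by move=> e he; rewrite /= fa // -h3.
- by move=> e he; rewrite fr // h4.
Qed.

Lemma heval_num s e : heval H s (num_at (ER e)) = heval H s (num_at (EC (rg s e))).
Proof. by []. Qed.

Lemma heval_den s e : heval H s (den_at (ER e)) = heval H s (den_at (EC (rg s e))).
Proof. by []. Qed.

Lemma entry_spec s : scale_data s -> rg s re < N ->
  rg (den H p_entry s) rv = scaled (rg s re).
Proof.
move=> ds he; rewrite /p_entry den_seq den_set; set s1 := setr s rv _.
have ds1 : scale_data s1 by apply: scale_data_frame (frame_setr _ _ _) ds.
have v1 : rg s1 rv = num (rg s re).
  by rewrite /s1 heval_num; case: ds => _ -> //.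
have e1 : rg s1 re = rg s re by [].
clearbody s1.
pose I m s2 := rg s2 rv = num (rg s re) * \prod_(0 <= f < m | f != rg s re) dn f.
rewrite /scaled; set c := CFor _ _ _.
suff : I (rg s1 rN2) (den H c s1) by case: ds1 => ->.
apply: for_ind => //; first by rewrite /I /= /update /= big_geq ?muln1.
move=> m s2 hm fE frs IH; have [fr fa] := frs.
have ds2 : scale_data s2 by apply: scale_data_frame frs ds1.
have mN : m < N by case: ds1 hm => ->.
have prodS : \prod_(0 <= f < m.+1 | f != rg s re) dn f =
    \prod_(0 <= f < m | f != rg s re) dn f * (if m != rg s re then dn m else 1).
  by rewrite big_mkcond big_nat_recr //= -big_mkcond.
rewrite /I prodS mulnA -IH.
rewrite den_if heval_neqe.
have -> : (heval H s2 (ER re) != heval H s2 (ER rf2)) = (m != rg s re).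
  by rewrite /= fr // e1 fE eq_sym.
case: (m != rg s re); last by rewrite muln1 den_skip.
rewrite den_seq den_set; set s3 := setr s2 rb2 _.
have b3 : rg s3 rb2 = dn m.
  rewrite -[LHS]/(heval H s2 (den_at (ER rf2))) heval_den fE.
  by case: ds2 => _ _ h _; rewrite h.
have v3 : rg s3 rv = rg s2 rv by [].
have L3 : rg s3 rL = rg s2 rL by [].
have hb : rg s3 rb2 < 2 ^ rg s3 rL by rewrite b3 L3; case: ds2 => _ _ _; apply.
by rewrite den_seq den_set -v3 -b3 -(mul_spec H hb).
Qed.

Lemma scale_spec s : scale_data s ->
  let s' := den H p_scale s in
  (forall e, e < N -> ar s' aA e = scaled e) /\
  rg s' rS = 1 + \sum_(0 <= e < N) scaled e.
Proof.
move=> ds; rewrite /p_scale den_seq den_set; set s1 := setr s rS _.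
have ds1 : scale_data s1 by apply: scale_data_frame (frame_setr _ _ _) ds.
set c := CFor _ _ _.
pose I m s2 := (forall e, e < m -> ar s2 aA e = scaled e) /\
  rg s2 rS = 1 + \sum_(0 <= e < m) scaled e.
suff : I (rg s1 rN2) (den H c s1) by case: ds1 => ->.
apply: for_ind => //; first by split; rewrite // big_geq.
move=> m s2 hm eE frs [i1 i2].
have ds2 : scale_data s2 by apply: scale_data_frame frs ds1.
have mN : rg s2 re < N by rewrite eE; case: ds1 hm => ->.
have v3 := entry_spec ds2 mN; rewrite eE in v3.
have [fr3 fa3] := den_frame H p_entry s2.
rewrite den_seq; move: (den H p_entry s2) v3 fr3 fa3 => s3 v3 fr3 fa3.
have e3 : rg s3 re = m by rewrite fr3.
rewrite !denE /I /= /update /idx /= e3 v3; split.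
  move=> e; rewrite ltnS leq_eqVlt => /orP[/eqP->|h]; first by rewrite eqxx.
  by rewrite ltn_eqF // fa3 // i1.
by rewrite fr3 // i2 big_nat_recr //= addnA.
Qed.

End Scale.

Lemma sumden_spec H s : rg (den H p_sumden s) rps =
  \sum_(0 <= e < rg s rN2) heval H s (den_at (EC e)).
Proof.
rewrite /p_sumden den_seq den_set.
rewrite (for_sum (F := fun e => heval H s (den_at (EC e)))) // => i s2 hi eE [_ fa] _.
have a0 : ar s2 0 = ar s 0 by rewrite fa.
by rewrite den_set /= /update /= eE a0.
Qed.

Lemma rows_spec H s n : rg s rN = n ->
  forall i, i < n -> ar (den H p_rows s) aROW i = i * n.
Proof.
move=> hN; rewrite /p_rows den_seq den_set; set s1 := setr s rrow _.
have N1 : rg s1 rN = n by [].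
set c := CFor _ _ _.
pose I m s2 := rg s2 rrow = m * n /\ forall i, i < m -> ar s2 aROW i = i * n.
suff : I (rg s1 rN) (den H c s1) by rewrite N1 => -[].
apply: for_ind => //.
move=> m s2 hm eE [fr fa] [i1 i2].
rewrite !denE /I /= /update /idx /= eE i1 fr // N1; split; first by rewrite mulSn addnC.
move=> i; rewrite ltnS leq_eqVlt => /orP[/eqP->|h]; first by rewrite eqxx.
by rewrite ltn_eqF // i2.
Qed.

Definition shifted (S : nat) (A : nat -> nat -> nat) (i j : nat) : nat :=
  if i != j then S + A i j else 0.

Lemma weights_spec H s n A : rg s rN = n ->
  (forall i, i < n -> ar s aROW i = i * n) ->
  (forall i j, i < n -> j < n -> ar s aA (i * n + j) = A i j) ->
  let s' := den H p_weights s in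
  forall i j, i < n -> j < n -> ar s' aG (ar s' aROW i + j) = shifted (rg s rS) A i j.
Proof.
move=> hN hrow hA s' i j hi hj.
have [_ fa'] := den_frame H p_weights s.
rewrite (fa' aROW) // hrow //.
have inj i1 j1 i2 j2 : j1 < n -> j2 < n -> i1 * n + j1 = i2 * n + j2 -> i1 = i2 /\ j1 = j2.
  move=> h1 h2 e; have n0 : 0 < n by lia.
  have := congr1 (fun x => x %/ n) e; have := congr1 (fun x => x %% n) e.
  by rewrite !modnMDl !modn_small // !divnMDl // !divn_small // !addn0.
pose I m s1 := forall i j, i < m -> j < n -> ar s1 aG (i * n + j) = shifted (rg s rS) A i j.
suff : I (rg s rN) s' by rewrite hN; apply.
apply: for_ind => //; rewrite hN => m s1 hm eE [fr fa]; rewrite /I => IH.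
have N1 : rg s1 rN = n by rewrite fr.
set c := CFor rf2 rN _.
pose J l s2 := (forall i j, i < m -> j < n -> ar s2 aG (i * n + j) = shifted (rg s rS) A i j) /\
  (forall j, j < l -> ar s2 aG (m * n + j) = shifted (rg s rS) A m j).
suff : J (rg s1 rN) (den H c s1).
  rewrite N1 => -[h1 h2] i1 j1; rewrite ltnS leq_eqVlt => /orP[/eqP->|h] hj1; first exact: h2.
  exact: h1.
apply: for_ind => //.

move=> l s2; rewrite N1 => hl fE [fr2 fa2] [j1 j2].
have e2 : rg s2 re = m by rewrite fr2.
have R2 : ar s2 aROW = ar s aROW by rewrite fa2 // fa.
have A2 : ar s2 aA = ar s aA by rewrite fa2 // fa.
have S2 : rg s2 rS = rg s rS by rewrite fr2 // fr.
have -> : den H (CIf (neqe (ER re) (ER rf2))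
    (CPut aG (EAdd (EA aROW (ER re)) (ER rf2))
       (EAdd (ER rS) (EA aA (EAdd (EA aROW (ER re)) (ER rf2)))))
    (CPut aG (EAdd (EA aROW (ER re)) (ER rf2)) (EC 0))) s2
    = seta s2 aG (m * n + l) (shifted (rg s rS) A m l).
  rewrite den_if heval_neqe /= /idx /= e2 fE R2 A2 S2 hrow // hA // /shifted.
  by case: eqP.
split=> [i1 j1' hi1 hj1|j1' hj1] /=.
  case: eqP => [/inj[] //|_]; first by lia.
  exact: j1.
case: eqP => [e|ne]; first by congr shifted; lia.
by apply: j2; lia.
Qed.

(** * The whole program *)

Definition p_out : hcmd := CFor ri rN (CPut 0 (ER ri) (EA aBEST (ER ri))).

Definition p_main : hcmd :=
  CSeq p_scale (CSeq p_rows (CSeq p_weights (CSeq p_hungarian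
  (CSeq p_cycles (CSeq p_next (CSeq p_rounds p_out)))))).

Lemma sum_rows m n (F : nat -> nat) :
  \sum_(0 <= e < m * n) F e = \sum_(0 <= x < m) \sum_(0 <= j < n) F (x * n + j).
Proof.
elim: m => [|m IH]; first by rewrite !big_geq.
rewrite big_nat_recr //= -IH mulSn addnC (@big_cat_nat _ _ _ (m * n)) ?leq_addr //=.
congr (_ + _); rewrite -{1}[m * n]add0n big_addn addnC addnK.
by apply: eq_bigr => j _; rewrite addnC.
Qed.

Lemma leq_sum_term m n (F : nat -> nat) i : m <= i < n -> F i <= \sum_(m <= j < n) F j.
Proof.
by move=> hi; rewrite (bigD1_seq i) ?mem_index_iota ?iota_uniq //= leq_addr.
Qed.

(** * Maximum weight permutations have no fixed points *)

Section Derangement.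

Variables (n S : nat) (A : nat -> nat -> nat) (sg : nat -> nat).
Hypothesis n2 : 2 <= n.
Hypothesis sgP : inj_below n sg.
Hypothesis SA : S = 1 + \sum_(0 <= x < n) \sum_(0 <= j < n) A x j.
Hypothesis sg_max : forall f, inj_below n f ->
  \sum_(0 <= x < n) shifted S A x (f x) <= \sum_(0 <= x < n) shifted S A x (sg x).

Lemma sum_shifted f : (forall x, x < n -> f x <> x) ->
  \sum_(0 <= x < n) shifted S A x (f x) = n * S + \sum_(0 <= x < n) A x (f x).
Proof.
move=> der; rewrite -[n in n * S]subn0 -sum_nat_const_nat -big_split /=.
apply: eq_big_nat => x /andP[_ hx]; rewrite /shifted ifT //.
by apply/eqP => e; apply: (der x).
Qed.

(** A fixed point forgoes one [S], more than [sg] can collect from [A], whereas the rotation by 1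
    collects [n * S]. *)
Lemma derangement x0 : x0 < n -> sg x0 <> x0.
Proof.
move=> hx0 fixed; have hr := @inj_below_rot n 1 ltac:(lia).
have := sg_max hr; rewrite sum_shifted; last first.
  by move=> x hx; rewrite modn_val; try lia; case: ifP; lia.
have A_S : \sum_(0 <= x < n) A x (sg x) < S.
  rewrite SA add1n ltnS; apply: leq_sum_nat => x /andP[_ hx].
  by apply: leq_sum_term; case: sgP => h _; rewrite h.
have le : \sum_(0 <= x < n) shifted S A x (sg x) + S <=
    n * S + \sum_(0 <= x < n) A x (sg x).
  have -> : n * S = \sum_(0 <= x < n) S by rewrite sum_nat_const_nat subn0.
  have -> : S = \sum_(0 <= x < n) (x == x0) * S.
    by rewrite -big_distrl /= sum_point ?mul1n.
  rewrite -!big_split /=; apply: leq_sum_nat => x _.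
  rewrite -big_distrl /= sum_point ?mul1n // /shifted.
  case: (eqVneq x x0) => [->|ne]; first by rewrite fixed eqxx mul1n leq_addr.
  by rewrite mul0n addn0; case: ifP => //; lia.
have := leq_addr (\sum_(0 <= x < n) A x ((x + 1) %% n)) (n * S).
by lia.
Qed.

Lemma derangement_max f : inj_below n f -> (forall x, x < n -> f x <> x) ->
  \sum_(0 <= x < n) A x (f x) <= \sum_(0 <= x < n) A x (sg x).
Proof.
move=> hf der; have := sg_max hf; rewrite !sum_shifted ?leq_add2l //.
exact: derangement.
Qed.

End Derangement.

Section Main.

Variables (H n k : nat) (num dn : nat -> nat).
Hypothesis nH : n <= H.-1.

Definition weight_matrix (i j : nat) : nat := scaled (n * n) num dn (i * n + j).

Definition start (h : hstate) : Prop :=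
  [/\ [/\ rg h rN = n, rg h rN1 = n.+1 & rg h rK = k],
      scale_data H (n * n) num dn h & forall a j, 0 < a -> ar h a j = 0].

Hypotheses (k3 : 3 <= k) (kn : k %| n) (n0 : 0 < n).
Hypothesis A_sym : forall i j, i < n -> j < n -> weight_matrix i j = weight_matrix j i.
Hypothesis A_tri : forall i j l, i < n -> j < n -> l < n ->
  weight_matrix i l <= weight_matrix i j + weight_matrix j l.

Lemma main_spec h : start h -> let out := ar (den H p_main h) 0 in
  inj_below n out /\
  forall f, inj_below n f -> (forall x, x < n -> f x <> x) ->
    (3 * k - 1) * \sum_(0 <= x < n) weight_matrix x (f x) <=
    4 * k * \sum_(0 <= i < n) weight_matrix (out i) (out (nx k i)).
Proof.
move=> [[hN hN1 hK] ds hz].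
rewrite /p_main 7!den_seq.
have [f1A f1S] := scale_spec ds; have [fr1 fa1] := den_frame H p_scale h.
set h1 := den H p_scale h in f1A f1S fr1 fa1 *.
have N1 : rg h1 rN = n by rewrite fr1.
have f2 := rows_spec H N1; have [fr2 fa2] := den_frame H p_rows h1.
set h2 := den H p_rows h1 in f2 fr2 fa2 *.
have N2 : rg h2 rN = n by rewrite fr2.
have A2 i j : i < n -> j < n -> ar h2 aA (i * n + j) = weight_matrix i j.
  by move=> hi hj; rewrite fa2 // f1A //; nia.
have f3 := weights_spec H N2 f2 A2; have [fr3 fa3] := den_frame H p_weights h2.
set h3 := den H p_weights h2 in f3 fr3 fa3 *.
set S := rg h2 rS in f3.
have SE : S = 1 + \sum_(0 <= x < n) \sum_(0 <= j < n) weight_matrix x j.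
  by rewrite /S fr2 // f1S sum_rows.
have S3 : rg h3 rS = S by rewrite fr3.
have N3 : rg h3 rN = n by rewrite fr3.
have N13 : rg h3 rN1 = n.+1 by rewrite fr3 // fr2 // fr1.
have ds3 : hung_data n (shifted S weight_matrix) h3 by split.
have V3 j : ar h3 aV j = 0 by rewrite fa3 // fa2 // fa1 // hz.
have P3 j : ar h3 aP j = 0 by rewrite fa3 // fa2 // fa1 // hz.
have G3 x j : x < n -> j < n -> shifted S weight_matrix x j <= rg h3 rS + rg h3 rS.
  move=> hx hj; rewrite S3 /shifted; case: ifP => // _; rewrite leq_add2l.
  apply: leq_trans (_ : \sum_(0 <= j < n) weight_matrix x j <= _).
    exact: (@leq_sum_term 0 n (weight_matrix x)).
  rewrite SE; apply: leq_trans (leq_addl _ _).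
  exact: (@leq_sum_term 0 n (fun x => \sum_(0 <= j < n) weight_matrix x j)).
have [sgP sg_max] := hungarian_spec H ds3 V3 P3 G3.
have [fr4 fa4] := den_frame H p_hungarian h3.
set h4 := den H p_hungarian h3 in sgP sg_max fr4 fa4 *.
set sg := ar h4 aSG in sgP sg_max.
have N4 : rg h4 rN = n by rewrite fr4.
have Z4 y : ar h4 aSEEN y = 0 by rewrite fa4 // fa3 // fa2 // fa1 // hz.
have [aP_ bl_succ bl_closed] := cycles_spec H sgP N4 (fun y _ => erefl) Z4.
have [fr5 fa5] := den_frame H p_cycles h4.
set h5 := den H p_cycles h4 in aP_ bl_succ bl_closed fr5 fa5 *.
have N5 : rg h5 rN = n by rewrite fr5.
have K5 : rg h5 rK = k by rewrite fr5 // fr4 // fr3 // fr2 // fr1.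
have f6 := next_spec H N5 K5 (ltn_trans (ltn0Sn 1) k3).
have [fr6 fa6] := den_frame H p_next h5.
set h6 := den H p_next h5 in f6 fr6 fa6 *.
have k_n : k <= n by apply: dvdn_leq.
have n2 : 2 <= n by lia.
have der := derangement n2 sgP SE sg_max.
have ds6 : rounds_data n k weight_matrix sg h6.
  split=> //.
  - split; first by rewrite fr6.
      by rewrite fr6 // fr5 // fr4.
    by rewrite fr6.
  - move=> i j hi hj; rewrite !(fa6 _, fa5 _, fa4 _, fa3 _) //.
    by rewrite f2 // A2.
  - by move=> x hx; rewrite fa6 // fa5.
have AA6 : ar h6 aAA = ar h5 aAA by rewrite fa6.
have BL6 : ar h6 aBL = ar h5 aBL by rewrite fa6.
have [||||inj7 bound7] := rounds_spec H k3 kn n0 A_sym A_tri sgP ds6.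
- by rewrite AA6.
- by rewrite BL6; apply: bl_succ_start bl_succ.
- by rewrite BL6; apply: base_two aP_ bl_closed der.
- rewrite AA6 BL6.
  by apply: (base_arrangement (T := n`!)) => // [|x hx]; [exact: fact_gt0 | exact: inj_below_fact].
have [fr7 fa7] := den_frame H p_rounds h6.
set h7 := den H p_rounds h6 in inj7 bound7 fr7 fa7 *.
have N7 : rg h7 rN = n by rewrite fr7 // fr6.
clearbody h7.
have out i : i < n -> ar (den H p_out h7) 0 i = ar h7 aBEST i.
  move=> hi; rewrite (for_map (g := ar h7 aBEST)) // ?N7 ?hi //.
  move=> m s hm riE [fr fa] IH j; rewrite den_put /= riE /idx /= fa //.
  by rewrite (_ : minn m H.-1 = m) //; move: hm; rewrite ?N7; lia.
split.
  by apply: eq_inj_below inj7 => i hi; rewrite out.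
move=> f hf fder.
have -> : \sum_(0 <= i < n) weight_matrix (ar (den H p_out h7) 0 i)
    (ar (den H p_out h7) 0 (nx k i)) = cfg_weight n k weight_matrix (ar h7 aBEST).
  by apply: eq_big_nat => i /andP[_ hi]; rewrite !out // nx_lt.
apply: leq_trans bound7; rewrite leq_mul2l; apply/orP; right.
exact: (derangement_max n2 sgP SE sg_max).
Qed.

End Main.

(** * Running time *)

(** This is written directly for the machine, because the number of turns is itself the result: it
    becomes the loop bound [rL]. *)
Definition p_log : cmd :=
  While (Reg rps.+1)
    (Seq (SetReg rps.+1 (Half (Reg rps.+1))) (SetReg rL.+1 (Add (Reg rL.+1) (Const 1)))).

(** The input has length [2 * n * n + 1], so halving register 0 gives [n * n]. At the end register 0
    receives the length of the output. *)
Definition packing_cmd (k : nat) : cmd :=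
  Seq (SetReg rN.+1 (Defs.Mem (Const 0)))
  (Seq (SetReg rN2.+1 (Half (Reg 0)))
  (Seq (SetReg rK.+1 (Const k))
  (Seq (SetReg rN1.+1 (Add (Reg rN.+1) (Const 1)))
  (Seq (compile p_sumden) (Seq p_log (Seq (compile p_main) (SetReg 0 (Reg rN.+1)))))))).

(** A turn costs 9 and the final test 2. *)
Lemma log_exec B s : reg s rps.+1 < 2 ^ B ->
  exists t s' L, [/\ exec p_log s t s', L <= B, t <= 9 * L + 2, reg s rps.+1 < 2 ^ L &
    [/\ Defs.mem s' = Defs.mem s, reg s' rL.+1 = reg s rL.+1 + L
      & forall r, r != rps.+1 -> r != rL.+1 -> reg s' r = reg s r]].
Proof.
elim: B s => [|B IH] s hv.
  exists 2, s, 0; split=> //; last by rewrite addn0.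
  by apply: (@exec_while_false (Reg rps.+1)); move: hv => /=; rewrite expn0; lia.
have [v0|v0] := eqVneq (reg s rps.+1) 0.
  exists 2, s, 0; split=> //; [exact: (@exec_while_false (Reg rps.+1)) | by rewrite v0 | by rewrite addn0].
set s1 := State (update (reg s) rps.+1 (eval s (Half (Reg rps.+1)))) (Defs.mem s).
set s2 := State (update (reg s1) rL.+1 (eval s1 (Add (Reg rL.+1) (Const 1)))) (Defs.mem s1).
have v2 : reg s2 rps.+1 = (reg s rps.+1)./2 by [].
have L2 : reg s2 rL.+1 = (reg s rL.+1).+1 by rewrite /= /update /= addn1.
have [t [s' [L [x hL ht hL2 [m' L' r']]]]] : exists t s' L,
  [/\ exec p_log s2 t s', L <= B, t <= 9 * L + 2, reg s2 rps.+1 < 2 ^ L &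
    [/\ Defs.mem s' = Defs.mem s2, reg s' rL.+1 = reg s2 rL.+1 + L
      & forall r, r != rps.+1 -> r != rL.+1 -> reg s' r = reg s2 r]].
  by apply: IH; rewrite v2; move: hv; rewrite expnS; lia.
exists (1 + (3 + 4) + t).+1, s', L.+1; split=> //.
- apply: (@exec_while_true (Reg rps.+1)) x => //.
  apply: (@exec_seq _ _ _ 3 s1); first exact: (exec_setreg rps.+1 (Half (Reg rps.+1))).
  exact: (exec_setreg rL.+1 (Add (Reg rL.+1) (Const 1))).
- by lia.
- by rewrite v2 in hL2; rewrite expnS; lia.
- split=> //; first by rewrite L' L2 addSnnS.
  by move=> r h1 h2; rewrite r' //= /update (negbTE h1) (negbTE h2).
Qed.

Lemma bitlen_gt m : m < 2 ^ bitlen m.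
Proof. by rewrite /bitlen trunc_log_ltn. Qed.

Lemma sum_lt_bitsize xs : \sum_(m <- xs) m < 2 ^ bitsize xs.
Proof.
rewrite /bitsize; elim: xs => [|m xs IH]; first by rewrite !big_nil.
rewrite !big_cons expnD; have := bitlen_gt m.
move: (2 ^ bitlen m) (2 ^ _) (\sum_(_ <- _) _) IH => a b c; nia.
Qed.

Lemma size_bitsize xs : size xs <= bitsize xs.
Proof.
rewrite /bitsize -[size xs]mul1n -[1 * _]/(1 * size xs) mulnC.
rewrite -(count_predT xs) -sum1_count muln1; exact: leq_sum.
Qed.

Lemma sum_even N (F : nat -> nat) :
  \sum_(0 <= e < N) F (e + e + 2) <= \sum_(0 <= i < (N + N).+1) F i.
Proof.
elim: N => [|N IH]; first by rewrite big_geq.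
have -> : (N.+1 + N.+1).+1 = (N + N).+3 by lia.
rewrite big_nat_recr //= [leqRHS]big_nat_recr //= [X in _ <= X + _]big_nat_recr //= addn2.
by rewrite leq_add2r; apply: leq_trans IH (leq_addr _ _).
Qed.

Lemma p_sumden_ok : cok p_sumden && all (fun m => m \notin wr p_sumden) (bnds p_sumden).
Proof. by vm_compute. Qed.

Lemma p_main_ok : [&& cok p_main, all (fun m => m \notin wr p_main) (bnds p_main)
  & all (fun m => m \in [:: rN; rN2; rK; rL; rN1]) (bnds p_main)].
Proof. by vm_compute. Qed.

Lemma rN_p_main : rN \notin wr p_main.
Proof. by vm_compute. Qed.

(** All loop bounds are at most the bit size of the input plus [k], hence the composition; the
    remaining terms cover [p_log] and the assignments. *)
Definition time_poly (k : nat) : {poly nat} :=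
  (30%:P + 9%:P * 'X + ((tpol p_sumden + tpol p_main) \Po ('X + k%:P)))%R.

Lemma time_polyE k B : (time_poly k).[B]%R =
  30 + 9 * B + (tbound p_sumden (B + k) + tbound p_main (B + k)).
Proof.
rewrite /time_poly /tbound; move: (tpol p_sumden) (tpol p_main) => p q.
by rewrite !hornerD hornerM !hornerC hornerX horner_comp !hornerD hornerX hornerC.
Qed.

Section Run.

Variables (k n : nat) (xs : seq nat).
Hypothesis k0 : 0 < k.
Hypothesis size_xs : size xs = (n * n + n * n).+1.
Hypothesis xs0 : nth 0 xs 0 = n.

Lemma packing_cmd_exec : exists t s' h,
  [/\ exec (packing_cmd k) (load xs) t s', t <= (time_poly k).[bitsize xs]%R,
      start (size xs) n k (fun e => nth 0 xs (e + e + 1)) (fun e => nth 0 xs (e + e + 2)) h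
    & reg s' 0 = n /\
      forall i, i < n -> Defs.mem s' i = ar (den (size xs) p_main h) 0 i].
Proof.
set H := size xs; have H0 : 0 < H by rewrite /H size_xs.
set B := bitsize xs; have HB : H <= B by apply: size_bitsize.
set s1 := State (update (reg (load xs)) rN.+1 (eval (load xs) (Defs.Mem (Const 0)))) (Defs.mem (load xs)).
set s2 := State (update (reg s1) rN2.+1 (eval s1 (Half (Reg 0)))) (Defs.mem s1).
set s3 := State (update (reg s2) rK.+1 (eval s2 (Const k))) (Defs.mem s2).
set s4 := State (update (reg s3) rN1.+1 (eval s3 (Add (Reg rN.+1) (Const 1)))) (Defs.mem s3).
have x1 : exec (SetReg rN.+1 (Defs.Mem (Const 0))) (load xs) 3 s1 by exact: (exec_setreg _ _).
have x2 : exec (SetReg rN2.+1 (Half (Reg 0))) s1 3 s2 by exact: (exec_setreg _ _).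
have x3 : exec (SetReg rK.+1 (Const k)) s2 2 s3 by exact: (exec_setreg _ _).
have x4 : exec (SetReg rN1.+1 (Add (Reg rN.+1) (Const 1))) s3 4 s4 by exact: (exec_setreg _ _).
have [r0 r1 r2 r3 r5] : [/\ reg s4 0 = H, reg s4 rN.+1 = n, reg s4 rN2.+1 = n * n,
    reg s4 rK.+1 = k & reg s4 rN1.+1 = n.+1].
  rewrite /s4 /s3 /s2 /s1 /= /update /= xs0 /H size_xs addn1; split=> //.
  by rewrite addnn -[in LHS]uphalfE uphalf_double.
have r4 : reg s4 rL.+1 = 0 by [].
have m4 : Defs.mem s4 = nth 0 xs by [].
clearbody s4.
pose h0 := HState (fun r => reg s4 r.+1) (fun a j => if a == 0 then nth 0 xs j else 0).
have sim0 : sim H s4 h0.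
  split=> //; first by move=> i _; rewrite m4.
  move=> a i /andP[a0 _]; rewrite m4 /= gtn_eqF // nth_default //.
  by rewrite -/H leq_addr.
have nN : n <= n * n by case: (n) => // m; rewrite leq_pmulr.
have N_B : n * n <= B + k by move: HB; rewrite /H size_xs; lia.
have idxE i : i < H -> idx H 0 i = i by rewrite /idx /=; lia.
have numE h e : ar h 0 = nth 0 xs -> e < n * n ->
    heval H h (num_at (EC e)) = nth 0 xs (e + e + 1).
  by move=> h_ he; rewrite [LHS]/= idxE ?h_ // /H size_xs; lia.
have denE' h e : ar h 0 = nth 0 xs -> e < n * n ->
    heval H h (den_at (EC e)) = nth 0 xs (e + e + 2).
  by move=> h_ he; rewrite [LHS]/= idxE ?h_ // /H size_xs; lia.
have /andP[ok1 ok1'] := p_sumden_ok.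
have [t5 [s5 [x5 sim5 ht5]]] := compile_exec (N := B + k) H0 sim0 ok1
  ltac:(by move=> m; rewrite /= inE => /eqP->; rewrite /= r2)
  ltac:(by move=> m /(allP ok1')).
have [fr5 fa5] := den_frame H p_sumden h0.
set h5 := den H p_sumden h0 in sim5 fr5 fa5.
have ps5 : rg h5 rps = \sum_(0 <= e < n * n) nth 0 xs (e + e + 2).
  rewrite sumden_spec /= r2; apply: eq_big_nat => e /andP[_ he].
  by have := denE' h0 e (erefl _) he.
have lo5 : ar h5 0 = nth 0 xs by rewrite fa5.
have [q0 q1 q2 q3] := sim5.
have lt5 : reg s5 rps.+1 < 2 ^ B.
  rewrite q1 ps5; apply: leq_ltn_trans (sum_lt_bitsize xs).
  by rewrite [X in _ <= X](big_nth 0) size_xs; apply: sum_even.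
have [t6 [s6 [L [x6 hL ht6 hL2 [m6 L6 r6]]]]] := log_exec lt5.
pose h6 := setr (setr h5 rps (reg s6 rps.+1)) rL L.
have L60 : reg s6 rL.+1 = L by rewrite L6 q1 /h5 fr5 //= r4.
have sim6 : sim H s6 h6.
  split=> //.
  - by rewrite r6.
  - move=> r; rewrite /h6 /= /update.
    case: (r =P rL) => [->//|/eqP nL]; case: (r =P rps) => [->//|/eqP nps].
    by rewrite r6 ?eqSS // q1.
  - by move=> i hi; rewrite m6 q2.
  - by move=> a i ha; rewrite m6 q3.
have st6 : start H n k (fun e => nth 0 xs (e + e + 1)) (fun e => nth 0 xs (e + e + 2)) h6.
  split.
  - by rewrite /h6 /= /update /= !fr5 //= r1 r3 r5.
  - split.
    + by rewrite /h6 /= /update /= fr5 //= r2.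
    + by move=> e he; apply: numE.
    + by move=> e he; apply: denE'.
    + move=> e he; rewrite [rg h6 rL]/= /update /=.
      apply: leq_ltn_trans hL2; rewrite q1 ps5.
      exact: (@leq_sum_term 0 (n * n) (fun e => nth 0 xs (e + e + 2))).
  - by move=> a j a0; rewrite /h6 /= fa5 //= gtn_eqF.
have /and3P[ok2 ok2' ok2''] := p_main_ok.
have [t7 [s7 [x7 sim7 ht7]]] : exists t s', [/\ exec (compile p_main) s6 t s',
    sim H s' (den H p_main h6) & t <= tbound p_main (B + k)].
  apply: compile_exec => //.
    case: st6 => [[e1 e2 e3] [e4 _ _ _] _].
    move=> m /(allP ok2''); rewrite !inE => /or4P[|||/orP[]] /eqP->.
    - by rewrite e1; lia.
    - by rewrite e4.
    - by rewrite e3 leq_addl.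
    - by rewrite [rg h6 rL]/= /update /=; lia.
    - by rewrite e2; move: HB; rewrite /H size_xs; lia.
  by move=> m /(allP ok2').
pose s8 := State (update (reg s7) 0 (eval s7 (Reg rN.+1))) (Defs.mem s7).
have x8 : exec (SetReg 0 (Reg rN.+1)) s7 2 s8 by exact: (exec_setreg _ _).
exists (3 + (3 + (2 + (4 + (t5 + (t6 + (t7 + 2))))))), s8, h6; split=> //.
- apply: exec_seq x1 (exec_seq x2 (exec_seq x3 (exec_seq x4 _))).
  exact: exec_seq x5 (exec_seq x6 (exec_seq x7 x8)).
- by rewrite time_polyE; lia.
- have [z0 z1 z2 z3] := sim7; split.
    rewrite /= /update /= z1.
    have [fr7 _] := den_frame H p_main h6; rewrite (fr7 _ rN_p_main).
    by case: st6 => [[-> _ _] _ _].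
  move=> i hi; have hiH : i < H by rewrite /H size_xs; lia.
  exact: z2 hiH.
Qed.

End Run.

(** * Instances and packings *)

Lemma nth_flatten_uniform (T : Type) (x0 : T) c (L : seq (seq T)) e b :
  all (fun l => size l == c) L -> b < c ->
  nth x0 (flatten L) (e * c + b) = nth x0 (nth [::] L e) b.
Proof.
move=> hL hb; elim: L e hL => [|l L IH] e /=; first by rewrite !nth_nil.
case/andP=> /eqP sl hL; rewrite nth_cat sl; case: e => [|e] /=.
  by rewrite mul0n add0n hb.
by rewrite mulSn -addnA ltnNge leq_addr /= addKn IH.
Qed.

Lemma size_flatten_uniform (T : Type) c (L : seq (seq T)) :
  all (fun l => size l == c) L -> size (flatten L) = size L * c.
Proof.
by elim: L => //= l L IH /andP[/eqP sl /IH]; rewrite size_cat sl mulSn => ->.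
Qed.

Section Encoding.

Variables (n : nat) (w : 'I_n -> 'I_n -> rat).

Let xs := encode_instance w.

Let code (x y : 'I_n) : seq nat := [:: `|numq (w x y)|; `|denq (w x y)|]%N.

Let rows := [seq [seq code x y | y <- enum 'I_n] | x <- enum 'I_n].

Let all_rows : all (fun l => size l == n) rows.
Proof. by apply/allP => l /mapP[x _ ->]; rewrite size_map size_enum_ord. Qed.

Let all_codes : all (fun l => size l == 2) (flatten rows).
Proof. by apply/allP => l /flatten_mapP[x _ /mapP[y _ ->]]. Qed.

Lemma size_encode : size xs = (n * n + n * n).+1.
Proof.
rewrite /xs /encode_instance /= -/(flatten rows) (size_flatten_uniform all_codes).
by rewrite (size_flatten_uniform all_rows) size_map size_enum_ord muln2 addnn.
Qed.

Lemma nth_encode (x y : 'I_n) b : b < 2 ->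
  nth 0 xs (((x * n + y) * 2 + b).+1) = nth 0 (code x y) b.
Proof.
move=> hb; rewrite /xs /encode_instance /= -/(flatten rows).
rewrite (nth_flatten_uniform _ _ all_codes hb).
rewrite (nth_flatten_uniform _ _ all_rows (ltn_ord y)).
by rewrite (nth_map x) ?size_enum_ord // (nth_map y) ?size_enum_ord // !nth_ord_enum.
Qed.

Lemma nth_num (x y : 'I_n) (e := x * n + y) :
  nth 0 xs (e + e + 1) = `|numq (w x y)|%N.
Proof.
rewrite -[RHS]/(nth 0 (code x y) 0) -nth_encode // /e.
by congr (nth 0 xs _); lia.
Qed.

Lemma nth_den (x y : 'I_n) (e := x * n + y) :
  nth 0 xs (e + e + 2) = `|denq (w x y)|%N.
Proof.
rewrite -[RHS]/(nth 0 (code x y) 1) -nth_encode // /e.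
by congr (nth 0 xs _); lia.
Qed.

Hypothesis hw : is_metric w.

Let num e := nth 0 xs (e + e + 1).
Let dn e := nth 0 xs (e + e + 2).
Let A := weight_matrix n num dn.
Let D := \prod_(0 <= f < n * n) dn f.

Lemma pair_lt (x y : 'I_n) : x * n + y < n * n.
Proof. have := ltn_ord x; have := ltn_ord y; nia. Qed.

Lemma dn_gt0 e : e < n * n -> 0 < dn e.
Proof.
move=> he; have n0 : 0 < n by case: (n) he.
have hx : e %/ n < n by rewrite ltn_divLR.
have hy : e %% n < n by rewrite ltn_pmod.
have := nth_den (Ordinal hx) (Ordinal hy); rewrite /= -divn_eq /dn => ->.
by rewrite absz_gt0 denq_neq0.
Qed.

Lemma D_gt0 : 0 < D.
Proof.
rewrite /D big_nat_cond; apply: prodn_cond_gt0 => e.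
by rewrite andbT => /andP[_ /dn_gt0].
Qed.

Lemma matrixE (x y : 'I_n) : ((A x y)%:R = w x y * D%:R :> rat)%R.
Proof.
rewrite /A /weight_matrix /scaled /D.
rewrite (bigD1_seq (x * n + y)) ?mem_index_iota ?pair_lt ?iota_uniq //=.
rewrite !natrM mulrA; congr (_ * _)%R.
rewrite /num /dn nth_num nth_den.
have hn : (0 <= numq (w x y))%R by rewrite numq_ge0 (metric_ge0 hw).
have -> : (`|numq (w x y)|%N%:R = (numq (w x y))%:~R :> rat)%R.
  by rewrite natr_absz ger0_norm.
have -> : (`|denq (w x y)|%N%:R = (denq (w x y))%:~R :> rat)%R.
  by rewrite natr_absz ger0_norm // denq_ge0.
rewrite -{2}(divq_num_den (w x y)) mulfVK // intr_eq0 denq_neq0 //.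
Qed.

Lemma A_symm i j : i < n -> j < n -> A i j = A j i.
Proof.
move=> hi hj; apply/eqP; rewrite -(eqr_nat rat).
have := matrixE (Ordinal hi) (Ordinal hj) => /= ->.
have := matrixE (Ordinal hj) (Ordinal hi) => /= ->.
by rewrite (metric_sym hw).
Qed.

Lemma A_triangle i j l : i < n -> j < n -> l < n -> A i l <= A i j + A j l.
Proof.
move=> hi hj hl; rewrite -(ler_nat rat) natrD.
have := matrixE (Ordinal hi) (Ordinal hl) => /= ->.
have := matrixE (Ordinal hi) (Ordinal hj) => /= ->.
have := matrixE (Ordinal hj) (Ordinal hl) => /= ->.
by rewrite -mulrDl ler_wpM2r ?ler0n // (metric_triangle hw).
Qed.

End Encoding.

Section Packing.

Variables (n k : nat) (w : 'I_n -> 'I_n -> rat).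
Hypotheses (k0 : 0 < k) (kn : k %| n).

Lemma size_vertices (P : cycle_family n k) : size (vertices P) = n.
Proof.
rewrite /vertices (@size_flatten_uniform _ k); last first.
  by apply/allP => l /mapP[c _ ->]; rewrite size_tuple.
by rewrite size_map size_tuple divnK.
Qed.

Lemma nth_vertices (x0 : 'I_n) (P : cycle_family n k) (c : 'I_(n %/ k)) (i : nat) :
  i < k -> nth x0 (vertices P) (c * k + i) = nth x0 (tnth P c) i.
Proof.
move=> hi; rewrite /vertices (@nth_flatten_uniform _ _ k) //; last first.
  by apply/allP => l /mapP[d _ ->]; rewrite size_tuple.
by rewrite (nth_map (tnth P c)) ?size_tuple // -tnth_nth.
Qed.

Lemma next_nth_uniq (T : eqType) (x0 : T) (p : seq T) i : uniq p -> i < size p ->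
  next p (nth x0 p i) = nth x0 p (if i.+1 == size p then 0 else i.+1).
Proof.
case: p => // y p u hi; rewrite next_nth mem_nth // index_uniq //=.
case: eqP => [[->]|ne]; first by rewrite nth_default.
by apply: set_nth_default; move: hi ne => /=; lia.
Qed.

(** In the concatenated list, [next] within a cycle becomes [nx] on positions. *)
Lemma weight_positions (x0 : 'I_n) (P : cycle_family n k) : uniq (vertices P) ->
  (weight w P = \sum_(0 <= j < n) w (nth x0 (vertices P) j)
                                  (nth x0 (vertices P) (nx k j)))%R.
Proof.
move=> u; rewrite /weight big_tuple.
have -> : (\sum_(0 <= j < n) w (nth x0 (vertices P) j) (nth x0 (vertices P) (nx k j)) =
   \sum_(0 <= c < n %/ k) \sum_(0 <= i < k) w (nth x0 (vertices P) (c * k + i))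
      (nth x0 (vertices P) (nx k (c * k + i))))%R.
  rewrite -{1}(divnK kn); elim: (n %/ k) => [|m IH]; first by rewrite !big_geq.
  rewrite big_nat_recr //= -IH mulSn addnC (@big_cat_nat _ _ _ (m * k)) ?leq_addr //=.
  congr (_ + _)%R; rewrite -{1}[(m * k)%N]add0n big_addn addnC addnK.
  by apply: eq_bigr => j _; rewrite addnC.
rewrite big_mkord; apply: eq_bigr => c _.
have uc : uniq (tnth P c).
  have : forall s : seq (k.-tuple 'I_n), tnth P c \in s ->
      uniq (flatten [seq val d | d <- s]) -> uniq (tnth P c).
    elim=> // d s IH; rewrite inE /= cat_uniq => hc /and3P[u1 _ u2].
    by case/orP: hc => [/eqP-> //|hc]; apply: IH.
  by apply; [exact: mem_tnth | exact: u].
rewrite /cycle_weight (big_nth x0) size_tuple.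
apply: eq_big_nat => i /andP[_ hi]; rewrite nth_vertices //.
rewrite next_nth_uniq ?size_tuple //; congr (w _ _).
rewrite /nx -addnS dvdn_addr ?dvdn_mull //.
case: (eqVneq i.+1 k) => [->|ne].
  by rewrite dvdnn addnK -nth_vertices // addn0.
have nd : (k %| i.+1) = false by apply/negP => /dvdn_leq h; have := h isT; lia.
by rewrite nd nth_vertices //; lia.
Qed.

Lemma packing_of (x0 : 'I_n) (out : nat -> nat) : inj_below n out ->
  exists P : cycle_family n k, is_packing P /\
    vertices P = [seq insubd x0 (out j) | j <- iota 0 n].
Proof.
move=> [ob oi].
pose v j : 'I_n := insubd x0 (out j).
pose P : cycle_family n k := [tuple [tuple v (c * k + i) | i < k] | c < n %/ k].
have vE : vertices P = [seq v j | j <- iota 0 n].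
  apply: (@eq_from_nth _ x0) => [|j]; rewrite size_vertices ?size_map ?size_iota //.
  move=> hj; have hc : j %/ k < n %/ k by rewrite ltn_divLR // divnK.
  rewrite {1}(divn_eq j k) (nth_vertices x0 P (Ordinal hc)) ?ltn_pmod //.
  have hm : j %% k < k by rewrite ltn_pmod.
  rewrite tnth_mktuple -[(j %% k)%N]/(val (Ordinal hm)) -tnth_nth tnth_mktuple.
  by rewrite /= -divn_eq (nth_map 0) ?size_iota // nth_iota.
have vv j : j < n -> val (v j) = out j by move=> hj; rewrite /v val_insubd ob.
have uv : uniq (vertices P).
  rewrite vE map_inj_in_uniq ?iota_uniq // => i j; rewrite !mem_iota => /andP[_ hi] /andP[_ hj].
  by move/(congr1 val); rewrite !vv //; apply: oi.
exists P; split=> //; rewrite /is_packing uv /=; apply/forallP => x.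
have [j hj ej] := inj_below_onto (conj ob oi) (ltn_ord x).
rewrite vE; apply/mapP; exists j; first by rewrite mem_iota.
by apply: val_inj; rewrite /= vv.
Qed.

End Packing.

(** * The approximation ratio *)

Lemma nx_inj_below n k : 0 < k -> k %| n -> inj_below n (nx k).
Proof.
move=> k0 kn; split=> [i hi|i j hi hj]; first exact: nx_lt.
rewrite /nx; case: ifP => di; case: ifP => dj e.
- by have := dvdn_leq (ltn0Sn i) di; have := dvdn_leq (ltn0Sn j) dj; lia.
- by have := dvdn_sub di (dvdnn k); rewrite e dj.
- by have := dvdn_sub dj (dvdnn k); rewrite -e di.
- by case: e.
Qed.

Lemma nx_neq k i : 2 <= k -> nx k i <> i.
Proof. by move=> k2; rewrite /nx; case: ifP => [/dvdn_leq h|_]; [have := h isT|]; lia. Qed.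

Section PackingPermutation.

Variables (n k : nat) (x0 : 'I_n) (Q : cycle_family n k).
Hypotheses (k2 : 2 <= k) (kn : k %| n).
Hypothesis Qp : is_packing Q.

Let v j : 'I_n := nth x0 (vertices Q) j.
Let pos (x : nat) : nat := index (insubd x0 x) (vertices Q).

(** The packing as a permutation, each vertex going to the next one of its cycle; having no fixed
    point, it competes with the maximum weight permutation. *)
Definition packing_next (x : nat) : nat := v (nx k (pos x)).

Let uQ : uniq (vertices Q). Proof. by case/andP: Qp. Qed.

Let k0 : 0 < k. Proof. exact: ltnW. Qed.

Let pos_lt x : pos x < n.
Proof.
have := index_mem (insubd x0 x) (vertices Q); rewrite (size_vertices kn) /pos => ->.
by case/andP: Qp => _ /forallP.
Qed.

Let v_pos x : x < n -> val (v (pos x)) = x.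
Proof.
move=> hx; rewrite /v nth_index; first by rewrite val_insubd hx.
by case/andP: Qp => _ /forallP.
Qed.

Let v_inj i j : i < n -> j < n -> val (v i) = val (v j) -> i = j.
Proof.
move=> hi hj /val_inj/eqP.
by rewrite /v nth_uniq ?(size_vertices kn) // => /eqP.
Qed.

Let pos_v j : j < n -> pos (v j) = j.
Proof. by move=> hj; apply: v_inj; rewrite ?v_pos. Qed.

Lemma packing_next_inj : inj_below n packing_next.
Proof.
have [nb ni] := nx_inj_below k0 kn; split=> [x hx|x y hx hy]; first exact: ltn_ord.
move/(v_inj (nb _ (pos_lt x)) (nb _ (pos_lt y)))/(ni _ _ (pos_lt x) (pos_lt y)) => e.
by rewrite -(v_pos hx) -(v_pos hy) e.
Qed.

Lemma packing_next_neq x : x < n -> packing_next x <> x.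
Proof.
move=> hx; rewrite -{2}(v_pos hx) => /(v_inj (nx_lt kn (pos_lt x)) (pos_lt x)).
exact: nx_neq.
Qed.

Lemma sum_packing_next (A : nat -> nat -> nat) :
  \sum_(0 <= x < n) A x (packing_next x) = \sum_(0 <= j < n) A (v j) (v (nx k j)).
Proof.
have vP : inj_below n v by split=> [j hj|]; [exact: ltn_ord | exact: v_inj].
rewrite -(sum_inj_below _ vP); apply: eq_big_nat => j /andP[_ hj].
by rewrite /packing_next pos_v.
Qed.

End PackingPermutation.

Lemma packing_scaled n k (w : 'I_n -> 'I_n -> rat) (x0 : 'I_n) (P : cycle_family n k)
    (num dn : nat -> nat) (D : nat) : 0 < k -> k %| n -> uniq (vertices P) ->
  (forall x y : 'I_n, (weight_matrix n num dn x y)%:R = w x y * D%:R :> rat)%R ->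
  ((\sum_(0 <= j < n) weight_matrix n num dn (nth x0 (vertices P) j)
      (nth x0 (vertices P) (nx k j)))%:R = weight w P * D%:R :> rat)%R.
Proof.
move=> k0 kn u hA; rewrite (weight_positions w k0 kn x0 u) natr_sum mulr_suml.
by apply: eq_bigr => j _.
Qed.

Local Open Scope ring_scope.

Lemma ratio_bound (k D a b : nat) (wP wQ : rat) : (0 < k)%N -> (0 < D)%N ->
  a%:R = wQ * D%:R -> b%:R = wP * D%:R -> ((3 * k - 1) * a <= 4 * k * b)%N ->
  (3 / 4 - (1 / 4) / k%:R) * wQ <= wP.
Proof.
move=> k0 D0 ea eb le_ab.
have kr : 0 < k%:R :> rat by rewrite ltr0n.
have Dr : 0 < D%:R :> rat by rewrite ltr0n.
have h : (3 * k - 1)%N%:R * a%:R <= (4 * k)%N%:R * b%:R :> rat.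
  by rewrite -!natrM ler_nat.
have {}h : (3 * k%:R - 1) * wQ <= 4 * k%:R * wP.
  rewrite -(ler_pM2r Dr) -[leLHS]mulrA -[leRHS]mulrA -ea -eb.
  by move: h; rewrite natrB ?natrM //; lia.
have -> : 3 / 4 - (1 / 4) / k%:R = (3 * k%:R - 1) / (4 * k%:R) :> rat.
  by field; rewrite gt_eqF.
rewrite mulrAC ler_pdivrMr; last by rewrite mulr_gt0.
by rewrite [leRHS]mulrC.
Qed.

Unset Implicit Arguments.

Theorem mainTheorem4 (k : nat) (k_ge3 : (3 <= k)%N) (k_odd : odd k) :
  exists A : cmd, polytime_approximation k (3 / 4 - (1 / 4) / k%:R) A.
Proof.
exists (packing_cmd k), (time_poly k) => n w kn hw.
have k0 : (0 < k)%N by apply: leq_trans k_ge3.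
set xs := encode_instance w.
have size_xs : size xs = (n * n + n * n).+1 := size_encode w.
have [t [s [h [x ht hstart [reg0 out_mem]]]]] := packing_cmd_exec k0 size_xs (erefl _).
have unloadE : unload s = mkseq (ar (den (size xs) p_main h) 0) n.
  rewrite /unload reg0; apply: (@eq_from_nth _ 0%N); rewrite !size_mkseq // => i hi.
  by rewrite !nth_mkseq // out_mem.
have rho0 : 0 <= 3 / 4 - (1 / 4) / k%:R :> rat.
  have kr : 3 <= k%:R :> rat by rewrite (ler_nat rat 3).
  by rewrite subr_ge0 ler_pdivrMr; lra.
have opt_le (P : cycle_family n k) : 0 <= weight w P ->
    (forall Q : cycle_family n k, is_packing Q ->
      (3 / 4 - (1 / 4) / k%:R) * weight w Q <= weight w P) ->
    (3 / 4 - (1 / 4) / k%:R) * opt k w <= weight w P.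
  move=> wP hQ; rewrite /opt.
  (* The default value 0 of the maximum is covered by the nonnegative weight of [P]. *)
  elim/big_ind: _ => [|a b ha hb|Q /hQ//]; first by rewrite mulr0.
  by rewrite maxEle; case: ifP.
have weight_ge0 (P : cycle_family n k) : 0 <= weight w P.
  by apply: sumr_ge0 => c _; apply: sumr_ge0 => y _; apply: metric_ge0.
have [n0|n0] := posnP n.
  have q0 : (n %/ k = 0)%N by rewrite n0 div0n.
  have vnil (P : cycle_family n k) : val P = [::].
    by apply: size0nil; rewrite size_tuple.
  have P : cycle_family n k by rewrite /cycle_family q0; exact: [tuple].
  exists t, P; split; [|exact: ht| |].
  - exists s; first exact: x.
    by rewrite unloadE /encode_packing /vertices vnil n0.
  - rewrite /is_packing /vertices vnil; apply/forallP => y.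
    by have := ltn_ord y; rewrite {2}n0.
  - by apply: (opt_le P (weight_ge0 P)) => Q _; rewrite /weight !vnil !big_nil mulr0.
have x0 : 'I_n := Ordinal n0.
have nH : (n <= (size xs).-1)%N by rewrite size_xs /=; nia.
have [inj bound] := main_spec nH k_ge3 kn n0 (A_symm hw) (A_triangle hw) hstart.
set out := ar (den (size xs) p_main h) 0 in inj bound unloadE.
have [P [pP vP]] := packing_of k0 kn x0 inj.
exists t, P; split; [|exact: ht|exact: pP|].
  exists s; first exact: x.
  rewrite unloadE /encode_packing vP -map_comp.
  apply/eq_in_map => j; rewrite mem_iota => /andP[_ hj] /=.
  by rewrite val_insubd; case: inj => -> .
apply: (opt_le P (weight_ge0 P)) => Q pQ.
have uP : uniq (vertices P) by case/andP: pP.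
have uQ : uniq (vertices Q) by case/andP: pQ.
have k2 : (2 <= k)%N by apply: leq_trans k_ge3.
(* The optimum enters only here, through the successor permutation of an arbitrary packing [Q]. *)
have bQ := bound _ (packing_next_inj x0 k2 kn pQ) (packing_next_neq k2 kn pQ).
have sP := packing_scaled x0 k0 kn uP (matrixE hw).
have sQ := packing_scaled x0 k0 kn uQ (matrixE hw).
apply: (ratio_bound k0 (D_gt0 w) sQ sP).
move: bQ; rewrite sum_packing_next // => bQ; apply: leq_trans bQ _.
rewrite leq_mul2l; apply/orP; right; rewrite leq_eqVlt; apply/orP; left; apply/eqP.
have nthP j : (j < n)%N -> val (nth x0 (vertices P) j) = out j.
  move=> hj; rewrite vP (nth_map 0%N) ?size_iota // nth_iota // add0n val_insubd.
  by case: inj => ->.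
by apply: eq_big_nat => j /andP[_ hj]; rewrite !nthP // nx_lt.
Qed.
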